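(* Let $M$ be a noncompact manifold of dimension $\geq3$. Then the map $\overline{Y}_M$ (Yamabe constant at infinity) on $\mathrm{Metr}(M)$ is locally constant (in particular continuous) with respect to the fine $C^2$-topology on $\mathrm{Metr}(M)$.
   Context: Conventions: manifolds are smooth, pure-dimensional, second countable, without boundary, and not necessarily connected. $\mathrm{Metr}(M)$ is the set of smooth Riemannian metrics on $M$. Yamabe constant: for a nonempty $n$-manifold $M$ with $n\geq3$, put $p=\frac{2n}{n-2}$ and $a_n=\frac{4(n-1)}{n-2}$. For $g\in\mathrm{Metr}(M)$ and $v\in C^\infty_c(M,\mathbb{R}_{\geq0})\setminus\{0\}$ let $$E_g(v)=\frac{1}{\|v\|_{L^p(g)}^2}\int_M\big(a_n|dv|_g^2+\mathrm{scal}_g\,v^2\big)\,d\mu_g,$$ where $\mathrm{scal}_g$ is the scalar curvature and $d\mu_g$ the Riemannian density of $g$. The Yamabe constant of $g$ is $Y_M(g)=\inf\{E_g(v) : v\in C_c^\infty(M,\mathbb{R}_{\geq0})\setminus\{0\}\}\in\mathbb{R}\cup\{-\infty\}$. For a nonempty open $U\subseteq M$, $Y_U(g)$ denotes the Yamabe constant of the restriction of $g$ to $U$. Compact exhaustion of $M$: a sequence $(K_i)_{i\in\mathbb{N}}$ of compact subsets of $M$ with union $M$ such that each $K_i$ is contained in the interior of $K_{i+1}$. Yamabe constant at infinity: for $M$ noncompact and $g\in\mathrm{Metr}(M)$, $\overline{Y}_M(g)=\lim_{i\to\infty}Y_{M\setminus K_i}(g)\in\mathbb{R}\cup\{-\infty\}$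 for any compact exhaustion $(K_i)$ of $M$; the limit exists and does not depend on the exhaustion. Fine (strong, Whitney) $C^2$-topology on $\mathrm{Metr}(M)$: let $J^2\mathrm{Sym}^2_+T^*M$ be the 2-jet bundle of the bundle of positive definite symmetric bilinear forms on the tangent spaces of $M$, and for a metric $h$ let $\mathrm{graph}(j^2h)$ be the image of its 2-jet prolongation in the total space. A neighborhood basis at $g$ is given by the sets $\{h\in\mathrm{Metr}(M): \mathrm{graph}(j^2h)\subseteq U\}$, where $U$ ranges over the open neighborhoods of $\mathrm{graph}(j^2g)$ in the total space of $J^2\mathrm{Sym}^2_+T^*M$. *)

(* Defs.v *)
(* Smooth manifolds, Riemannian metrics, Yamabe constants and the fine
   C^2-topology, over MathComp-Analysis. Tensor calculus is done in charts. *)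
From HB Require Import structures.
From mathcomp Require Import all_boot all_order all_algebra.
From mathcomp Require Import all_classical all_reals all_analysis.
Set Implicit Arguments.
Unset Strict Implicit.
Unset Printing Implicit Defensive.
Import Order.TTheory GRing.Theory Num.Theory.
Import numFieldNormedType.Exports.
Local Open Scope classical_set_scope.
Local Open Scope ring_scope.

Section Euclidean.
Variables (R : realType) (n : nat).
Implicit Types (f : 'rV[R]_n -> R) (p : 'rV[R]_n).

Definition partial (a : 'I_n) f p : R := 'D_(delta_mx 0 a : 'rV[R]_n) f p.

Definition partials (s : seq 'I_n) f : 'rV[R]_n -> R := foldr partial f s.

(* C^oo on O, meant for open O: the values of f outside O do not matter. *)
Definition smooth_on (O : set 'rV[R]_n) f : Prop :=
  forall (s : seq 'I_n) p, O p ->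
    {for p, continuous (partials s f)} /\
    forall a : 'I_n, derivable (partials s f) p (delta_mx 0 a : 'rV[R]_n).

Definition christoffel (g : 'rV[R]_n -> 'M[R]_n) (k i j : 'I_n) p : R :=
  2^-1 * \sum_l invmx (g p) k l *
    (partial i (fun q => g q j l) p + partial j (fun q => g q i l) p
     - partial l (fun q => g q i j) p).

Definition ricci (g : 'rV[R]_n -> 'M[R]_n) (i j : 'I_n) p : R :=
  \sum_k (partial k (christoffel g k i j) p - partial j (christoffel g k i k) p)
  + \sum_k \sum_l (christoffel g k k l p * christoffel g l i j p
                   - christoffel g k j l p * christoffel g l i k p).

(* Positive on round spheres. *)
Definition scal (g : 'rV[R]_n -> 'M[R]_n) p : R :=
  \sum_i \sum_j invmx (g p) i j * ricci g i j p.

(* Coordinates of the 2-jet of a matrix-valued function at a point: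
   base point, value, first and second partial derivatives. *)
Definition jet_space : topologicalType :=
  ('rV[R]_n * 'M[R]_n * 'rV['M[R]_n]_n * 'M['M[R]_n]_n)%type.

Definition jet2 (g : 'rV[R]_n -> 'M[R]_n) p : jet_space :=
  (p, g p,
   \row_a \matrix_(i, j) partial a (fun q => g q i j) p,
   \matrix_(a, b) \matrix_(i, j) partials [:: a; b] (fun q => g q i j) p).

End Euclidean.

(* Integral over R^n as an iterated Lebesgue integral; below it is only used for
   continuous compactly supported functions, for which it is the integral
   against n-dimensional Lebesgue measure. *)
Fixpoint integral_Rn (R : realType) (n : nat) : ('rV[R]_n -> R) -> R :=
  match n with
  | 0%N => fun f => f 0
  | m.+1 => fun f => Rintegral (@lebesgue_measure R) setT
      (fun t => @integral_Rn R m
         (fun q => f (row_mx (const_mx t : 'rV[R]_1) q : 'rV[R]_(1 + m))))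
  end.

(* The smooth structure is given by an atlas (chart_idx, chart). [parm i] is the
   inverse of [chart i] on the image of [dom i], and arbitrary elsewhere. *)
Record manifold (R : realType) (n : nat) := Manifold {
  carrier :> topologicalType;
  chart_idx : choiceType;
  dom : chart_idx -> set carrier;
  chart : chart_idx -> carrier -> 'rV[R]_n;
  parm : chart_idx -> 'rV[R]_n -> carrier;
  manifold_hausdorff : hausdorff_space carrier;
  manifold_second_countable : @second_countable carrier;
  dom_cover : forall x, exists i, dom i x;
  dom_open : forall i, open (dom i);
  chart_open : forall i, open (chart i @` dom i);
  chartK : forall i x, dom i x -> parm i (chart i x) = x;
  chart_continuous : forall i x, dom i x -> {for x, continuous (chart i)};
  parm_continuous : forall i x, dom i x ->
    {for chart i x, continuous (parm i)};
  transition_smooth : forall i j (b : 'I_n),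
    smooth_on (chart i @` (dom i `&` dom j))
              (fun p => chart j (parm i p) 0 b) }.

Section Manifold.
Variables (R : realType) (n : nat) (M : manifold R n).
Implicit Types (U V : set M) (i j : chart_idx M) (v : M -> R).

Definition cdom U i : set 'rV[R]_n := chart i @` (dom i `&` U).

Lemma sub_cdom U V i : V `<=` U -> cdom V i `<=` cdom U i.
Proof. by move=> VU; apply: image_subset; apply: setIS. Qed.

(* Riemannian metrics on the open submanifold U of M: one component matrix per
   chart, with the transformation law of covariant 2-tensors. The components
   are only meaningful on [cdom U i]. *)
Record riem U := Riem {
  comp :> chart_idx M -> 'rV[R]_n -> 'M[R]_n;
  comp_smooth : forall i (a b : 'I_n),
    smooth_on (cdom U i) (fun p => comp i p a b);
  comp_sym : forall i p, cdom U i p -> (comp i p)^T = comp i p;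
  comp_pos : forall i p, cdom U i p ->
    forall w : 'rV[R]_n, w != 0 -> 0 < (w *m comp i p *m w^T) 0 0;
  comp_law : forall i j x, dom i x -> dom j x -> U x ->
    let J := jacobian (fun p => chart j (parm i p)) (chart i x) in
    comp i (chart i x) = J *m comp j (chart j x) *m J^T }.

Definition riem_restrict U V (VU : V `<=` U) (g : riem U) : riem V :=
  @Riem V g
    (fun i a b s p Vp => @comp_smooth U g i a b s p (sub_cdom VU Vp))
    (fun i p Vp => @comp_sym U g i p (sub_cdom VU Vp))
    (fun i p Vp => @comp_pos U g i p (sub_cdom VU Vp))
    (fun i j x ix jx Vx => @comp_law U g i j x ix jx (VU x Vx)).

(* Continuous partitions of unity subordinate to the atlas, indexed like it. *)
Definition partition_of_unity (chi : chart_idx M -> M -> R) : Prop :=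
  [/\ forall i, continuous (chi i),
      forall i x, 0 <= chi i x,
      forall i, closure [set x | chi i x != 0] `<=` dom i,
      forall x : M, exists2 N, nbhs x N &
        finite_set [set i | N `&` [set y | chi i y != 0] !=set0] &
      forall x, \sum_(i \in [set: chart_idx M]) chi i x = 1].

Definition pou : chart_idx M -> M -> R :=
  xget (fun _ _ => 0) [set chi | partition_of_unity chi].

(* Integral over U, against the Riemannian density of g, of the function on U
   whose expression in the chart i is f i; meant for continuous functions with
   compact support in U, for which the sum has finite support and does not depend
   on the partition of unity. *)
Definition integral_riem U (g : riem U) (f : chart_idx M -> 'rV[R]_n -> R) : R :=
  \sum_(i \in [set: chart_idx M]) integral_Rn
    ((fun p => pou i (parm i p) * f i p * Num.sqrt (\det (g i p))) \_ (cdom U i)).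

(* C^oo_c(U, R_{>=0}) \ {0}; functions on U are represented by functions on M
   whose values outside U do not matter. *)
Definition test_fun U : set (M -> R) := [set v : M -> R |
  [/\ forall i, smooth_on (cdom U i) (v \o parm i),
      exists K, [/\ compact K, K `<=` U & forall x, U x -> ~ K x -> v x = 0],
      forall x, U x -> 0 <= v x &
      exists2 x, U x & v x != 0]].

Definition a_ : R := 4 * (n%:R - 1) / (n%:R - 2).
Definition p_ : R := 2 * n%:R / (n%:R - 2).

Definition norm_d2 U (g : riem U) v i (q : 'rV[R]_n) : R :=
  \sum_a \sum_b invmx (g i q) a b *
    partial a (v \o parm i) q * partial b (v \o parm i) q.

Definition Lp_norm U (g : riem U) v : R :=
  integral_riem g (fun i q => `|v (parm i q)| `^ p_) `^ p_^-1.

Definition yamabe_energy U (g : riem U) v : R :=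
  integral_riem g (fun i q =>
    a_ * norm_d2 g v i q + scal (g i) q * v (parm i q) ^+ 2)
  / Lp_norm g v ^+ 2.

Definition yamabe U (g : riem U) : \bar R :=
  ereal_inf [set (yamabe_energy g v)%:E | v in test_fun U].

Definition Metr : Type := riem [set: M].

Definition compact_exhaustion (K : nat -> set M) : Prop :=
  [/\ forall k, compact (K k), \bigcup_k K k = setT &
      forall k, K k `<=` interior (K k.+1)].

(* The common limit along all compact exhaustions. *)
Definition yamabe_infty (g : Metr) : \bar R :=
  xget -oo%E [set l | forall K, compact_exhaustion K ->
    yamabe (riem_restrict (@subsetT _ (~` K k)) g) @[k --> \oo] --> l].

Definition jet_coord U (h : riem U) (x : M) i : option (jet_space R n) :=
  if `[< dom i x >] then Some (jet2 (h i) (chart i x)) else None.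

(* Total space of the bundle of 2-jets of Riemannian metrics: a 2-jet at x is
   given by its coordinates in all charts around x, and comes from a metric
   defined near x. *)
Record jet := Jet {
  jet_base : M;
  jet_val : chart_idx M -> option (jet_space R n);
  jet_valP : exists (V : set M) (h : riem V),
    [/\ open V, V jet_base & jet_val = jet_coord h jet_base] }.

HB.instance Definition _ := gen_eqMixin jet.
HB.instance Definition _ := gen_choiceMixin jet.

Definition jet_box i (O : set (jet_space R n)) : set jet :=
  [set J | exists2 c, jet_val J i = Some c & O c].

(* The topology generated by the preimages of open sets under the bundle
   charts. *)
HB.instance Definition _ := @isSubBaseTopological.Build jet (set jet)
  [set B | exists i O, open O /\ B = jet_box i O] id.

Definition j2 (h : Metr) (x : M) : jet :=
  @Jet x (jet_coord h x)
    (ex_intro _ setT (ex_intro _ h (And3 openT (I : setT x) erefl))).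

Definition graph_j2 (h : Metr) : set jet := range (j2 h).

Definition fine_nbhs (g : Metr) : set_system Metr := [set A : set Metr |
  exists2 W : set jet, open W /\ graph_j2 g `<=` W &
    [set h | graph_j2 h `<=` W] `<=` A].

HB.instance Definition _ := gen_eqMixin Metr.
HB.instance Definition _ := gen_choiceMixin Metr.
HB.instance Definition _ := hasNbhs.Build Metr fine_nbhs.

Lemma fine_nbhs_filter (g : Metr) : ProperFilter (nbhs g).
Proof.
apply: Build_ProperFilter_ex.
  by move=> A [W [_ gW] WA]; exists g; apply: WA.
split.
- by exists setT => //; split=> //; exact: openT.
- move=> A B [W [oW gW] WA] [W' [oW' gW'] WB].
  exists (W `&` W'); first by split; [exact: openI | rewrite subsetI].
  by move=> h; rewrite /= subsetI => -[hW hW']; split; [exact: WA | exact: WB].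
- by move=> A B AB [W gW WA]; exists W => //; exact: subset_trans AB.
Qed.

Lemma fine_nbhs_singleton (g : Metr) (A : set Metr) : nbhs g A -> A g.
Proof. by move=> [W [_ gW] WA]; apply: WA. Qed.

Lemma fine_nbhs_nbhs (g : Metr) (A : set Metr) :
  nbhs g A -> nbhs g (nbhs^~ A).
Proof. by move=> [W [oW gW] WA]; exists W => // h hW; exists W. Qed.

(* The fine C^2-topology. *)
HB.instance Definition _ := Nbhs_isNbhsTopological.Build Metr
  fine_nbhs_filter fine_nbhs_singleton fine_nbhs_nbhs.

End Manifold.

(* Main.v *)
(* On the complements of large compact sets, the Yamabe energies of g and of a
   nearby metric h are compared by passing from a test function v to
   w = (1 - eps) v, where eps = sum_m c_m phi_m^2 is smooth, positive and decays
   as fast as we like. If h is eps-close to g, then the gain in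
   |dw|^2 <= (1 - eps/2) |dv|^2 + C v^2 sum_m c_m |d phi_m|^2
   absorbs the difference between the Dirichlet terms of g and h, which the
   energy does not control, the scalar curvature being unbounded. All other
   errors are integrals of c_m psi_m v^2 with psi_m continuous of compact support
   depending only on g, so they are small multiples of ||v||_p^2. The estimate is
   symmetric in g and h; hence along every exhaustion the two sequences of Yamabe
   constants have the same limits, and neither the existence nor the uniqueness
   of the limit has to be known. *)

(* The order of choices is what makes the estimate work. The functions [phi m], their supports and
   the constants [B m] are fixed from [g] alone; then [c m] is taken small against [B m] and against
   a bound of [phi m ^+ 2]; only then is the neighborhood of [g] cut out, by asking that at each
   point [h] be close to [g] at the rate [c m * phi m ^+ 2] for some [m]. The squares matter because
   d eps is the sum of [2 * c m * phi m] times d phi_m. Each pairing with dv splits into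
   [c m * phi m ^+ 2] |dv|^2, which sums to eps |dv|^2, and [c m] |d phi_m|^2 v^2, so that nothing
   is ever divided by eps. Integrals for [g] and [h] are compared as integrands, chart by chart,
   under one and the same partition of unity. Far out only indices from some [mk] on survive, so the
   errors have size 2^-mk for all test functions at once. The comparison of quotients also produces
   2^-mk times the energy level itself; therefore Yamabe constants are compared at fixed real levels
   [e < e'], a form that also covers the limit -oo. *)
Require Import Defs.
From mathcomp Require Import all_boot all_order all_algebra.
From mathcomp Require Import all_classical all_reals all_analysis.
From mathcomp Require Import ring lra.
Set Implicit Arguments.
Unset Strict Implicit.
Unset Printing Implicit Defensive.
Import Order.TTheory GRing.Theory Num.Theory.
Import numFieldNormedType.Exports.
Local Open Scope classical_set_scope.
Local Open Scope ring_scope.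

(** * Smooth functions on R^n *)

Section Ck.
Variables (R : realType) (n : nat).
Implicit Types (O : set 'rV[R]_n) (f g : 'rV[R]_n -> R) (p : 'rV[R]_n).

(** Recursion on the order lets each closure property follow from one product or chain rule and the
    induction hypothesis for the first derivatives. *)
Fixpoint Ck (k : nat) O f : Prop :=
  (forall p, O p -> {for p, continuous f}) /\
  match k with
  | 0%N => True
  | k'.+1 => (forall p (a : 'I_n), O p ->
                derivable f p (delta_mx 0 a : 'rV[R]_n)) /\
             forall a, Ck k' O (partial a f)
  end.

Lemma smooth_onP O f : smooth_on O f <-> forall k, Ck k O f.
Proof.
split=> [sf k|Cf s p Op].
  elim: k f sf => [|k IH] f sf /=.
    by split=> // p Op; have [] := sf [::] p Op.
  split; first by move=> p Op; have [] := sf [::] p Op.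
  split; first by move=> p a Op; have [_] := sf [::] p Op; exact.
  move=> a; apply: IH => s p Op.
  by have := sf (rcons s a) p Op; rewrite /partials !foldr_rcons.
(* [partials] applies the last index of the list first, and this is the derivative that [Ck] peels
   off; hence the induction from the end. *)
elim/last_ind: s f Cf => [|s a IH] f Cf.
  split; first by have [+ _] := Cf 0%N; apply.
  by move=> a; have [_ [+ _]] := Cf 1%N; apply.
rewrite /partials !foldr_rcons; apply: IH => k.
by have [_ [_]] := Cf k.+1; apply.
Qed.

Lemma partials_rcons (s : seq 'I_n) a f :
  partials (rcons s a) f = partials s (partial a f).
Proof. by rewrite /partials foldr_rcons. Qed.

Lemma smooth_partial O f a : smooth_on O f -> smooth_on O (partial a f).
Proof. by move=> sf s p Op; rewrite -partials_rcons; exact: sf. Qed.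

Lemma smooth_cont O f p : smooth_on O f -> O p -> {for p, continuous f}.
Proof. by move=> sf /(sf [::]) []. Qed.

Lemma smooth_derivable O f p a : smooth_on O f -> O p ->
  derivable f p (delta_mx 0 a : 'rV[R]_n).
Proof. by move=> sf /(sf [::]) [_]. Qed.

Lemma partial_near f g p a : (\near p, f p = g p) -> partial a f p = partial a g p.
Proof. by move=> fg; rewrite /partial; exact: near_eq_derive. Qed.

Lemma open_eq_near (T : topologicalType) (U : Type) (A : set T) (f g : T -> U) (p : T) :
  open A -> {in A, f =1 g} -> A p -> \near p, f p = g p.
Proof.
move=> oA fg Ap; near=> x; apply: fg; rewrite inE; near: x.
exact: open_nbhs_nbhs.
Unshelve. all: by end_near. Qed.

Lemma near_cont (T U : topologicalType) (f g : T -> U) (p : T) :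
  (\near p, f p = g p) -> {for p, continuous f} -> {for p, continuous g}.
Proof.
move=> fg cf; rewrite /prop_for /continuous_at -(nbhs_singleton fg).
by apply: cvg_trans cf; exact: near_eq_cvg.
Qed.

Lemma Ck_eq k O f g : open O -> {in O, f =1 g} -> Ck k O f -> Ck k O g.
Proof.
move=> oO; elim: k f g => [|k IH] f g fg [cf df]; split.
- by move=> p Op; apply: near_cont (cf _ Op); exact: open_eq_near Op.
- by [].
- by move=> p Op; apply: near_cont (cf _ Op); exact: open_eq_near Op.
- case: df => df pf; split.
    move=> p a Op; apply: near_eq_derivable (df _ a Op).
    exact: open_eq_near Op.
  move=> a; apply: IH (pf a) => p; rewrite inE => Op.
  by apply: partial_near; exact: open_eq_near Op.
Qed.

Lemma CkW k O f : Ck k.+1 O f -> Ck k O f.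
Proof.
elim: k f => [|k IH] f /= [cf [df pf]]; split=> //; split=> // a.
exact: IH (pf a).
Qed.

Lemma Ck_cst k O c : Ck k O (cst c : 'rV[R]_n -> R).
Proof.
elim: k c => [|k IH] c; split=> //; try by move=> p _; exact: cst_continuous.
split; first by move=> *; exact: derivable_cst.
move=> a; have -> : partial a (cst c : 'rV[R]_n -> R) = cst 0 by
  apply/funext => p; rewrite /partial derive_cst.
exact: IH.
Qed.

Lemma Ck_add k O f g : open O -> Ck k O f -> Ck k O g -> Ck k O (f + g).
Proof.
move=> oO; elim: k f g => [|k IH] f g [cf df] [cg dg]; split.
- by move=> p Op; apply: continuousD; [exact: cf|exact: cg].
- by [].
- by move=> p Op; apply: continuousD; [exact: cf|exact: cg].
- case: df dg => df pf [dg pg]; split.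
    by move=> p a Op; apply: derivableD; [exact: df|exact: dg].
  move=> a; apply: Ck_eq (IH _ _ (pf a) (pg a)) => // p; rewrite inE => Op.
  by rewrite /partial deriveD //; [exact: df|exact: dg].
Qed.

Lemma Ck_mul k O f g : open O -> Ck k O f -> Ck k O g -> Ck k O (f * g).
Proof.
move=> oO; elim: k f g => [|k IH] f g Cf Cg; move: (Cf) (Cg) => [cf df] [cg dg]; split.
- by move=> p Op; apply: continuousM; [exact: cf|exact: cg].
- by [].
- by move=> p Op; apply: continuousM; [exact: cf|exact: cg].
- case: df dg => df pf [dg pg]; split.
    by move=> p a Op; apply: derivableM; [exact: df|exact: dg].
  move=> a.
  have := Ck_add oO (IH _ _ (CkW Cf) (pg a)) (IH _ _ (CkW Cg) (pf a)).
  apply: Ck_eq => // p; rewrite inE => Op.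
  by rewrite /partial deriveM //; [exact: df|exact: dg].
Qed.

(** On the line through [p] in direction [v] this is the one-variable chain rule; derivability of
    [f] along that line suffices. *)
Lemma is_derive_comp1 (F : R -> R) f p (v : 'rV[R]_n) dF :
  derivable f p v -> is_derive (f p) (1:R) F dF ->
  derivable (F \o f) p v /\ 'D_v (F \o f) p = dF * 'D_v f p.
Proof.
move=> df dFp; pose h := fun t : R => f (t *: v + p).
have h0 : h 0 = f p by rewrite /h scale0r add0r.
have E (g : 'rV[R]_n -> R) : 'D_v g p = 'D_1 (fun t : R => g (t *: v + p)) 0.
  rewrite /derive; set g1 := fun h => h^-1 *: _; set g2 := fun h => h^-1 *: _.
  suff -> : g1 = g2 by [].
  by apply/funext => t; rewrite /g1 /g2 /= addr0 scale0r add0r [_%:A]mulr1.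
have dh : is_derive (0:R) (1:R) h ('D_v f p).
  by rewrite E; apply: derivableP; exact: (derivable1P _ _ _).1 df.
have dFh : is_derive (h 0) (1:R) F dF by rewrite h0.
have [d1 d2] := is_derive1_comp dFh dh.
split; first by apply: (derivable1P _ _ _).2; exact: d1.
by rewrite E; exact: d2.
Qed.

(** [B] lists the successive derivatives of the outer function. Quantifying over [j] in the
    conclusion closes the induction, since differentiating [B j \o f] produces [B j.+1 \o f]. *)
Lemma Ck_comp1 (B : nat -> R -> R) (D : set R) k O f :
  open O -> (forall j x, D x -> is_derive x (1:R) (B j) (B j.+1 x)) ->
  (forall p, O p -> D (f p)) -> Ck k O f -> forall j, Ck k O (B j \o f).
Proof.
move=> oO dB Df.
have cB j x : D x -> {for x, continuous (B j)}.
  move=> /(dB j) [dBx _]; apply: differentiable_continuous.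
  exact/derivable1_diffP.
elim: k => [|k IH] Cf j; move: (Cf) => [cf df].
  by split=> // p Op; apply: continuous_comp; [exact: cf|exact/cB/Df].
split; first by move=> p Op; apply: continuous_comp; [exact: cf|exact/cB/Df].
case: df => df pf; split.
  by move=> p a Op; have [] := is_derive_comp1 (df _ a Op) (dB j _ (Df _ Op)).
move=> a; have := Ck_mul oO (IH (CkW Cf) j.+1) (pf a).
apply: Ck_eq => // p; rewrite inE => Op; rewrite {2}/partial.
by have [_ ->] := is_derive_comp1 (df _ a Op) (dB j _ (Df _ Op)).
Qed.

(** The derivative of 1/f is -(1/f)^2 times that of [f], and the induction hypothesis already covers
    1/f at the lower order. *)
Lemma Ck_inv k O f : open O -> (forall p, O p -> f p != 0) ->
  Ck k O f -> Ck k O (fun p => (f p)^-1).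
Proof.
move=> oO f0; elim: k => [|k IH] Cf; move: (Cf) => [cf df].
  by split=> // p Op; apply: continuousV; [exact: f0|exact: cf].
split; first by move=> p Op; apply: continuousV; [exact: f0|exact: cf].
case: df => df pf; split.
  by move=> p a Op; apply: derivableV; [exact: f0|exact: df].
move=> a.
have Ci := IH (CkW Cf).
have := Ck_mul oO (Ck_cst k O (-1)) (Ck_mul oO (Ck_mul oO Ci Ci) (pf a)).
apply: Ck_eq => // p; rewrite inE => Op.
rewrite /partial deriveV; [|exact: f0|exact: df].
by rewrite !fctE /= mulN1r expr2 invfM /GRing.scale /= mulNr.
Qed.

Section Smooth.
Variables (O : set 'rV[R]_n) (oO : open O).

Lemma smooth_eq f g : {in O, f =1 g} -> smooth_on O f -> smooth_on O g.
Proof. by move=> fg /smooth_onP Cf; apply/smooth_onP => k; exact: Ck_eq (Cf k). Qed.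

Lemma smooth_cst c : smooth_on O (cst c : 'rV[R]_n -> R).
Proof. by apply/smooth_onP => k; exact: Ck_cst. Qed.

Lemma smooth_add f g : smooth_on O f -> smooth_on O g ->
  smooth_on O (fun p => f p + g p).
Proof.
by move=> /smooth_onP Cf /smooth_onP Cg; apply/smooth_onP => k; exact: Ck_add.
Qed.

Lemma smooth_mul f g : smooth_on O f -> smooth_on O g ->
  smooth_on O (fun p => f p * g p).
Proof.
by move=> /smooth_onP Cf /smooth_onP Cg; apply/smooth_onP => k; exact: Ck_mul.
Qed.

Lemma smooth_inv f : (forall p, O p -> f p != 0) -> smooth_on O f ->
  smooth_on O (fun p => (f p)^-1).
Proof.
by move=> f0 /smooth_onP Cf; apply/smooth_onP => k; exact: Ck_inv.
Qed.

Lemma smooth_comp1 (B : nat -> R -> R) (D : set R) f :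
  (forall j x, D x -> is_derive x (1:R) (B j) (B j.+1 x)) ->
  (forall p, O p -> D (f p)) -> smooth_on O f -> smooth_on O (B 0%N \o f).
Proof.
move=> dB Df /smooth_onP Cf; apply/smooth_onP => k.
by apply: (@Ck_comp1 B D).
Qed.

Lemma smooth_opp f : smooth_on O f -> smooth_on O (fun p => - f p).
Proof.
move=> sf; apply: smooth_eq (smooth_mul (smooth_cst (-1)) sf) => p _ /=.
by rewrite mulN1r.
Qed.

Lemma smooth_sub f g : smooth_on O f -> smooth_on O g ->
  smooth_on O (fun p => f p - g p).
Proof. by move=> sf sg; exact: (smooth_add sf (smooth_opp sg)). Qed.

Lemma smooth_sum (I : Type) (r : seq I) (P : pred I) (F : I -> 'rV[R]_n -> R) :
  (forall i, P i -> smooth_on O (F i)) ->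
  smooth_on O (fun p => \sum_(i <- r | P i) F i p).
Proof.
move=> sF; elim: r => [|i r IH].
  by apply: smooth_eq (smooth_cst 0) => p _; rewrite big_nil.
have [Pi|Pi] := boolP (P i).
  by apply: smooth_eq (smooth_add (sF _ Pi) IH) => p _; rewrite big_cons Pi.
by apply: smooth_eq IH => p _; rewrite big_cons (negbTE Pi).
Qed.

Lemma smooth_prod (I : Type) (r : seq I) (P : pred I) (F : I -> 'rV[R]_n -> R) :
  (forall i, P i -> smooth_on O (F i)) ->
  smooth_on O (fun p => \prod_(i <- r | P i) F i p).
Proof.
move=> sF; elim: r => [|i r IH].
  by apply: smooth_eq (smooth_cst 1) => p _; rewrite big_nil.
have [Pi|Pi] := boolP (P i).
  by apply: smooth_eq (smooth_mul (sF _ Pi) IH) => p _; rewrite big_cons Pi.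
by apply: smooth_eq IH => p _; rewrite big_cons (negbTE Pi).
Qed.

End Smooth.

Lemma smooth_sub_on O O' f : O' `<=` O -> smooth_on O f -> smooth_on O' f.
Proof. by move=> sO sf s p /sO Op; exact: sf. Qed.

Lemma smooth_local O f : (forall p, O p -> exists O', [/\ open O', O' p &
  smooth_on O' f]) -> smooth_on O f.
Proof. by move=> H s p /H[V [_ Vp sf]]; exact: sf. Qed.

End Ck.

(** * Flat functions of one variable *)

Section Flat.
Variable R : realType.
Implicit Types (q : {poly R}) (x y : R).

Definition flat q x : R := if 0 < x then q.[x^-1] * expR (- x^-1) else 0.

(** Termwise from y^k <= k! exp y, which keeps a single term of the exponential series. *)
Lemma poly_le_exp q : exists2 C, 0 <= C & forall y, 0 <= y -> `|q.[y]| <= C * expR y.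
Proof.
elim/poly_ind: q => [|q c _].
  by exists 0 => // y _; rewrite horner0 normr0 mul0r.
move: (q * 'X + c%:P) => {q c}q.
exists (\sum_(i < size q) `|q`_i| * i`!%:R) => [|y y0].
  by apply: sumr_ge0 => i _; rewrite mulr_ge0.
rewrite horner_coef mulr_suml (le_trans (ler_norm_sum _ _ _))// ler_sum// => i _.
rewrite normrM -mulrA ler_wpM2l// ger0_norm ?exprn_ge0//.
case: (nat_of_ord i) => [|k].
  by rewrite expr0 fact0 mul1r -{1}expR0 ler_expR.
have k0 : 0 < (k.+1)`!%:R :> R by rewrite ltr0n fact_gt0.
rewrite -ler_pdivrMl // mulrC.
by apply: le_trans (expR_ge1Dxn k y0); rewrite ler_wpDl.
Qed.

(** The exponential bound for [q * 'X^2] yields decay of order x^2, enough for the difference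
    quotient at 0 to tend to 0. *)
Lemma flat_le q : exists2 C, 0 <= C & forall x, `|flat q x| <= C * x ^+ 2.
Proof.
have [C C0 qC] := poly_le_exp (q * 'X^2); exists C => // x.
rewrite /flat; case: ifPn => [x0|_]; last by rewrite normr0 mulr_ge0 ?sqr_ge0.
have H : `|(q * 'X^2).[x^-1]| <= C * expR x^-1 by apply: qC; rewrite ltW// invr_gt0.
rewrite hornerM hornerXn normrM [`|x^-1 ^+ 2|]ger0_norm ?sqr_ge0// in H.
rewrite normrM [`|expR _|]ger0_norm ?expR_ge0// expRN.
rewrite ler_pdivrMr ?expR_gt0// -mulrA [x ^+ 2 * _]mulrC mulrA.
by rewrite -ler_pdivrMr ?exprn_gt0// -exprVn.
Qed.

Lemma is_derive_flat q x : is_derive x (1:R) (flat q) (flat ('X^2 * (q - q^`())) x).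
Proof.
have [x0|x0|->] := ltgtP x 0.
- rewrite [X in is_derive _ _ _ X](_ : _ = 0); last first.
    by rewrite /flat ltNge ltW.
  apply: near_eq_is_derive (is_derive_cst (0:R) x (1:R)).
  near=> z; rewrite /flat ifN//= -leNgt ltW//; near: z.
  exact: lt_nbhsl.
- rewrite [X in is_derive _ _ _ X](_ : _ = ('X^2 * (q - q^`())).[x^-1] * expR (- x^-1)); last first.
    by rewrite /flat x0.
  apply: (@near_eq_is_derive _ _ _ ((fun z => q.[z^-1]) * (fun z => expR (- z^-1)))).
    near=> z; rewrite /flat ifT//; near: z.
    exact: lt_nbhsr.
  have di : is_derive x (1:R) (fun z : R => z^-1) (- x^-2).
    have dx : derivable (@id R) x 1 by exact: derivable_id.
    have xn0 : id x != 0 by rewrite /= gt_eqF.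
    apply: DeriveDef; first exact: derivableV.
    by rewrite (deriveV xn0 dx) derive_id /GRing.scale /= mulr1.
  have d1 : is_derive x (1:R) (horner q \o (fun z : R => z^-1)) (q^`().[x^-1] * - x^-2).
    exact: is_derive1_comp.
  have d2 : is_derive x (1:R) (expR \o (fun z : R => - z^-1)) (expR (- x^-1) * x^-2).
    apply: is_derive1_comp => //.
      rewrite -[x^-2]opprK; exact: is_deriveN.
  apply: is_derive_eq (is_deriveM d1 d2) _.
  rewrite /= /GRing.scale /= hornerM hornerXn hornerD hornerN -!exprVn; ring.
- have F0 g : flat g 0 = 0 by rewrite /flat ltxx.
  rewrite F0; have [C C0 qC] := flat_le q.
  have cv : (fun h => h^-1 *: ((flat q \o shift 0) (h *: (1:R)) - flat q 0)) @ 0^' --> (0:R).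
    apply/cvgrPdist_le => e e0; near=> h.
    rewrite /= F0 subr0 sub0r normrN addr0 [h%:A]mulr1 /GRing.scale /= normrM normfV.
    have h0 : h != 0 by near: h; exact: nbhs_dnbhs_neq.
    rewrite ler_pdivrMl ?normr_gt0// (le_trans (qC h))//.
    rewrite -real_normK ?num_real// mulrC expr2 -mulrA ler_wpM2l//.
    (* [flat_le] bounds the difference quotient by C|h|; [C + 1] keeps the denominator positive when
       [C] is 0. *)
    have : `|h| <= e / (C + 1).
      near: h; apply: dnbhs0_le.
      by rewrite divr_gt0// ltr_wpDl.
    rewrite ler_pdivlMr ?ltr_wpDl//; apply: le_trans.
    by rewrite ler_wpM2l// lerDl.
  apply: DeriveDef; first by apply/cvg_ex; exists 0; exact: cv.
  exact/cvg_lim.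
Unshelve. all: by end_near. Qed.

Definition flat_der (k : nat) : R -> R :=
  flat (iter k (fun q => 'X^2 * (q - q^`())) 1).

Lemma is_derive_flat_der k x :
  is_derive x (1:R) (flat_der k) (flat_der k.+1 x).
Proof. exact: is_derive_flat. Qed.

Lemma flat_der0_gt0 x : 0 < x -> 0 < flat_der 0 x.
Proof. by move=> x0; rewrite /flat_der /flat x0 hornerC mul1r expR_gt0. Qed.

Lemma flat_der0_ge0 x : 0 <= flat_der 0 x.
Proof. by rewrite /flat_der /flat; case: ifP => // _; rewrite hornerC mul1r expR_ge0. Qed.

Lemma flat_der0_eq0 x : x <= 0 -> flat_der 0 x = 0.
Proof. by move=> x0; rewrite /flat_der /flat ltNge x0. Qed.

End Flat.

(** * Iterated integrals of continuous functions with compact support *)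

Section IntegralRn.
Variable R : realType.
Implicit Types (n : nat) (A C t : R).

(** Cubes are used because the slices of a function supported in a cube are supported in the cube of
    the same size, one dimension lower. *)
Definition in_box n A (f : 'rV[R]_n -> R) : Prop :=
  forall p, f p != 0 -> forall j, `|p 0 j| <= A.

Definition Cc n (f : 'rV[R]_n -> R) : Prop := continuous f /\ exists A, in_box A f.

Lemma in_boxW n A A' (f : 'rV[R]_n -> R) : A <= A' -> in_box A f -> in_box A' f.
Proof. by move=> AA bf p /bf fp j; exact: le_trans AA. Qed.

Lemma in_boxD n A (f g : 'rV[R]_n -> R) :
  in_box A f -> in_box A g -> in_box A (fun p => f p + g p).
Proof.
move=> bf bg p; have [->|/bf//] := eqVneq (f p) 0.
by rewrite add0r; exact: bg.
Qed.

Lemma in_box0 n A (f : 'rV[R]_n -> R) (p : 'rV[R]_n) : in_box A f -> (exists j, A < `|p 0 j|) ->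
  f p = 0.
Proof.
move=> bf [j]; rewrite ltNge => /negP pj.
by apply/eqP/negP => /negP fp; apply/pj/bf.
Qed.

Lemma CcD n (f g : 'rV[R]_n -> R) : Cc f -> Cc g -> Cc (fun p => f p + g p).
Proof.
move=> [cf [A bf]] [cg [B bg]]; split.
  by move=> p; apply: continuousD; [exact: cf|exact: cg].
exists (Num.max A B); apply: in_boxD; apply: in_boxW; [|exact: bf| |exact: bg].
  by rewrite le_max lexx.
by rewrite le_max lexx orbT.
Qed.

Lemma CcZ n (c : R) (f : 'rV[R]_n -> R) : Cc f -> Cc (fun p => c * f p).
Proof.
move=> [cf [A bf]]; split.
  by move=> p; apply: continuousM; [exact: cst_continuous|exact: cf].
by exists A => p; rewrite mulf_eq0 negb_or => /andP[_ /bf].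
Qed.

Definition slice n (f : 'rV[R]_(1 + n) -> R) t : 'rV[R]_n -> R :=
  fun q => f (row_mx (const_mx t : 'rV[R]_1) q).

Lemma row_mx_continuous n :
  continuous (fun tq : R * 'rV[R]_n => row_mx (const_mx tq.1 : 'rV[R]_1) tq.2).
Proof.
move=> [t q] /= S /nbhs_ballP[e e0 eS]; apply/nbhs_ballP; exists e => //= -[s r] /= [ts qr].
apply: eS; split=> // i j; rewrite !mxE.
by case: splitP => k _; [rewrite !mxE|have [_] := qr; exact].
Qed.

Lemma slice_joint_cvg n (f : 'rV[R]_(1 + n) -> R) t q e : continuous f -> 0 < e ->
  \forall s \near nbhs t & r \near nbhs q, `|slice f t q - slice f s r| < e.
Proof.
move=> cf e0.
have cu : {for (t, q), continuous
    (f \o (fun tq : R * 'rV[R]_n => row_mx (const_mx tq.1 : 'rV[R]_1) tq.2))}.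
  by apply: continuous_comp; [exact: row_mx_continuous|exact: cf].
by have /cvgrPdist_lt/(_ e e0) := cu.
Qed.

Lemma slice_continuous n (f : 'rV[R]_(1 + n) -> R) t : continuous f ->
  continuous (slice f t).
Proof.
move=> cf q; have cr : {for q, continuous (fun q : 'rV[R]_n => row_mx (const_mx t : 'rV[R]_1) q)}.
  move=> S /= /nbhs_ballP[e e0 eS]; apply/nbhs_ballP; exists e => //= r qr.
  apply: eS; split=> // i j; rewrite !mxE.
  by case: splitP => k _; [exact: ballxx|have [_] := qr; exact].
exact: continuous_comp cr (cf _).
Qed.

Lemma in_box_slice n A (f : 'rV[R]_(1 + n) -> R) t : in_box A f ->
  in_box A (slice f t).
Proof.
move=> bf q /bf bq j; have := bq (rshift 1 j).
by rewrite row_mxEr.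
Qed.

Lemma slice_out n A (f : 'rV[R]_(1 + n) -> R) t : in_box A f -> A < `|t| ->
  slice f t = fun=> 0.
Proof.
move=> bf At; apply/funext => q; apply: in_box0 bf _.
by exists (lshift n 0); rewrite row_mxEl mxE.
Qed.

Lemma Cc_slice n (f : 'rV[R]_(1 + n) -> R) t : Cc f -> Cc (slice f t).
Proof.
move=> [cf [A bf]]; split; first exact: slice_continuous.
by exists A; exact: in_box_slice.
Qed.

Lemma box_compact n A : compact [set p : 'rV[R]_n | forall j, `|p 0 j| <= A].
Proof.
rewrite (_ : mkset _ = [set v : 'rV[R]_n | forall i, `[- A, A]%classic (v ord0 i)]).
  by apply: (@rV_compact _ _ (fun=> `[- A, A]%classic)) => _; exact: segment_compact.
apply/seteqP; split => p /= pA j.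
  by rewrite in_itv /= -ler_norml.
by rewrite ler_norml; have := pA j; rewrite in_itv.
Qed.

(** Compactness of the cube turns joint continuity into uniformity in [q]; off the cube both slices
    vanish. This is what makes the inner integral continuous in [t]. *)
Lemma slice_unif n A (f : 'rV[R]_(1 + n) -> R) t e : continuous f -> in_box A f ->
  0 < e -> \forall s \near t, forall q, `|slice f t q - slice f s q| <= e.
Proof.
move=> cf bf e0.
have := @box_compact n A => /compact_near_coveringP.
move=> /(_ R (nbhs t) (fun s q => `|slice f t q - slice f s q| <= e)) H.
have {}H : \forall s \near t,
    [set p : 'rV[R]_n | forall j, `|p 0 j| <= A] `<=`
    (fun q => `|slice f t q - slice f s q| <= e).
  apply: H => q _.
  have e20 : 0 < e / 2 by rewrite divr_gt0.
  have [[P Q] /= [Pt Qq] PQ] := slice_joint_cvg t q cf e20.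
  exists (Q, P) => //= -[r s] /= [Qr Ps].
  have h1 := PQ (s, r) (conj Ps Qr).
  have h2 := PQ (t, r) (conj (nbhs_singleton Pt) Qr).
  rewrite /= in h1 h2.
  rewrite [e]splitr (le_trans (ler_distD (slice f t q) _ _))// lerD//; last exact: ltW.
  by rewrite distrC ltW.
apply: filterS H => s H q.
have [qA|] := pselect (forall j, `|q 0 j| <= A); first exact: H.
move=> /existsNP[j /negP]; rewrite -ltNge => Aq.
rewrite (@in_box0 _ A (slice f t)); [|exact: in_box_slice|by exists j].
rewrite (@in_box0 _ A (slice f s)); [|exact: in_box_slice|by exists j].
by rewrite subrr normr0 ltW.
Qed.

Lemma compact_support_integrable A (F : R -> R) : continuous F ->
  (forall t, A < `|t| -> F t = 0) ->
  (@lebesgue_measure R).-integrable setT (EFin \o F).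
Proof.
move=> cF F0.
have -> : EFin \o F = (EFin \o F) \_ `[- A, A]%classic.
  apply/funext => t; rewrite patchE; case: ifPn => // /negP tA.
  rewrite /= F0// ltNge; apply/negP; rewrite ler_norml => tA'.
  by apply: tA; rewrite inE /= in_itv.
apply: (integrable_mkcond _ _).1 => //.
apply: (@continuous_compact_integrable R F `[- A, A]%classic); first exact: segment_compact.
exact: continuous_subspaceT.
Qed.

Local Notation mu := (@lebesgue_measure R).

Lemma integral_RnS n (f : 'rV[R]_n.+1 -> R) :
  integral_Rn f = Rintegral mu setT (fun t => integral_Rn (@slice n f t)).
Proof. by []. Qed.

(** The four claims need a common induction: linearity and monotonicity in dimension [n.+1] require
    the inner integral to be integrable, which follows from its continuity, and this in turn uses
    differences and the sup-norm bound in dimension [n]. *)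
Lemma integral_Rn_ind n :
  [/\ forall f g : 'rV[R]_n -> R, Cc f -> Cc g ->
        integral_Rn (fun p => f p + g p) = integral_Rn f + integral_Rn g,
      forall c (f : 'rV[R]_n -> R), Cc f ->
        integral_Rn (fun p => c * f p) = c * integral_Rn f,
      forall f g : 'rV[R]_n -> R, Cc f -> Cc g -> (forall p, f p <= g p) ->
        integral_Rn f <= integral_Rn g &
      forall A, 0 <= A -> exists2 B, 0 <= B &
        forall C (f : 'rV[R]_n -> R), continuous f -> in_box A f ->
          (forall p, `|f p| <= C) -> `|integral_Rn f| <= C * B].
Proof.
elim: n => [|n [addI scaleI leI bndI]].
  split=> //=.
  by move=> A _; exists 1 => // C f _ _ fC; rewrite mulr1.
have I0 : integral_Rn (fun _ : 'rV[R]_n => 0) = 0.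
  have C0 : Cc (fun _ : 'rV[R]_n => (0 : R)).
    by split; [exact: cst_continuous|exists 0 => p; rewrite eqxx].
  rewrite -[RHS](mul0r (integral_Rn (fun _ : 'rV[R]_n => 0))) -scaleI//.
  by congr integral_Rn; apply/funext => p; rewrite mul0r.
have subI (f g : 'rV[R]_n -> R) : Cc f -> Cc g ->
    integral_Rn f - integral_Rn g = integral_Rn (fun p => f p + (-1) * g p).
  by move=> Cf Cg; rewrite addI ?scaleI ?mulN1r//; exact: CcZ.
have zI A (f : 'rV[R]_n.+1 -> R) : in_box A f ->
    forall t, A < `|t| -> integral_Rn (slice f t) = 0.
  by move=> bf t At; rewrite (slice_out bf At).
have cI (f : 'rV[R]_n.+1 -> R) : Cc f -> continuous (fun t => integral_Rn (slice f t)).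
  move=> Cf t; have [cf [A0 bf]] := Cf.
  pose A := Num.max A0 0.
  have A00 : 0 <= A by rewrite le_max lexx orbT.
  have {}bf : in_box A f by apply: in_boxW bf; rewrite le_max lexx.
  have [B B0 HB] := bndI A A00.
  apply/cvgrPdist_le => e e0.
  (* Slices that differ by at most [e / (B + 1)] everywhere have integrals that differ by at most
     [B] times this. *)
  have eB0 : 0 < e / (B + 1) by rewrite divr_gt0// ltr_wpDl.
  have := slice_unif t cf bf eB0; apply: filterS => s H.
  rewrite subI; [|exact: Cc_slice|exact: Cc_slice].
  have cs r : continuous (slice f r) by exact: slice_continuous.
  apply: le_trans (HB (e / (B + 1)) _ _ _ _) _.
  - move=> q; apply: continuousD; first exact: cs.
    by apply: continuousM; [exact: cst_continuous|exact: cs].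
  - apply: in_boxD; first exact: in_box_slice.
    by move=> q; rewrite mulf_eq0 negb_or => /andP[_ /in_box_slice]; exact.
  - by move=> q; rewrite mulN1r.
  - by rewrite -mulrA ler_piMr ?(ltW e0)// ler_pdivrMl ?ltr_wpDl// mulr1 lerDl.
have intI (f : 'rV[R]_n.+1 -> R) : Cc f ->
    mu.-integrable setT (EFin \o (fun t => integral_Rn (slice f t))).
  move=> Cf; have [cf [A bf]] := Cf.
  by apply: (@compact_support_integrable A); [exact: cI|exact: zI].
split.
- move=> f g Cf Cg; rewrite !integral_RnS -RintegralD//; [|exact: intI|exact: intI].
  by congr Rintegral; apply/funext => t; rewrite -addI//; exact: Cc_slice.
- move=> c f Cf; rewrite !integral_RnS -RintegralZl//; last exact: intI.
  by congr Rintegral; apply/funext => t; rewrite -scaleI//; exact: Cc_slice.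
- move=> f g Cf Cg fg; rewrite !integral_RnS; apply: le_Rintegral => //; [exact: intI|exact: intI|].
  by move=> t _; apply: leI; [exact: Cc_slice|exact: Cc_slice|move=> q; exact: fg].
- move=> A A0; have [B B0 HB] := bndI A A0.
  exists (B * (A + A)); first by rewrite mulr_ge0// addr_ge0.
  move=> C f cf bf fC.
  have Cf : Cc f by split => //; exists A.
  rewrite integral_RnS.
  have -> : (fun t => integral_Rn (slice f t)) =
      (fun t => integral_Rn (slice f t)) \_ `[- A, A]%classic.
    apply/funext => t; rewrite patchE; case: ifPn => // /negP tA.
    rewrite (zI A)// ltNge; apply/negP; rewrite ler_norml => tA'.
    by apply: tA; rewrite inE /= in_itv.
  rewrite -Rintegral_mkcond.
  have iA : mu.-integrable `[- A, A]%classic (EFin \o (fun t => integral_Rn (slice f t))).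
    by apply: integrableS (intI _ Cf).
  apply: le_trans (le_normr_Rintegral _ iA) _ => //.
  apply: (@le_trans _ _ (Rintegral mu `[- A, A]%classic (fun=> C * B))).
    apply: le_Rintegral => //.
    + have := integrable_abse iA.
      by apply: eq_integrable => // t _.
    + apply: continuous_compact_integrable; first exact: segment_compact.
      by apply: continuous_subspaceT => x; exact: cst_continuous.
    + move=> t _; apply: HB; [exact: slice_continuous|exact: in_box_slice|].
      by move=> q; exact: fC.
  rewrite Rintegral_cst// mulrA ler_wpM2l//.
    by rewrite mulr_ge0//; apply: le_trans (fC 0); exact: normr_ge0.
  have -> : fine (mu `[- A, A]%classic) = _ := congr1 fine (lebesgue_measure_itv `[- A, A]).
  rewrite /= lte_fin.
  (* The formula for the measure of an interval gives 0 when [- A < A] fails, that is, for [A = 0];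
     the bound [A + A] holds in both cases. *)
  case: ifPn => _ /=; first by rewrite opprK.
  by rewrite addr_ge0.
Qed.

Lemma integral_RnD n (f g : 'rV[R]_n -> R) : Cc f -> Cc g ->
  integral_Rn (fun p => f p + g p) = integral_Rn f + integral_Rn g.
Proof. by have [+ _ _ _] := integral_Rn_ind n; exact. Qed.

Lemma integral_RnZ n c (f : 'rV[R]_n -> R) : Cc f ->
  integral_Rn (fun p => c * f p) = c * integral_Rn f.
Proof. by have [_ + _ _] := integral_Rn_ind n; exact. Qed.

Lemma le_integral_Rn n (f g : 'rV[R]_n -> R) : Cc f -> Cc g ->
  (forall p, f p <= g p) -> integral_Rn f <= integral_Rn g.
Proof. by have [_ _ + _] := integral_Rn_ind n; exact. Qed.

Lemma Cc0 n : Cc (fun _ : 'rV[R]_n => 0).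
Proof. by split; [exact: cst_continuous|exists 0 => p; rewrite eqxx]. Qed.

Lemma integral_Rn0 n : integral_Rn (fun _ : 'rV[R]_n => 0) = 0.
Proof.
rewrite -[RHS](mul0r (integral_Rn (fun _ : 'rV[R]_n => 0))) -integral_RnZ//; last exact: Cc0.
by congr integral_Rn; apply/funext => p; rewrite mul0r.
Qed.

End IntegralRn.

(** * Determinants, inverse matrices and curvature as continuous or smooth functions *)

Section ContinuousAlgebra.
Variables (R : realType) (T : topologicalType) (c0 : T).
Implicit Types (f g : T -> R).

Lemma cont_sum (I : Type) (r : seq I) (F : I -> T -> R) :
  (forall i, {for c0, continuous (F i)}) ->
  {for c0, continuous (fun c => \sum_(i <- r) F i c)}.
Proof.
move=> cF; elim: r => [|i r IH].
  rewrite (_ : (fun _ => _) = cst 0); first exact: cst_continuous.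
  by apply/funext => t; rewrite big_nil.
rewrite (_ : (fun _ => _) = (fun c => F i c + \sum_(i <- r) F i c)).
  exact: (cvgD (cF i) IH).
by apply/funext => t; rewrite big_cons.
Qed.

Lemma cont_prod (I : Type) (r : seq I) (F : I -> T -> R) :
  (forall i, {for c0, continuous (F i)}) ->
  {for c0, continuous (fun c => \prod_(i <- r) F i c)}.
Proof.
move=> cF; elim: r => [|i r IH].
  rewrite (_ : (fun _ => _) = cst 1); first exact: cst_continuous.
  by apply/funext => t; rewrite big_nil.
rewrite (_ : (fun _ => _) = (fun c => F i c * \prod_(i <- r) F i c)).
  exact: (cvgM (cF i) IH).
by apply/funext => t; rewrite big_cons.
Qed.

Lemma cont_mul f g : {for c0, continuous f} -> {for c0, continuous g} ->
  {for c0, continuous (fun c => f c * g c)}.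
Proof. by move=> cf cg; exact: (cvgM cf cg). Qed.

Lemma cont_add f g : {for c0, continuous f} -> {for c0, continuous g} ->
  {for c0, continuous (fun c => f c + g c)}.
Proof. by move=> cf cg; exact: (cvgD cf cg). Qed.

Lemma cont_sub f g : {for c0, continuous f} -> {for c0, continuous g} ->
  {for c0, continuous (fun c => f c - g c)}.
Proof. by move=> cf cg; exact: (cvgB cf cg). Qed.

Lemma cont_opp f : {for c0, continuous f} -> {for c0, continuous (fun c => - f c)}.
Proof. by move=> cf; exact: (cvgN cf). Qed.

Lemma cont_cst (x : R) : {for c0, continuous (fun _ : T => x)}.
Proof. exact: cst_continuous. Qed.

Lemma cont_det k (A : T -> 'M[R]_k) :
  (forall a b, {for c0, continuous (fun c => A c a b)}) ->
  {for c0, continuous (fun c => \det (A c))}.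
Proof.
move=> cA; apply: cont_sum => s; apply: cont_mul; first exact: cont_cst.
by apply: cont_prod => i; exact: cA.
Qed.

(** Cramer's rule. On a singular matrix [invmx] returns the matrix itself, so the cofactor formula
    holds only near [c0], where the determinant stays nonzero. *)
Lemma cont_invmx k (A : T -> 'M[R]_k) : A c0 \in unitmx ->
  (forall a b, {for c0, continuous (fun c => A c a b)}) ->
  forall a b, {for c0, continuous (fun c => invmx (A c) a b)}.
Proof.
move=> uA cA a b; have d0 : \det (A c0) != 0 by rewrite -unitfE -unitmxE.
apply: (@near_cont _ _ (fun c => (\det (A c))^-1 * cofactor (A c) b a)).
  have h : \forall c \near c0, \det (A c) != 0.
    have nd : nbhs (\det (A c0)) [set x : R | x != 0].
      by apply: open_nbhs_nbhs; split; [exact: open_neq|].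
    exact: (cont_det cA nd).
  apply: filterS h => c dc; rewrite /invmx.
  by rewrite [X in if X then _ else _](_ : _ = true) ?mxE ?mxE// unitmxE unitfE.
apply: cont_mul; first exact: (cvgV d0 (cont_det cA)).
apply: cont_mul; first exact: cont_cst.
apply: cont_det => i j.
rewrite (_ : (fun _ => _) = (fun c => A c (lift b i) (lift a j))); first exact: cA.
by apply/funext => c; rewrite !mxE.
Qed.

End ContinuousAlgebra.

Section MatrixSmooth.
Variables (R : realType) (n : nat) (O : set 'rV[R]_n) (oO : open O).

Lemma smooth_det k (A : 'rV[R]_n -> 'M[R]_k) :
  (forall a b, smooth_on O (fun p => A p a b)) -> smooth_on O (fun p => \det (A p)).
Proof.
move=> sA; apply: smooth_sum => // s _; apply: smooth_mul => //.
  exact: smooth_cst.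
by apply: smooth_prod => // i _; exact: sA.
Qed.

Lemma smooth_invmx k (A : 'rV[R]_n -> 'M[R]_k) :
  (forall p, O p -> A p \in unitmx) ->
  (forall a b, smooth_on O (fun p => A p a b)) ->
  forall a b, smooth_on O (fun p => invmx (A p) a b).
Proof.
move=> uA sA a b.
apply: (@smooth_eq _ _ _ oO (fun p => (\det (A p))^-1 * cofactor (A p) b a)).
  move=> p; rewrite inE => Op; rewrite /invmx uA//.
  by rewrite !mxE.
apply: smooth_mul => //.
  apply: smooth_inv => //; last exact: smooth_det.
  by move=> p /uA; rewrite unitmxE unitfE.
rewrite /cofactor; apply: smooth_mul => //; first exact: smooth_cst.
apply: smooth_det => c d.
by apply: smooth_eq (sA _ _) => // p _; rewrite !mxE.
Qed.

End MatrixSmooth.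

Section PosDef.
Variables (R : realType) (n : nat).
Implicit Types A : 'M[R]_n.

Definition posdef A := forall w : 'rV[R]_n, w != 0 -> 0 < (w *m A *m w^T) 0 0.

Lemma posdef_unit A : posdef A -> A \in unitmx.
Proof.
move=> pA; rewrite -row_free_unit -kermx_eq0; apply/rowV0P => w /sub_kermxP wA.
apply/eqP/negPn/negP => /pA; by rewrite wA mul0mx mxE ltxx.
Qed.

Lemma quad_ge0 (w : 'rV[R]_n) : 0 <= (w *m w^T) 0 0.
Proof. by rewrite mxE; apply: sumr_ge0 => i _; rewrite mxE -expr2 sqr_ge0. Qed.

Lemma quad_gt0 (w : 'rV[R]_n) : w != 0 -> 0 < (w *m w^T) 0 0.
Proof.
move=> w0; rewrite lt_neqAle quad_ge0 andbT eq_sym; apply: contraNneq w0 => E.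
apply/eqP/rowP => j; rewrite mxE; apply/eqP; rewrite -sqrf_eq0.
move: E; rewrite mxE => /eqP; rewrite psumr_eq0.
  by move=> /allP/(_ j (mem_index_enum _)); rewrite mxE -expr2.
by move=> i _; rewrite mxE -expr2 sqr_ge0.
Qed.

(** Along the segment from the identity to [A] the determinant starts at 1 and never vanishes, since
    convex combinations of positive definite matrices are positive definite and hence invertible;
    the intermediate value theorem excludes a sign change. *)
Lemma posdef_det_gt0 A : posdef A -> 0 < \det A.
Proof.
move=> pA; rewrite ltNge; apply/negP => dA.
pose f (t : R) := \det ((1 - t) *: 1%:M + t *: A).
have cf : continuous f.
  move=> t; apply: (@cont_det _ _ t n (fun u => (1 - u) *: 1%:M + u *: A)) => a b.
  have -> : (fun u => ((1 - u) *: 1%:M + u *: A) a b) =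
      (fun u => (1 - u) * (1%:M : 'M[R]_n) a b + u * A a b).
    by apply/funext => u; rewrite !mxE.
  apply: cont_add; apply: cont_mul; try exact: cont_cst; last exact: cvg_id.
  by apply: cont_sub; [exact: cont_cst|exact: cvg_id].
have f0 : f 0 = 1 by rewrite /f subr0 scale0r addr0 scale1r det1.
have f1 : f 1 = \det A by rewrite /f subrr scale0r add0r scale1r.
have [] := @IVT R f 0 1 0 ler01.
- exact: continuous_subspaceT.
- by rewrite f0 f1 ge_min dA orbT le_max ler01.
move=> t; rewrite in_itv /= => /andP[t0 t1] ft.
have : (1 - t) *: 1%:M + t *: A \in unitmx.
  apply: posdef_unit => w w0; rewrite mulmxDr mulmxDl mxE.
  rewrite -!scalemxAr -!scalemxAl mulmx1 mxE [X in _ + X]mxE.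
  have [->|tn1] := eqVneq t 1; first by rewrite subrr mul0r add0r mul1r pA.
  rewrite ltr_wpDr ?mulr_ge0 ?(ltW (pA _ w0))// mulr_gt0 ?quad_gt0// subr_gt0.
  by rewrite lt_neqAle tn1.
by rewrite unitmxE -/(f t) ft unitr0.
Qed.

End PosDef.

Section Curvature.
Variables (R : realType) (n : nat) (O : set 'rV[R]_n) (oO : open O).
Variable g : 'rV[R]_n -> 'M[R]_n.
Hypothesis sg : forall a b, smooth_on O (fun p => g p a b).
Hypothesis ug : forall p, O p -> g p \in unitmx.

Lemma smooth_christoffel k i j : smooth_on O (christoffel g k i j).
Proof.
apply: smooth_mul => //; first exact: smooth_cst.
apply: smooth_sum => // l _; apply: smooth_mul => //; first exact: smooth_invmx.
by apply: smooth_sub => //; [apply: smooth_add => //|]; exact: smooth_partial.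
Qed.

Lemma smooth_ricci i j : smooth_on O (ricci g i j).
Proof.
apply: smooth_add => //; apply: smooth_sum => // k _.
  by apply: smooth_sub => //; apply: smooth_partial; exact: smooth_christoffel.
apply: smooth_sum => // l _.
by apply: smooth_sub => //; apply: smooth_mul => //; exact: smooth_christoffel.
Qed.

Lemma smooth_scal : smooth_on O (scal g).
Proof.
apply: smooth_sum => // i _; apply: smooth_sum => // j _.
by apply: smooth_mul => //; [exact: smooth_invmx|exact: smooth_ricci].
Qed.

End Curvature.

(** * Bump functions and exhaustions *)

Section Bumps.
Variables (R : realType) (n : nat) (M : manifold R n).
Implicit Types (U V : set M) (i j : chart_idx M) (v : M -> R).

Lemma cdomP U i q : cdom U i q <-> (chart i @` dom i) q /\ U (parm i q).
Proof.
split=> [[x [ix Ux] <-]|[[x ix <-]]].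
  by split; [exists x|rewrite chartK].
by rewrite chartK// => Ux; exists x.
Qed.

Lemma cdom_chart U i x : dom i x -> U x -> cdom U i (chart i x).
Proof. by move=> ix Ux; exists x. Qed.

Lemma cdom_parm U i q : cdom U i q -> [/\ dom i (parm i q), U (parm i q) &
  chart i (parm i q) = q].
Proof. by move=> [x [ix Ux] <-]; rewrite chartK. Qed.

Lemma cdom_open U i : open U -> open (cdom U i).
Proof.
move=> oU; rewrite openE => q [x [ix Ux] <-]; rewrite /interior.
have h1 : nbhs (chart i x) (chart i @` dom i).
  by apply: open_nbhs_nbhs; split; [exact: chart_open|exists x].
have h2 : \forall q \near chart i x, U (parm i q).
  by apply: (parm_continuous ix); rewrite chartK//; exact: open_nbhs_nbhs.
by apply: filterS2 h1 h2 => r ? ?; apply/cdomP.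
Qed.

Lemma cdom_nbhs U i x : open U -> dom i x -> U x -> nbhs (chart i x) (cdom U i).
Proof.
move=> oU ix Ux; apply: open_nbhs_nbhs.
by split; [exact: cdom_open|exact: cdom_chart].
Qed.

Definition smoothM U v := forall i, smooth_on (cdom U i) (v \o parm i).

Lemma smoothM_continuous U v x : open U -> smoothM U v -> U x -> {for x, continuous v}.
Proof.
move=> oU sv Ux; have [i ix] := dom_cover x.
apply: (@near_cont _ _ ((v \o parm i) \o chart i)).
  near=> y; rewrite /= chartK//; near: y.
  by apply: open_nbhs_nbhs; split => //; exact: dom_open.
apply: continuous_comp; first exact: chart_continuous.
by apply: (smooth_cont (sv i)); exact: cdom_chart.
Unshelve. all: by end_near. Qed.

Lemma smoothM_sub U V v : V `<=` U -> smoothM U v -> smoothM V v.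
Proof. by move=> VU sv i; apply: smooth_sub_on (sv i); exact: sub_cdom. Qed.

(** The profile exp(-1/t) at t = r^2 - |q - q0|^2 in one chart, extended by 0. It is positive only
    in the compact cube [B], which lies in the chart image of [U] because [r] is half the radius of
    a sup-norm ball there. *)
Lemma bump_exists (x : M) U : open U -> U x -> exists v, [/\ smoothM setT v,
  forall y, 0 <= v y, 0 < v x &
  exists S, [/\ compact S, S `<=` U & forall y, ~ S y -> v y = 0]].
Proof.
move=> oU Ux; have [i ix] := dom_cover x; pose q0 := chart i x.
have /nbhs_ballP[e /= e0 eU] := cdom_nbhs oU ix Ux.
pose r := e / 2; have r0 : 0 < r by rewrite divr_gt0.
pose f (q : 'rV[R]_n) := r ^+ 2 - \sum_b (q 0 b - q0 0 b) ^+ 2.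
pose B := [set q : 'rV[R]_n | forall b, `|q 0 b - q0 0 b| <= r].
have fB q : 0 < f q -> B q.
  rewrite /f subr_gt0 => qr b; rewrite -(@ler_pXn2r _ 2)// ?nnegrE ?(ltW r0)//.
  rewrite real_normK ?num_real//; apply: le_trans (ltW qr).
  by rewrite (bigD1 b)//= lerDl sumr_ge0// => *; rewrite sqr_ge0.
have BU : B `<=` cdom U i.
  move=> q Bq; apply: eU; split=> // a b; rewrite (ord1 a) /ball /= distrC.
  by rewrite (le_lt_trans (Bq b))// ltr_pdivrMr// ltr_pMr// ltr1n.
have cB : compact B.
  have -> : B = [set q | forall b, `[q0 0 b - r, q0 0 b + r]%classic (q ord0 b)].
    by apply/seteqP; split => q Bq b; have := Bq b; rewrite /= in_itv /= ler_distl.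
  apply: (@rV_compact _ _ (fun b => `[q0 0 b - r, q0 0 b + r]%classic)) => b.
  exact: segment_compact.
pose S := parm i @` B.
have cS : compact S.
  apply: continuous_compact => //; apply: continuous_in_subspaceT => q.
  rewrite inE => /BU[y [iy _] <-]; exact: parm_continuous.
have SU : S `<=` U by move=> y [q /BU /cdom_parm[_ Uq _] <-].
have S_dom : S `<=` dom i by move=> y [q /BU /cdom_parm[iq _ _] <-].
pose v y := if `[< dom i y >] then flat_der 0 (f (chart i y)) else 0.
have v0 y : ~ S y -> v y = 0.
  move=> Sy; rewrite /v; case: ifPn => // /asboolP iy.
  apply: flat_der0_eq0; rewrite leNgt; apply/negP => /fB By.
  by apply: Sy; exists (chart i y) => //; rewrite chartK.
exists v; split; last by exists S.
- move=> j; apply: smooth_local => q jq.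
  have [jy _ yq] := cdom_parm jq.
  (* Smoothness in another chart [j] is checked on two open sets that cover [M]: on [dom i] through
     the transition map, and off the support [S], closed since [M] is Hausdorff, where [v] is 0. *)
  have [iy|iy] := pselect (dom i (parm j q)).
    exists (cdom (dom i) j); split; [exact/cdom_open/dom_open|by rewrite -yq; exact: cdom_chart|].
    have oD : open (cdom (dom i) j) by exact/cdom_open/dom_open.
    apply: (@smooth_eq _ _ _ oD (flat_der 0 \o (fun p => f (chart i (parm j p))))).
      move=> p; rewrite inE => /cdom_parm[_ ip _].
      by rewrite /v /=; case: asboolP.
    apply: (@smooth_comp1 _ _ _ _ (@flat_der R) setT) => //.
    + by move=> k y _; exact: is_derive_flat_der.
    + have sc b : smooth_on (cdom (dom i) j) (fun p => chart i (parm j p) 0 b - q0 0 b).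
        apply: smooth_sub => //; last exact: smooth_cst.
        exact: transition_smooth.
      rewrite /f; apply: smooth_sub => //; first exact: smooth_cst.
      apply: smooth_sum => // b _; apply: (smooth_eq oD _ (smooth_mul oD (sc b) (sc b))) => p _.
      by rewrite expr2.
  have oS : open (~` S) by apply/closed_openC/(compact_closed (@manifold_hausdorff _ _ M)).
  exists (cdom (~` S) j); split; first exact: cdom_open.
    by rewrite -yq; apply: cdom_chart => // /S_dom.
  apply: (@smooth_eq _ _ _ (cdom_open oS) (cst 0)).
    by move=> p; rewrite inE => /cdom_parm[_ Sp _]; rewrite /= v0.
  exact: smooth_cst.
- by move=> y; rewrite /v; case: ifP => // _; exact: flat_der0_ge0.
- rewrite /v; case: asboolP => // _; apply: flat_der0_gt0.
  rewrite /f big1 ?subr0 ?exprn_gt0// => b _.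
  by rewrite subrr expr0n.
Qed.

End Bumps.

(** Near-covering compactness is applied to the filter [F] of finite lists directed by inclusion: a
    property holds along [F] if it holds for all lists containing a given one. *)
Lemma compact_finite_cover (T : topologicalType) (I : choiceType) (A : set T)
    (D : set I) (f : I -> set T) : compact A ->
  (forall i, D i -> open (f i)) -> (forall y, A y -> exists2 i, D i & f i y) ->
  exists s : seq I, (forall i, i \in s -> D i) /\
    forall y, A y -> exists2 i, i \in s & f i y.
Proof.
move=> /compact_near_coveringP cA fo Af.
pose F : set_system (seq I) :=
  [set P : set (seq I) | exists s0 : seq I, forall s : seq I, {subset s0 <= s} -> P s].
have FF : Filter F.
  split; first by exists [::].
  - move=> P Q [s0 P0] [s1 Q1]; exists (s0 ++ s1) => s ss; split.
      by apply: P0 => i i0; apply: ss; rewrite mem_cat i0.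
    by apply: Q1 => i i0; apply: ss; rewrite mem_cat i0 orbT.
  - by move=> P Q PQ [s0 P0]; exists s0 => s /P0 /PQ.
have [|s0 H] := cA _ F (fun s y => exists i, [/\ i \in s, D i & f i y]) FF.
  move=> y /Af[i Di fiy].
  exists (f i, [set s : seq I | i \in s]); last by move=> [z s] /= [fz si]; exists i.
  split => /=; first by apply: open_nbhs_nbhs; split=> //; exact: fo.
  by exists [:: i] => s; apply; rewrite inE.
exists [seq i <- s0 | `[< D i >]]; split.
  by move=> i; rewrite mem_filter => /andP[/asboolP].
move=> y /(H s0 (fun _ h => h))[i [is0 Di fy]]; exists i => //.
by rewrite mem_filter is0 andbT; apply/asboolP.
Qed.

Section Exhaustion.
Variables (R : realType) (n : nat) (M : manifold R n).
Implicit Types (U V : set M) (i j : chart_idx M) (v : M -> R).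

(** A finite sum of bumps whose positivity sets cover [L]; its support lies in the union of finitely
    many compact sets. *)
Lemma compact_bump (L U : set M) : compact L -> open U -> L `<=` U ->
  exists v, [/\ smoothM setT v, forall y, 0 <= v y, forall y, L y -> 0 < v y &
  exists S, [/\ compact S, S `<=` U & forall y, ~ S y -> v y = 0]].
Proof.
move=> cL oU LU.
have /choice[b bP] : forall x : M, exists v, L x -> [/\ smoothM setT v,
    forall y, 0 <= v y, 0 < v x &
    exists S, [/\ compact S, S `<=` U & forall y, ~ S y -> v y = 0]].
  move=> x; have [Lx|Lx] := pselect (L x); last by exists (cst 0).
  by have [v vP] := bump_exists oU (LU _ Lx); exists v.
have [|y Ly|D [DL LD]] := @compact_finite_cover _ M L L (fun x => [set y | 0 < b x y]) cL.
- move=> x Lx; have [sb _ _ _] := bP _ Lx.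
  apply: (@open_comp _ _ (b x) [set r | 0 < r]); last exact: open_gt.
  by move=> y _; exact: smoothM_continuous (openT) sb _.
- by exists y => //=; have [_ _ + _] := bP _ Ly.
have DL' x : x \in D -> L x by exact: DL.
have b0 y x : x \in D -> 0 <= b x y by move=> /DL' /bP[_ + _ _].
exists (fun y => \sum_(x <- D) b x y); split.
- move=> i; have oc : open (cdom [set: M] i) by exact/cdom_open/openT.
  apply: (@smooth_eq _ _ _ oc (fun p => \sum_(x <- D | x \in D) (b x \o parm i) p)).
    by move=> p _; rewrite -big_seq.
  by apply: smooth_sum => // x /DL' /bP[+ _ _ _]; exact.
- by move=> y; rewrite big_seq; apply: sumr_ge0 => x xD; exact: b0.
- move=> y /LD[x xD /= bxy]; rewrite (big_rem x)//= ltr_wpDr// big_seq.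
  by apply: sumr_ge0 => z /mem_rem; exact: b0.
- have /choice[S SP] : forall x : M, exists S : set M, x \in D ->
      [/\ compact S, S `<=` U & forall y, ~ S y -> b x y = 0].
    move=> x; have [xD|xD] := boolP (x \in D); last by exists set0.
    by have [_ _ _ [S SP]] := bP _ (DL' _ xD); exists S.
  exists (\bigcup_(x in [set x | x \in D]) S x); split.
  + have : forall r : seq M, {subset r <= D} -> compact (\bigcup_(x in [set` r]) S x).
      elim=> [_|x r IH rD].
        rewrite (_ : \bigcup_(x in _) _ = set0); first exact: compact0.
        by apply/seteqP; split => // y [].
      rewrite (_ : \bigcup_(x in _) _ = S x `|` \bigcup_(x in [set` r]) S x); last first.
        apply/seteqP; split => y.
          by move=> [z /=]; rewrite inE => /predU1P[->|zr] Sz; [left|right; exists z].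
        case=> [Sx|[z /= zr Sz]]; first by exists x => //=; rewrite inE eqxx.
        by exists z => //=; rewrite inE zr orbT.
      apply: compactU.
        by have [] := SP x (rD _ (mem_head _ _)).
      by apply: IH => z zr; apply: rD; rewrite inE zr orbT.
    by move=> /(_ D); apply.
  + by move=> y [x xD]; have [_ + _] := SP x xD; exact.
  + move=> y Sy; rewrite big_seq big1// => x xD; have [_ _] := SP x xD; apply.
    by move=> Sxy; apply: Sy; exists x.
Qed.

(** The interiors cover [L], and finitely many of them are contained in the one of largest index.
    This also relates the exhaustion that defines the [phi m] to the one along which the limit is
    taken. *)
Lemma exhaustion_compact_sub (K : nat -> set M) L : compact_exhaustion K ->
  compact L -> exists k, forall k', (k <= k')%N -> L `<=` interior (K k').
Proof.
move=> [cK KT Kin] cL.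
have Kmono k k' : (k <= k')%N -> K k `<=` K k'.
  elim: k' => [|k' IH]; first by rewrite leqn0 => /eqP ->.
  rewrite leq_eqVlt => /predU1P[->//|]; rewrite ltnS => /IH H.
  by apply: subset_trans H (subset_trans (Kin k') (@interior_subset _ _)).
have [|y _|D [_ LD]] := @compact_finite_cover _ nat L setT (fun k => interior (K k)) cL.
- by move=> k _; exact: open_interior.
- have : [set: M] y by []. rewrite -KT => -[k _ Ky].
  by exists k.+1 => //; exact: Kin.
exists (\max_(k <- D) k)%N => k' Dk' y /LD[k kD /= Ky].
apply: interiorS Ky; apply: Kmono; apply: leq_trans Dk'.
exact: leq_bigmax_seq.
Qed.

(** Bumps for the compact layers between consecutive members of the exhaustion, each supported off
    the members two steps below: every point is seen by some [phi m], and every compact set by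
    finitely many. *)
Lemma layer_functions (K : nat -> set M) : compact_exhaustion K ->
  exists phi : nat -> M -> R, [/\ forall m, smoothM setT (phi m),
    forall m y, 0 <= phi m y,
    forall y, exists m, 0 < phi m y,
    forall m, exists2 S, compact S & forall y, ~ S y -> phi m y = 0 &
    forall k m y, (k.+2 <= m)%N -> K k y -> phi m y = 0].
Proof.
move=> exK; have [cK KT Kin] := exK.
(* Two empty sets in front make the first layers regular: layer [m] is [K' m.+2] minus the interior
   of [K' m.+1], a compact set disjoint from [K' m]. *)
pose K' m := if m is k.+2 then K k else set0.
have clK' m : closed (K' m).
  case: m => [|[|k]] /=; [exact: closed0|exact: closed0|].
  exact: (compact_closed (@manifold_hausdorff _ _ M)).
have cK' m : compact (K' m).
  by case: m => [|[|k]] /=; [exact: compact0|exact: compact0|].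
have K'in m : K' m `<=` interior (K' m.+1).
  by case: m => [|[|k]] //=; exact: Kin.
have Kmono k k' : (k <= k')%N -> K' k `<=` K' k'.
  elim: k' => [|k' IH]; first by rewrite leqn0 => /eqP ->.
  rewrite leq_eqVlt => /predU1P[->//|]; rewrite ltnS => /IH H.
  by apply: subset_trans H (subset_trans (K'in k') (@interior_subset _ _)).
have /choice[phi phiP] : forall m, exists v, [/\ smoothM setT v, forall y, 0 <= v y,
    forall y, (K' m.+2 `&` ~` interior (K' m.+1)) y -> 0 < v y &
    exists S, [/\ compact S, S `<=` ~` K' m & forall y, ~ S y -> v y = 0]].
  move=> m; apply: compact_bump.
  - rewrite setIC; apply: subclosed_compact (cK' m.+2) _; last exact: subIsetr.
    by apply: closedI; [apply/open_closedC/open_interior|].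
  - exact: closed_openC.
  - by move=> y [_ nK] Ky; apply/nK/K'in.
exists phi; split.
- by move=> m; have [] := phiP m.
- by move=> m; have [_ +] := phiP m.
- move=> y.
  have : exists m, `[< K' m y >].
    have : [set: M] y by []. rewrite -KT => -[k _ Ky].
    by exists k.+2; apply/asboolP.
  move=> /ex_minnP[m /asboolP Km minm].
  (* The least index with [y] in [K'] is at least 2, as the leading sets are empty. By minimality
     [y] avoids the previous set, so it lies in the layer that ends at this index. *)
  case: m Km minm => [//|[//|m]] Km minm; exists m.
  have [_ _ + _] := phiP m; apply; split=> // /interior_subset Km1.
  by have := minm m.+1 (asboolT Km1); rewrite ltnn.
- by move=> m; have [_ _ _ [S [cS _ S0]]] := phiP m; exists S.
- move=> k m y km Ky; have [_ _ _ [S [_ SK S0]]] := phiP m; apply: S0 => /SK; apply.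
  exact: (Kmono k.+2).
Qed.

End Exhaustion.

(** * Integration over a manifold *)

Section PartitionIntegral.
Variables (R : realType) (n : nat) (M : manifold R n).
Implicit Types (U V K : set M) (i j : chart_idx M) (v : M -> R).
Implicit Types (F G : chart_idx M -> 'rV[R]_n -> R).

Lemma norm_coord (p : 'rV[R]_n) (j : 'I_n) : `|p 0 j| <= `|p|.
Proof.
have /mapP[k _ ->] : `|p 0 j| \in [seq `|p x.1 x.2| | x : 'I_1 * 'I_n].
  by apply/mapP; exists (ord0, j) => //=; rewrite mem_enum.
by rewrite [leRHS]/Num.norm /= mx_normrE; apply/bigmax_geP; right => /=; exists k.
Qed.

(** The expressions [F i] in different charts are unrelated here: inequalities between integrals are
    obtained separately in each chart. *)
Definition admissible U K F := forall i q, cdom U i q ->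
  {for q, continuous (F i)} /\ (~ K (parm i q) -> F i q = 0).

Lemma admissibleD U K F G : admissible U K F -> admissible U K G -> admissible U K (fun i q => F i q + G i q).
Proof.
move=> aF aG i q iq; have [cF F0] := aF i q iq; have [cG G0] := aG i q iq.
split; first exact: (cvgD cF cG).
by move=> Kq; rewrite F0// G0// addr0.
Qed.

Lemma admissibleZ U K F c : admissible U K F -> admissible U K (fun i q => c * F i q).
Proof.
move=> aF i q iq; have [cF F0] := aF i q iq.
split; first exact: (cvgM (cvg_cst _) cF).
by move=> Kq; rewrite F0// mulr0.
Qed.

Hypothesis Hpou : partition_of_unity (@pou R n M).

Local Notation chi := (@pou R n M).

Definition pou_term U F i : 'rV[R]_n -> R :=
  (fun p => chi i (parm i p) * F i p) \_ (cdom U i).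

(** The Riemannian density is part of [F], so integrals against different metrics are values of one
    functional and can be compared. *)
Definition pint U F : R := \sum_(i \in [set: chart_idx M]) integral_Rn (pou_term U F i).

Lemma pou_termE U F i q : pou_term U F i q =
  if `[< cdom U i q >] then chi i (parm i q) * F i q else 0.
Proof.
rewrite /pou_term patchE; case: asboolP => h.
  by rewrite (_ : _ \in _) // inE.
by rewrite (_ : (_ \in _) = false)//; apply/negbTE; rewrite notin_setE.
Qed.

(** The support lies in the chart image of a compact set, the support of [chi i] intersected with
    [K]. Its complement is open, so the extension by 0 stays continuous. *)
Lemma pou_term_Cc U K F i : open U -> compact K -> K `<=` U -> admissible U K F ->
  Cc (pou_term U F i).
Proof.
move=> oU cK KU aF; have [cchi chi0 schi lf sum1] := Hpou.
pose S := closure [set x | chi i x != 0] `&` K.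
have cS : compact S.
  apply: (subclosed_compact _ cK); last exact: subIsetr.
  by apply: closedI; [exact: closed_closure|exact: (compact_closed (@manifold_hausdorff _ _ M))].
have Sd : S `<=` dom i `&` U by move=> x [/schi ix Kx]; split=> //; exact: KU.
have cC : compact (chart i @` S).
  apply: continuous_compact => //; apply: continuous_in_subspaceT => x.
  by rewrite inE => /Sd[ix _]; exact: chart_continuous.
have T0 q : ~ (chart i @` S) q -> pou_term U F i q = 0.
  move=> nq; rewrite pou_termE; case: asboolP => // iq.
  have [ix Ux xq] := cdom_parm iq.
  have [->|c0] := eqVneq (chi i (parm i q)) 0; first by rewrite mul0r.
  have [_ F0] := aF i q iq; rewrite F0 ?mulr0// => Kq.
  by apply: nq; exists (parm i q) => //; split => //; exact: subset_closure.
split.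
- move=> q; have [iq|iq] := pselect (cdom U i q).
  + have oc : open (cdom U i) by exact: cdom_open.
    apply: (@near_cont _ _ (fun p => chi i (parm i p) * F i p)).
      apply: (@open_eq_near _ _ (cdom U i)) => // p; rewrite inE => ip.
      by rewrite pou_termE; case: asboolP.
    have [cF _] := aF i q iq.
    have cc : {for q, continuous (chi i \o parm i)}.
      apply: continuous_comp; last exact: cchi.
      by have [ix _ <-] := cdom_parm iq; exact: parm_continuous.
    exact: cvgM cc cF.
  + have oc : open (~` (chart i @` S)).
      apply: closed_openC; apply: (compact_closed _ cC).
      exact: norm_hausdorff.
    apply: (@near_cont _ _ (cst 0)); last exact: cst_continuous.
    apply: (@open_eq_near _ _ (~` (chart i @` S))) => //.
      by move=> p; rewrite inE /= => /T0 ->.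
    by move=> [x /Sd[ix Ux] xq]; apply: iq; rewrite -xq; exact: cdom_chart.
- have /compact_bounded[A [_ HA]] := cC.
  exists (A + 1) => p p0 j; apply: le_trans (norm_coord p j) _.
  apply: (HA (A + 1)); first by rewrite ltrDl.
  by apply: contrapT => /T0 /eqP; apply/negP.
Qed.

(** Local finiteness gives a neighborhood meeting finitely many supports around each point, and
    finitely many such neighborhoods cover [K]. *)
Lemma pou_finite K : compact K -> exists J : seq (chart_idx M),
  forall i x, K x -> chi i x != 0 -> i \in J.
Proof.
move=> cK; have [cchi chi0 schi lf sum1] := Hpou.
have /choice[N NP] : forall x : M, exists N : set M, open N /\ N x /\
    finite_set [set i | N `&` [set y | chi i y != 0] !=set0].
  move=> x; have [N Nx fN] := lf x; exists (interior N); split; first exact: open_interior.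
  split; first exact: Nx.
  apply: sub_finite_set fN => i [y [/interior_subset Ny yi]]; by exists y.
have [||s [_ sK]] := @compact_finite_cover M M K setT N cK.
- by move=> x _; have [] := NP x.
- by move=> x _; exists x => //; have [_ []] := NP x.
have : exists J : seq (chart_idx M), forall i x, x \in s -> 
    (N x `&` [set y | chi i y != 0] !=set0) -> i \in J.
  elim: s {sK} => [|x s [J HJ]]; first by exists [::].
  have [_ [_ /finite_seqP[J' EJ']]] := NP x.
  exists (J' ++ J) => i y; rewrite inE mem_cat => /predU1P[->|ys] Hi.
    have : [set i | N x `&` [set y | chi i y != 0] !=set0] i by [].
    by rewrite EJ' /= => ->.
  by rewrite (HJ i y ys Hi) orbT.
move=> [J HJ]; exists J => i x Kx xi.
by have [z zs Nz] := sK x Kx; apply: (HJ i z zs); exists x.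
Qed.

Lemma pou_term0 U K F (J : seq (chart_idx M)) i : admissible U K F ->
  (forall i x, K x -> chi i x != 0 -> i \in J) -> i \notin J ->
  pou_term U F i = fun=> 0.
Proof.
move=> aF HJ iJ; apply/funext => q; rewrite pou_termE; case: asboolP => // iq.
have [->|c0] := eqVneq (chi i (parm i q)) 0; first by rewrite mul0r.
have [_ F0] := aF i q iq; rewrite F0 ?mulr0// => Kq.
by move: iJ; rewrite (HJ _ _ Kq c0).
Qed.

(** Turns the sum over all charts into one over a list that depends on [K] only, so that several
    integrands can share it. *)
Lemma pintE U K F (J : seq (chart_idx M)) : admissible U K F ->
  (forall i x, K x -> chi i x != 0 -> i \in J) -> uniq J ->
  pint U F = \sum_(i <- J) integral_Rn (pou_term U F i).
Proof.
move=> aF HJ uJ; rewrite /pint (@fsbigE _ _ _ _ _ J)//.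
  by apply: eq_bigl => i; rewrite in_setT.
by move=> i _ iJ; rewrite (pou_term0 aF HJ iJ) integral_Rn0.
Qed.

Lemma pou_finite_uniq K (J0 : seq (chart_idx M)) : compact K ->
  exists J : seq (chart_idx M), [/\ uniq J, {subset J0 <= J} &
  forall i x, K x -> chi i x != 0 -> i \in J].
Proof.
move=> /pou_finite[J HJ]; exists (undup (J0 ++ J)); split; first exact: undup_uniq.
  by move=> i; rewrite mem_undup mem_cat => ->.
by move=> i x Kx ix; rewrite mem_undup mem_cat (HJ i x)// orbT.
Qed.

Lemma pintD U K F G : open U -> compact K -> K `<=` U -> admissible U K F -> admissible U K G ->
  pint U (fun i q => F i q + G i q) = pint U F + pint U G.
Proof.
move=> oU cK KU aF aG; have [J [uJ _ HJ]] := pou_finite_uniq [::] cK.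
rewrite (pintE (admissibleD aF aG) HJ uJ) (pintE aF HJ uJ) (pintE aG HJ uJ) -big_split.
apply: eq_bigr => i _ /=; rewrite -integral_RnD; [|exact: pou_term_Cc aF|exact: pou_term_Cc aG].
congr integral_Rn; apply/funext => q; rewrite !pou_termE.
by case: asboolP; rewrite ?addr0// mulrDr.
Qed.

Lemma pintZ U K F c : open U -> compact K -> K `<=` U -> admissible U K F ->
  pint U (fun i q => c * F i q) = c * pint U F.
Proof.
move=> oU cK KU aF; have [J [uJ _ HJ]] := pou_finite_uniq [::] cK.
rewrite (pintE (admissibleZ c aF) HJ uJ) (pintE aF HJ uJ) mulr_sumr.
apply: eq_bigr => i _ /=; rewrite -integral_RnZ; last exact: pou_term_Cc aF.
congr integral_Rn; apply/funext => q; rewrite !pou_termE.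
by case: asboolP; rewrite ?mulr0// mulrCA.
Qed.

(** The integrands need comparing only in [K] and where [chi i] is nonzero, exactly the places where
    closeness of two metrics is available. *)
Lemma le_pint U K F G : open U -> compact K -> K `<=` U -> admissible U K F -> admissible U K G ->
  (forall i q, cdom U i q -> K (parm i q) -> chi i (parm i q) != 0 -> F i q <= G i q) ->
  pint U F <= pint U G.
Proof.
move=> oU cK KU aF aG FG; have [J [uJ _ HJ]] := pou_finite_uniq [::] cK.
have [_ chi0 _ _ _] := Hpou.
rewrite (pintE aF HJ uJ) (pintE aG HJ uJ).
apply: ler_sum => i _; apply: le_integral_Rn; [exact: pou_term_Cc aF|exact: pou_term_Cc aG|].
move=> q; rewrite !pou_termE; case: asboolP => // iq.
have [->|c0] := eqVneq (chi i (parm i q)) 0; first by rewrite !mul0r.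
have [Kq|Kq] := pselect (K (parm i q)).
  by apply: ler_wpM2l; [exact: chi0|exact: FG].
have [_ F0] := aF i q iq; have [_ G0] := aG i q iq.
by rewrite F0// G0.
Qed.

Lemma admissible0 U K : admissible U K (fun _ _ => 0).
Proof. by move=> i q _; split => //; exact: (@cst_continuous _ _ (0 : R)). Qed.

Lemma pint0 U : pint U (fun _ _ => 0) = 0.
Proof.
rewrite /pint fsbig1// => i _; rewrite (_ : pou_term _ _ _ = fun=> 0) ?integral_Rn0//.
by apply/funext => q; rewrite pou_termE; case: asboolP => //; rewrite mulr0.
Qed.

Lemma pint_ge0 U K F : open U -> compact K -> K `<=` U -> admissible U K F ->
  (forall i q, cdom U i q -> K (parm i q) -> 0 <= F i q) -> 0 <= pint U F.
Proof.
move=> oU cK KU aF F0; rewrite -[leLHS](pint0 U).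
apply: (le_pint oU cK KU (@admissible0 U K) aF) => i q iq Kq _; exact: F0.
Qed.

Lemma pint_sum U K (I : Type) (r : seq I) (F : I -> chart_idx M -> 'rV[R]_n -> R) :
  open U -> compact K -> K `<=` U -> (forall m, admissible U K (F m)) ->
  admissible U K (fun i q => \sum_(m <- r) F m i q) /\
  pint U (fun i q => \sum_(m <- r) F m i q) = \sum_(m <- r) pint U (F m).
Proof.
move=> oU cK KU aF; elim: r => [|m r [aIH IH]].
  have -> : (fun i q => \sum_(m <- [::]) F m i q) = (fun _ _ => 0).
    by apply/funext => i; apply/funext => q; rewrite big_nil.
  by rewrite big_nil pint0; split => //; exact: admissible0.
have -> : (fun i q => \sum_(k <- m :: r) F k i q) =
    (fun i q => F m i q + \sum_(k <- r) F k i q).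
  by apply/funext => i; apply/funext => q; rewrite big_cons.
by rewrite big_cons (pintD oU cK KU (aF m) aIH) IH; split => //; exact: admissibleD.
Qed.

(** The quotient of [psi i] by [rho i] is continuous on the chart image of the support of [chi i]
    intersected with [S], a compact set, hence bounded. *)
Lemma pou_bound S (psi rho : chart_idx M -> 'rV[R]_n -> R) i : compact S ->
  admissible setT S psi ->
  (forall q, cdom [set: M] i q -> {for q, continuous (rho i)} /\ 0 < rho i q) ->
  exists2 C, 0 <= C & forall q, cdom [set: M] i q -> chi i (parm i q) != 0 ->
    S (parm i q) -> psi i q <= C * rho i q.
Proof.
move=> cS ap rP; have [cchi chi0 schi lf sum1] := Hpou.
pose S' := closure [set x | chi i x != 0] `&` S.
have cS' : compact S'.
  apply: (subclosed_compact _ cS); last exact: subIsetr.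
  by apply: closedI; [exact: closed_closure|exact: (compact_closed (@manifold_hausdorff _ _ M))].
have cC : compact (chart i @` S').
  apply: continuous_compact => //; apply: continuous_in_subspaceT => x.
  by rewrite inE => -[/schi ix _]; exact: chart_continuous.
have Cd q : (chart i @` S') q -> cdom [set: M] i q.
  by move=> [x [/schi ix _] <-]; exact: cdom_chart.
have : compact ((fun q => psi i q / rho i q) @` (chart i @` S')).
  apply: continuous_compact => //; apply: continuous_in_subspaceT => q.
  rewrite inE => /Cd iq; have [cp _] := ap i q iq; have [cr r0] := rP q iq.
  by apply: (cvgM cp (cvgV _ cr)); rewrite gt_eqF.
move=> /compact_bounded[A [_ HA]]; exists (Num.max 0 (A + 1)).
  by rewrite le_max lexx.
move=> q iq cq Sq; have [ix _ xq] := cdom_parm iq.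
have [_ r0] := rP q iq.
rewrite -ler_pdivrMr// le_max; apply/orP; right.
apply: le_trans (ler_norm _) _; apply: (HA (A + 1)); first by rewrite ltrDl.
exists q => //; exists (parm i q) => //; split => //.
exact: subset_closure.
Qed.

(* Replaces Hoelder's inequality: for [f = t ^+ 2] and [h = t `^ r], the condition
   [f <= 1 + h] holds as soon as [2 <= r]. *)
Lemma weighted_bound S (psi rho : chart_idx M -> 'rV[R]_n -> R) : compact S ->
  admissible setT S psi ->
  (forall i q, cdom [set: M] i q -> {for q, continuous (rho i)} /\ 0 < rho i q) ->
  (forall i q, cdom [set: M] i q -> 0 <= psi i q) ->
  exists2 B, 0 <= B & forall U K (f h : chart_idx M -> 'rV[R]_n -> R),
    open U -> compact K -> K `<=` U ->
    admissible U K (fun i q => psi i q * f i q) -> admissible U K (fun i q => h i q * rho i q) ->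
    (forall i q, cdom U i q -> 0 <= h i q /\ f i q <= 1 + h i q) ->
    pint U (fun i q => psi i q * f i q) <= B + B * pint U (fun i q => h i q * rho i q).
Proof.
move=> cS ap rP p0.
have [J0 [uJ0 _ HJ0]] := pou_finite_uniq [::] cS.
have /choice[C CP] : forall i, exists C, 0 <= C /\ forall q, cdom [set: M] i q ->
    chi i (parm i q) != 0 -> S (parm i q) -> psi i q <= C * rho i q.
  by move=> i; have [C ? ?] := pou_bound cS ap (rP i); exists C.
have [_ chi0 _ _ _] := Hpou.
have Ccp i : Cc (pou_term setT psi i) by apply: pou_term_Cc cS _ ap => //; exact: openT.
have tp0 i q : 0 <= pou_term setT psi i q.
  rewrite pou_termE; case: asboolP => // iq; apply: mulr_ge0; first exact: chi0.
  exact: p0.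
have I0 i : 0 <= integral_Rn (pou_term setT psi i).
  by rewrite -(@integral_Rn0 R n); apply: le_integral_Rn => //; exact: Cc0.
(* In the charts of [J0], [psi * f <= psi + C i * rho * h]. The integral of [psi] gives an additive
   constant and [C i] a factor; their sum over [J0] serves as both. *)
exists (\sum_(i <- J0) (C i + integral_Rn (pou_term setT psi i))).
  by apply: sumr_ge0 => i _; apply: addr_ge0 => //; have [] := CP i.
move=> U K f h oU cK KU af ah fh.
have Ut i q : cdom U i q -> cdom [set: M] i q by apply: sub_cdom.
have [J [uJ JJ HJ]] := pou_finite_uniq J0 cK.
have tE i q : pou_term U (fun i q => h i q * rho i q) i q =
    if `[< cdom U i q >] then chi i (parm i q) * (h i q * rho i q) else 0.
  by rewrite pou_termE.
have th0 i q : 0 <= pou_term U (fun i q => h i q * rho i q) i q.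
  rewrite tE; case: asboolP => // iq; apply: mulr_ge0; first exact: chi0.
  by have [h0 _] := fh i q iq; have [_ r0] := rP i q (Ut _ _ iq); rewrite mulr_ge0// ltW.
have Cch i : Cc (pou_term U (fun i q => h i q * rho i q) i) by exact: pou_term_Cc ah.
have Ccf i : Cc (pou_term U (fun i q => psi i q * f i q) i) by exact: pou_term_Cc af.
have Ih0 i : 0 <= integral_Rn (pou_term U (fun i q => h i q * rho i q) i).
  by rewrite -(@integral_Rn0 R n); apply: le_integral_Rn => //; exact: Cc0.
have zero i : i \notin J0 -> pou_term U (fun i q => psi i q * f i q) i = fun=> 0.
  move=> iJ; apply/funext => q; rewrite pou_termE; case: asboolP => // iq.
  have [->|c0] := eqVneq (chi i (parm i q)) 0; first by rewrite mul0r.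
  have [_ ps0] := ap i q (Ut _ _ iq); rewrite ps0 ?mul0r ?mulr0// => Sq.
  by move: iJ; rewrite (HJ0 _ _ Sq c0).
rewrite (pintE af HJ uJ).
(* Charts outside [J0] do not meet the support of [psi], so the number of contributing charts is
   bounded independently of [U] and [K]. *)
rewrite (bigID (mem J0))/= [X in _ + X]big1 ?addr0; last first.
  by move=> i /zero ->; rewrite integral_Rn0.
set H := pint U _.
have HE : H = \sum_(i <- J) integral_Rn (pou_term U (fun i q => h i q * rho i q) i).
  exact: pintE ah HJ uJ.
have H0 : 0 <= H by rewrite HE; apply: sumr_ge0.
have IH i : i \in J -> integral_Rn (pou_term U (fun i q => h i q * rho i q) i) <= H.
  move=> iJ; rewrite HE (big_rem i)//= lerDl; apply: sumr_ge0 => *; exact: Ih0.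
have -> : \sum_(i <- J | i \in J0) integral_Rn (pou_term U (fun i q => psi i q * f i q) i) =
    \sum_(i <- J0) integral_Rn (pou_term U (fun i q => psi i q * f i q) i).
  rewrite -big_filter; apply: perm_big; apply: uniq_perm => //.
    exact: filter_uniq.
  by move=> i; rewrite mem_filter; case: (boolP (i \in J0)) => //= /JJ.
rewrite mulr_suml -big_split /= big_seq [leRHS]big_seq; apply: ler_sum => i iJ0.
have [C0 HC] := CP i.
apply: (@le_trans _ _ (integral_Rn (pou_term setT psi i) +
    C i * integral_Rn (pou_term U (fun i q => h i q * rho i q) i))).
  rewrite -integral_RnZ// -integral_RnD//; last exact: CcZ.
  apply: le_integral_Rn => //; first by apply: CcD => //; exact: CcZ.
  move=> q; rewrite [leLHS]pou_termE; case: asboolP => iq; last first.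
    by rewrite addr_ge0// mulr_ge0.
  rewrite tE asboolT// pou_termE asboolT; last exact: Ut.
  have [h0 fh1] := fh i q iq.
  rewrite [C i * _]mulrCA -mulrDr.
  have [->|c0] := eqVneq (chi i (parm i q)) 0; first by rewrite !mul0r.
  apply: ler_wpM2l; first exact: chi0.
  have [Sq|Sq] := pselect (S (parm i q)); last first.
    have [_ ps0] := ap i q (Ut _ _ iq); rewrite ps0// mul0r add0r mulr_ge0//.
    by have [_ r0] := rP i q (Ut _ _ iq); rewrite mulr_ge0// ltW.
  apply: (@le_trans _ _ (psi i q * (1 + h i q))).
    by apply: ler_wpM2l => //; exact/p0/Ut.
  rewrite mulrDr mulr1 lerD2l mulrCA [leLHS]mulrC; apply: ler_wpM2l => //.
  by apply: HC => //; exact: Ut.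
have h1 := ler_wpM2l C0 (IH i (JJ _ iJ0)).
by have h2 := mulr_ge0 (I0 i) H0; rewrite mulrDl; lra.
Qed.

End PartitionIntegral.

(** * Quadratic forms and the gradient of a cut-off *)

Section QuadraticForm.
Variables (R : realType) (n : nat).
Implicit Types (P : 'M[R]_n) (x y z : 'I_n -> R).

Definition qf P x y : R := \sum_a \sum_b P a b * x a * y b.

Lemma qfDl P x x' y : qf P (fun a => x a + x' a) y = qf P x y + qf P x' y.
Proof.
rewrite /qf -big_split; apply: eq_bigr => a _; rewrite -big_split.
by apply: eq_bigr => b _; rewrite mulrDr mulrDl.
Qed.

Lemma qfZl P c x y : qf P (fun a => c * x a) y = c * qf P x y.
Proof.
rewrite /qf mulr_sumr; apply: eq_bigr => a _; rewrite mulr_sumr.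
by apply: eq_bigr => b _; rewrite mulrCA -!mulrA.
Qed.

Lemma qf_scale c P x y : qf (c *: P) x y = c * qf P x y.
Proof.
rewrite /qf mulr_sumr; apply: eq_bigr => a _; rewrite mulr_sumr.
by apply: eq_bigr => b _; rewrite mxE -!mulrA.
Qed.

Lemma qfE P x y : qf P x y = ((\row_a x a) *m P *m (\row_a y a)^T) 0 0.
Proof.
rewrite mxE /qf exchange_big; apply: eq_bigr => b _; rewrite !mxE mulr_suml.
by apply: eq_bigr => a _; rewrite !mxE [x a * _]mulrC.
Qed.

(** Substituting w P^-1 for [w] turns the form of the inverse into the form of [P]. *)
Lemma posdef_inv P : P^T = P -> posdef P -> posdef (invmx P).
Proof.
move=> sP pP w w0; have uP := posdef_unit pP.
have -> : w *m invmx P *m w^T = (w *m invmx P) *m P *m (w *m invmx P)^T.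
  by rewrite trmx_mul trmx_inv sP mulmxKV// mulmxA.
apply: pP; apply: contraNneq w0 => E.
by rewrite -[w](mulmxKV uP) E mul0mx.
Qed.

Section Psd.
Variable P : 'M[R]_n.
Hypothesis sP : P^T = P.
Hypothesis pP : forall x, 0 <= qf P x x.

Lemma qfC x y : qf P x y = qf P y x.
Proof.
rewrite /qf exchange_big; apply: eq_bigr => b _; apply: eq_bigr => a _.
by rewrite -[in LHS]sP mxE mulrAC.
Qed.

Lemma qfDr x y y' : qf P x (fun a => y a + y' a) = qf P x y + qf P x y'.
Proof. by rewrite qfC qfDl !(qfC _ x). Qed.

Lemma qfZr c x y : qf P x (fun a => c * y a) = c * qf P x y.
Proof. by rewrite qfC qfZl qfC. Qed.

Lemma qf_comb c d x y : qf P (fun a => c * x a + d * y a) (fun a => c * x a + d * y a) =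
  c ^+ 2 * qf P x x + 2 * c * d * qf P x y + d ^+ 2 * qf P y y.
Proof. by rewrite !(qfDl, qfDr, qfZl, qfZr) (qfC y x); ring. Qed.

Lemma qf_sumr (I : Type) (r : seq I) x (c : I -> R) (y : I -> 'I_n -> R) :
  qf P x (fun a => \sum_(m <- r) c m * y m a) = \sum_(m <- r) c m * qf P x (y m).
Proof.
elim: r => [|m r IH].
  rewrite big_nil /qf big1// => a _; rewrite big1// => b _.
  by rewrite big_nil mulr0.
rewrite big_cons -IH -qfZr -qfDr; congr qf; apply/funext => a.
by rewrite big_cons.
Qed.

(* The AM-GM inequality is applied to each index separately, so that no
   derivative of [eps] itself enters the bound. *)
Lemma qf_cutoff (I : Type) (r : seq I) (c phi : I -> R) (xi : I -> 'I_n -> R) x (v : R) :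
  (forall m, 0 <= c m) ->
  let eps := \sum_(m <- r) c m * phi m ^+ 2 in
  let dw := fun a => (1 - eps) * x a + (- v) * \sum_(m <- r) (2 * c m * phi m) * xi m a in
  eps <= 2^-1 ->
  qf P dw dw <= (1 - eps / 2) * qf P x x
                + 8 * v ^+ 2 * \sum_(m <- r) c m * qf P (xi m) (xi m).
Proof.
move=> c0 eps dw e2.
have e0 : 0 <= eps by apply: sumr_ge0 => m _; rewrite mulr_ge0// sqr_ge0.
set Q := \sum_(m <- r) c m * qf P (xi m) (xi m).
have Q0 : 0 <= Q by apply: sumr_ge0 => m _; exact: mulr_ge0.
pose z a := \sum_(m <- r) (c m * phi m) * xi m a.
have dwE : dw = (fun a => (1 - eps) * x a + (- (2 * v)) * z a).
  apply/funext => a; rewrite /dw /z mulr_sumr mulr_sumr; congr (_ + _).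
  by apply: eq_bigr => m _; ring.
(* Expanding one factor [z] and applying AM-GM per index gives [2 * qf P z z <= eps * qf P z z + Q];
   the first term is absorbed because [eps <= 2^-1]. *)
have zQ : qf P z z <= Q.
  have : 2 * qf P z z <= eps * qf P z z + Q.
    rewrite [in leLHS](qf_sumr _ z) mulr_sumr /eps mulr_suml -big_split /=.
    apply: ler_sum => m _.
    have := pP (fun a => phi m * z a + (-1) * xi m a); rewrite qf_comb => h.
    by have := mulr_ge0 (c0 m) h; nra.
  have := pP z; nra.
(* The weights in the squares are chosen so that the cross term costs [eps * qf P x x] in total; the
   rest is bounded through [(1 - eps) ^+ 2 <= 1]. *)
have xz : - (4 * (1 - eps) * v) * qf P x z <= eps * qf P x x + 4 * v ^+ 2 * Q.
  rewrite [qf P x z]qf_sumr mulr_sumr {2}/eps [_ * qf P x x]mulr_suml [4 * _ * Q]mulr_sumr -big_split /=.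
  apply: ler_sum => m _; rewrite -/eps.
  have := pP (fun a => phi m * x a + (2 * (1 - eps) * v) * xi m a); rewrite qf_comb => h.
  have h1 := mulr_ge0 (c0 m) h.
  have h2 : (1 - eps) ^+ 2 <= 1 by nra.
  have h3 : (2 * (1 - eps) * v) ^+ 2 * qf P (xi m) (xi m) <= 4 * v ^+ 2 * qf P (xi m) (xi m).
    apply: ler_wpM2r => //; have -> : (2 * (1 - eps) * v) ^+ 2 = (4 * v ^+ 2) * (1 - eps) ^+ 2 by ring.
    by rewrite ler_piMr// mulr_ge0// sqr_ge0.
  by have h4 := ler_wpM2l (c0 m) h3; nra.
rewrite dwE qf_comb.
have hx := pP x.
have h5 : (2 * v) ^+ 2 * qf P z z <= 4 * v ^+ 2 * Q.
  have -> : (2 * v) ^+ 2 = 4 * v ^+ 2 by ring.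
  by rewrite ler_wpM2l// mulr_ge0// sqr_ge0.
(* The left factor is [1 - eps + eps ^+ 2], and [eps ^+ 2 <= eps / 2]; this is where the remaining
   gain [eps / 2] comes from. *)
have h6 : ((1 - eps) ^+ 2 + eps) * qf P x x <= (1 - eps / 2) * qf P x x.
  by apply: ler_wpM2r => //; nra.
rewrite sqrrN.
have -> : 2 * (1 - eps) * - (2 * v) * qf P x z = - (4 * (1 - eps) * v) * qf P x z by ring.
rewrite mulrDl in h6; lra.
Qed.

End Psd.
End QuadraticForm.

(** * Real powers and the squared L^p norm *)

Section Powers.
Variable R : realType.
Implicit Types (p c t x y : R).

(** For [x] the integral of |v|^p this is the squared L^p norm, the denominator of the energy. *)
Definition sqn p x : R := (x `^ p^-1) ^+ 2.

Lemma sqn_ge0 p x : 0 <= sqn p x. Proof. exact: sqr_ge0. Qed.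

Lemma sqn_gt0 p x : 0 < x -> 0 < sqn p x.
Proof. by move=> x0; rewrite exprn_gt0// powR_gt0. Qed.

(** The factor that comes out is c^(2/p), at most [c] since [2 <= p] and [1 <= c]. *)
Lemma le_sqn p c x y : 2 <= p -> 1 <= c -> 0 <= x -> 0 <= y -> y <= c * x ->
  sqn p y <= c * sqn p x.
Proof.
move=> p2 c1 x0 y0 yx; have p0 : 0 < p by lra.
have c0 : 0 <= c by lra.
have h : y `^ p^-1 <= c `^ p^-1 * x `^ p^-1.
  rewrite -powRM//; apply: ge0_ler_powR => //.
  - by rewrite invr_ge0 ltW.
  - by rewrite nnegrE mulr_ge0.
apply: (@le_trans _ _ ((c `^ p^-1 * x `^ p^-1) ^+ 2)).
  by rewrite ler_pXn2r// nnegrE ?mulr_ge0 ?powR_ge0.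
rewrite exprMn /sqn; apply: ler_wpM2r; first exact: sqr_ge0.
rewrite -powR_mulrn ?powR_ge0// -powRrM -[leRHS]powRr1//.
by apply: ler_powR => //; rewrite mulrC ler_pdivrMr// mul1r.
Qed.

Lemma sqr_le1DpowR p t : 2 <= p -> 0 <= t -> t ^+ 2 <= 1 + t `^ p.
Proof.
move=> p2 t0; have [t1|t1] := leP t 1.
  by apply: ler_wpDr; [exact: powR_ge0|rewrite expr_le1].
apply: ler_wpDl => //; rewrite -powR_mulrn//.
by apply: ler_powR => //; exact: ltW.
Qed.

(** At positive points the power is differentiable; at 0 continuity follows from |x|^p <= |x| for
    |x| <= 1. *)
Lemma powR_continuous p t : 1 <= p -> 0 <= t ->
  {for t, continuous (fun x : R => `|x| `^ p)}.
Proof.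
move=> p1; rewrite le_eqVlt => /predU1P[<-|t0]; last first.
  have h : {for t, continuous (fun x : R => x `^ p)}.
    apply: differentiable_continuous; apply/derivable1_diffP.
    by apply: derivable_powR; rewrite in_itv /= andbT.
  apply: near_cont h; near=> x; rewrite ger0_norm// ltW//; near: x.
  exact: lt_nbhsr.
rewrite /prop_for /continuous_at normr0 powR0; last by rewrite gt_eqF//; lra.
apply/cvgrPdist_lt => e e0; near=> x.
rewrite sub0r normrN ger0_norm ?powR_ge0//.
have xe : `|x| < e by near: x; apply: cvgr0_norm_lt; [exact: cvg_id|].
have x1 : `|x| <= 1 by near: x; apply: cvgr0_norm_le; [exact: cvg_id|].
have [->|x0] := eqVneq x 0; first by rewrite normr0 powR0// gt_eqF//; lra.
by apply: le_lt_trans xe; apply: ge1r_powR => //; rewrite normr_gt0 x0.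
Unshelve. all: by end_near. Qed.

(** The value 6 is the critical exponent in dimension 3, the largest that occurs; an integer power
    is then accessible to ring arithmetic. *)
Lemma powR_ge_expn p t : p <= 6 -> 0 < t <= 1 -> t ^+ 6 <= t `^ p.
Proof.
move=> p6 /andP[t0 t1]; have t01 : 0 < t <= 1 by rewrite t0.
by rewrite -powR_mulrn; [exact: (ger_powR t01 p6)|exact: ltW].
Qed.

End Powers.

(** The entries range over any topological space because jets contain matrices whose entries are
    matrices. *)
Lemma entry_continuous (T : topologicalType) k l (i : 'I_k) (j : 'I_l) :
  continuous (fun A : 'M[T]_(k, l) => A i j).
Proof.
move=> A S AS; exists (fun i' j' => [set x | (i' == i) && (j' == j) -> S x]).
  move=> i' j'; have [/andP[/eqP -> /eqP ->]|h] := boolP ((i' == i) && (j' == j)).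
    by apply: filterS AS => x Sx _.
  by apply: filterS (@filterT _ (nbhs (A i' j')) _) => x _.
by move=> B /= /(_ i j); rewrite !eqxx; exact.
Qed.

(** * The quantities of a metric that enter the energy *)

Section MetricQuantities.
Variables (R : realType) (n : nat).
Implicit Types (A : 'M[R]_n) (g h : 'rV[R]_n -> 'M[R]_n) (p q : 'rV[R]_n).

(** The integrands of the energy and of the L^p norm depend on the metric only through [vol],
    [gradq] and [scalv]. The density is built into all three, so that different metrics are compared
    against the same Lebesgue measure. *)
Definition vol A : R := Num.sqrt (\det A).
Definition gradq A : 'M[R]_n := vol A *: invmx A.
Definition scalv g p : R := scal g p * vol (g p).

Lemma vol_gt0 A : posdef A -> 0 < vol A.
Proof. by move=> pA; rewrite sqrtr_gt0 posdef_det_gt0. Qed.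

Lemma qf_posdef_gt0 A (x : 'I_n -> R) a : posdef A -> x a != 0 -> 0 < qf A x x.
Proof.
move=> pA xa; rewrite qfE; apply: pA; apply: contraNneq xa => /rowP/(_ a).
by rewrite !mxE => ->.
Qed.

Lemma qf_posdef_ge0 A (x : 'I_n -> R) : posdef A -> 0 <= qf A x x.
Proof.
move=> pA; have [[a xa]|h] := pselect (exists a, x a != 0).
  exact/ltW/qf_posdef_gt0/xa.
rewrite /qf big1// => a _; rewrite big1// => b _.
have -> : x a = 0 by apply: contrapT => /eqP xa; apply: h; exists a.
by rewrite mulr0 mul0r.
Qed.

Lemma gradq_sym A : A^T = A -> (gradq A)^T = gradq A.
Proof. by move=> sA; rewrite /gradq linearZ /= trmx_inv sA. Qed.

Lemma gradq_ge0 A x : A^T = A -> posdef A -> 0 <= qf (gradq A) x x.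
Proof.
move=> sA pA; rewrite qf_scale mulr_ge0 ?sqrtr_ge0//.
exact/qf_posdef_ge0/posdef_inv.
Qed.

(* Cauchy-Schwarz for [A] against the dual basis vectors. *)
Lemma qf_coercive A : A^T = A -> posdef A ->
  exists2 l, 0 < l & forall x : 'I_n -> R, l * \sum_a x a ^+ 2 <= qf A x x.
Proof.
move=> sA pA; have uA := posdef_unit pA.
pose k a := invmx A a a.
have ikA : posdef (invmx A) by exact: posdef_inv.
have k0 a : 0 <= k a.
  have := @qf_posdef_ge0 (invmx A) (fun b => (b == a)%:R) ikA.
  rewrite /qf (bigD1 a)//= [X in _ + X]big1 ?addr0; last first.
    by move=> b /negbTE ba; rewrite big1// => c _; rewrite ba mulr0 mul0r.
  rewrite (bigD1 a)//= [X in _ + X]big1 ?addr0; last first.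
    by move=> b /negbTE ba; rewrite ba mulr0.
  by rewrite eqxx !mulr1.
have key a x : x a ^+ 2 <= (1 + k a) * qf A x x.
  pose y b := invmx A a b.
  have Ay z : qf A y z = z a.
    rewrite /qf exchange_big /= (bigD1 a)//= [X in _ + X]big1 ?addr0.
      rewrite -mulr_suml (_ : \sum_(_ | _) _ = 1) ?mul1r//.
      have E : \sum_j invmx A a j * A j a = 1.
        by have /matrixP/(_ a a) := mulVmx uA; rewrite !mxE eqxx.
      rewrite -[RHS]E.
      by apply: eq_bigr => b _; rewrite mulrC.
    move=> b /negbTE ba; rewrite -mulr_suml (_ : \sum_(_ | _) _ = 0) ?mul0r//.
    have E : \sum_j invmx A a j * A j b = 0.
      by have /matrixP/(_ a b) := mulVmx uA; rewrite !mxE eq_sym ba.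
    rewrite -[RHS]E.
    by apply: eq_bigr => c _; rewrite mulrC.
  (* The form is evaluated at x - s x_a y, where [y] is dual to the coordinate x_a. The choice s =
     1/(1 + k a) ensures [s * k a <= 1] from [0 <= k a] alone. *)
  have s0 : 0 < (1 + k a)^-1 by rewrite invr_gt0; have := k0 a; lra.
  have E : (1 + k a) * (1 + k a)^-1 = 1 by rewrite divff// gt_eqF//; have := k0 a; lra.
  set s := (1 + k a)^-1 in s0 E.
  have := @qf_posdef_ge0 A (fun b => 1 * x b + (- (s * x a)) * y b) pA.
  have pge z : 0 <= qf A z z by exact: qf_posdef_ge0.
  rewrite (qf_comb sA) (qfC sA x y) !Ay -/(k a) => h.
  have h1 : s * x a ^+ 2 <= qf A x x.
    have h2 : s * (s * k a) * x a ^+ 2 <= s * x a ^+ 2.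
      apply: ler_wpM2r; first exact: sqr_ge0.
      by rewrite ler_piMr ?(ltW s0)//; have := k0 a; nra.
    by rewrite /y -/(k a) in h; nra.
  have h3 : 0 <= 1 + k a by have := k0 a; lra.
  have := ler_wpM2l h3 h1; rewrite mulrA E mul1r; exact.
have S0 : 0 < 1 + \sum_a (1 + k a).
  by apply: ltr_pwDl => //; apply: sumr_ge0 => a _; rewrite addr_ge0.
exists (1 + \sum_a (1 + k a))^-1; first by rewrite invr_gt0.
move=> x; rewrite ler_pdivrMl// mulrDl mul1r mulr_suml.
apply: ler_wpDl; first exact: qf_posdef_ge0.
by apply: ler_sum => a _; exact: key.
Qed.

(** From |x_a x_b| <= (x_a^2 + x_b^2)/2; summing over the other index produces the factor [n]. *)
Lemma qf_dist A A' d (x : 'I_n -> R) : (forall a b, `|A a b - A' a b| <= d) ->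
  `|qf A x x - qf A' x x| <= d * n%:R * \sum_a x a ^+ 2.
Proof.
move=> AA.
have -> : qf A x x - qf A' x x = \sum_a \sum_b (A a b - A' a b) * x a * x b.
  rewrite /qf -sumrB; apply: eq_bigr => a _; rewrite -sumrB.
  by apply: eq_bigr => b _; rewrite !mulrBl.
apply: le_trans (ler_norm_sum _ _ _) _.
apply: (@le_trans _ _ (\sum_a \sum_(b < n) d * ((x a ^+ 2 + x b ^+ 2) / 2))).
  apply: ler_sum => a _; apply: le_trans (ler_norm_sum _ _ _) _.
  apply: ler_sum => b _; rewrite -mulrA normrM.
  apply: ler_pM => //.
  have -> : (x a ^+ 2 + x b ^+ 2) / 2 = (`|x a| ^+ 2 + `|x b| ^+ 2) / 2.
    by rewrite !real_normK ?num_real.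
  by rewrite normrM; have := sqr_ge0 (`|x a| - `|x b|); nra.
have E a : \sum_(b < n) d * ((x a ^+ 2 + x b ^+ 2) / 2) =
    d / 2 * n%:R * x a ^+ 2 + d / 2 * \sum_b x b ^+ 2.
  have -> : d / 2 * n%:R * x a ^+ 2 = \sum_(b < n) d / 2 * x a ^+ 2.
    by rewrite sumr_const card_ord -[RHS]mulr_natr; ring.
  by rewrite mulr_sumr -big_split; apply: eq_bigr => b _ /=; field.
rewrite (eq_bigr _ (fun a _ => E a)) big_split /= -mulr_sumr sumr_const card_ord -[X in _ + X <= _]mulr_natr.
have {E} E (u w : R) : d / 2 * w * u + d / 2 * u * w = d * w * u by field.
by rewrite -(E (\sum_a x a ^+ 2) n%:R).
Qed.

End MetricQuantities.

Section ClosenessArithmetic.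
Variable R : realType.

(** Two quantities within [d] of a centre differ by at most [2 * d], which has to be absorbed by the
    density [v] at the moving point and not by that of the centre; [v] is at least three quarters of
    [v0]. *)
Lemma closeness_vol_arith (e v0 v d : R) : 0 < e -> e <= 1 -> 0 < v0 ->
  `|v - v0| <= d -> d <= e * v0 / 4 -> 2 * d <= e * v.
Proof.
move=> e0 e1 v00; rewrite ler_distl => /andP[g1 _] dd1.
have ev : e * v0 <= v0 by rewrite ler_piMl// ltW.
have hv : v0 * (3 / 4) <= v by lra.
by have := ler_wpM2l (ltW e0) hv; have := mulr_gt0 e0 v00; lra.
Qed.

(** The analogue for quadratic forms, with [l] the coercivity constant at the centre and [S] the
    Euclidean square of the vector: [qg] keeps at least 7/8 of [l * S]. *)
Lemma closeness_grad_arith (l e N d S qg q0 : R) : 0 < l -> 0 < e -> e <= 1 ->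
  0 <= N -> 0 <= d -> 0 <= S -> `|qg - q0| <= d * N * S -> l * S <= q0 ->
  d <= l * e / (8 * (N + 1)) -> 2 * d * N * S <= e / 2 * qg.
Proof.
move=> l0 e0 e1 N0 d0 S0; rewrite ler_distl => /andP[k2 _] k3 dd2.
have dn : d * N <= l * e / 8.
  have : d * (8 * (N + 1)) <= l * e.
    by rewrite -ler_pdivlMr// mulr_gt0// ltr_wpDl.
  by lra.
have dn1 : d * N <= l / 8 by apply: le_trans dn _; rewrite ler_wpM2r// ler_piMr// ltW.
have k4 : l * (7 / 8) * S <= qg.
  by have := ler_wpM2r S0 dn1; lra.
have e20 : 0 <= e / 2 by lra.
have k5 := ler_wpM2l e20 k4.
have k6 := ler_wpM2r S0 dn.
have : 0 <= l * e * S by rewrite !mulr_ge0// ltW.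
lra.
Qed.

End ClosenessArithmetic.

(** * Scalar curvature and 2-jets *)

Section JetScal.
Variables (R : realType) (n : nat).
Implicit Types (g h : 'rV[R]_n -> 'M[R]_n) (p q : 'rV[R]_n) (c : jet_space R n).

Definition jet_metric c : 'M[R]_n := c.1.1.2.
Definition jet_d1 c (a : 'I_n) : 'M[R]_n := c.1.2 0 a.
Definition jet_d2 c (a b : 'I_n) : 'M[R]_n := c.2 a b.

Definition jet_dinv c (m : 'I_n) : 'M[R]_n := - (invmx (jet_metric c) *m jet_d1 c m *m invmx (jet_metric c)).

Definition jet_christoffel c (k i j : 'I_n) : R :=
  2^-1 * \sum_l invmx (jet_metric c) k l * (jet_d1 c i j l + jet_d1 c j i l - jet_d1 c l i j).

(** A jet is a list of numbers and cannot be differentiated, so the derivative of the Christoffel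
    symbol is written out by the product rule, with [jet_dinv] for the derivative of the inverse
    metric. *)
Definition jet_dchristoffel c (m k i j : 'I_n) : R :=
  2^-1 * \sum_l (jet_dinv c m k l * (jet_d1 c i j l + jet_d1 c j i l - jet_d1 c l i j)
    + invmx (jet_metric c) k l * (jet_d2 c m i j l + jet_d2 c m j i l - jet_d2 c m l i j)).

Definition jet_ricci c (i j : 'I_n) : R :=
  \sum_k (jet_dchristoffel c k k i j - jet_dchristoffel c j k i k)
  + \sum_k \sum_l (jet_christoffel c k k l * jet_christoffel c l i j
                   - jet_christoffel c k j l * jet_christoffel c l i k).

Definition jet_scal c : R := \sum_i \sum_j invmx (jet_metric c) i j * jet_ricci c i j.

Section JetOfMetric.
Variables (O : set 'rV[R]_n) (oO : open O) (g : 'rV[R]_n -> 'M[R]_n).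
Hypothesis sg : forall a b, smooth_on O (fun p => g p a b).
Hypothesis ug : forall p, O p -> g p \in unitmx.

Lemma partialD (f h : 'rV[R]_n -> R) p a : smooth_on O f -> smooth_on O h -> O p ->
  partial a (fun q => f q + h q) p = partial a f p + partial a h p.
Proof.
move=> sf sh Op; rewrite /partial; apply: deriveD; exact: smooth_derivable Op.
Qed.

Lemma partialM (f h : 'rV[R]_n -> R) p a : smooth_on O f -> smooth_on O h -> O p ->
  partial a (fun q => f q * h q) p = partial a f p * h p + f p * partial a h p.
Proof.
move=> sf sh Op; rewrite /partial.
have -> : 'D_(delta_mx 0 a) (fun q => f q * h q) p = 'D_(delta_mx 0 a) (f * h) p by [].
rewrite deriveM; [|exact: smooth_derivable Op|exact: smooth_derivable Op].
by rewrite /GRing.scale /= addrC mulrC.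
Qed.

Lemma partial_cst (x : R) p a : partial a (fun _ : 'rV[R]_n => x) p = 0.
Proof. exact: derive_cst. Qed.

Lemma partialZ x (f : 'rV[R]_n -> R) p a : smooth_on O f -> O p ->
  partial a (fun q => x * f q) p = x * partial a f p.
Proof.
move=> sf Op; rewrite (@partialM (cst x) f p a (smooth_cst x) sf Op).
by rewrite partial_cst mul0r add0r.
Qed.

Lemma partialB (f h : 'rV[R]_n -> R) p a : smooth_on O f -> smooth_on O h -> O p ->
  partial a (fun q => f q - h q) p = partial a f p - partial a h p.
Proof.
move=> sf sh Op; rewrite /partial; apply: deriveB; exact: smooth_derivable Op.
Qed.

Lemma partial_sum (I : Type) (r : seq I) (F : I -> 'rV[R]_n -> R) p a :
  (forall i, smooth_on O (F i)) -> O p ->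
  partial a (fun q => \sum_(i <- r) F i q) p = \sum_(i <- r) partial a (F i) p.
Proof.
move=> sF Op; elim: r => [|i r IH].
  rewrite big_nil (_ : (fun _ => _) = cst 0) ?partial_cst//.
  by apply/funext => q; rewrite big_nil.
rewrite big_cons -IH -partialD//; last exact: smooth_sum.
by congr partial; apply/funext => q; rewrite big_cons.
Qed.

(** Differentiate g g^-1 = 1, which holds in a neighborhood of [p] because [O] is open. *)
Lemma partial_invmx p a : O p ->
  (\matrix_(k, l) partial a (fun q => invmx (g q) k l) p) =
  - (invmx (g p) *m (\matrix_(k, l) partial a (fun q => g q k l) p) *m invmx (g p)).
Proof.
move=> Op; set D := LHS; set G := \matrix_(k, l) partial a (fun q => g q k l) p.
have si k l : smooth_on O (fun q => invmx (g q) k l) by exact: smooth_invmx.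
have E : G *m invmx (g p) + g p *m D = 0.
  apply/matrixP => k l; rewrite !mxE -big_split /=.
  rewrite -[RHS](partial_cst ((k == l)%:R) p a).
  transitivity (partial a (fun q => \sum_m g q k m * invmx (g q) m l) p).
    rewrite partial_sum; [|by move=> m; exact: smooth_mul|exact: Op].
    by apply: eq_bigr => m _; rewrite partialM// !mxE.
  apply: partial_near; near=> q.
  have Oq : O q by near: q; apply: open_nbhs_nbhs.
  by have /matrixP/(_ k l) := mulmxV (ug Oq); rewrite !mxE.
move/eqP: E; rewrite addrC addr_eq0 => /eqP E.
by rewrite -[LHS](mulKmx (ug Op)) E mulmxN mulmxA.
Unshelve. all: by end_near. Qed.

Lemma jet_christoffelE p k i j : jet_christoffel (jet2 g p) k i j = christoffel g k i j p.
Proof.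
rewrite /jet_christoffel /christoffel; congr (_ * _); apply: eq_bigr => l _.
by rewrite /jet_metric /jet_d1 /jet2 /= !mxE.
Qed.

Lemma jet_dchristoffelE p m k i j : O p ->
  jet_dchristoffel (jet2 g p) m k i j = partial m (christoffel g k i j) p.
Proof.
move=> Op.
have si a b : smooth_on O (fun q => invmx (g q) a b) by exact: smooth_invmx.
have sd a b d : smooth_on O (partial a (fun q => g q b d)) by exact: smooth_partial.
have st l : smooth_on O (fun p => partial i (fun q => g q j l) p +
    partial j (fun q => g q i l) p - partial l (fun q => g q i j) p).
  by apply: smooth_sub => //; exact: smooth_add.
rewrite /christoffel partialZ//; last by apply: smooth_sum => // l _; exact: smooth_mul.
rewrite partial_sum; [|by move=> l; exact: smooth_mul|exact: Op].
rewrite /jet_dchristoffel; congr (_ * _); apply: eq_bigr => l _.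
rewrite partialM// partialB//; last exact: smooth_add.
rewrite partialD//.
have -> : jet_dinv (jet2 g p) m k l = partial m (fun q => invmx (g q) k l) p.
  have /matrixP/(_ k l) := partial_invmx m Op; rewrite mxE => ->.
  by rewrite /jet_dinv /jet_metric /jet_d1 /jet2 /= mxE.
by rewrite /jet_metric /jet_d1 /jet_d2 /jet2 /= !mxE.
Qed.

(** Exhibits the scalar curvature as a function of the 2-jet; this is why closeness in the C^2 sense
    controls it. *)
Lemma jet_scalE p : O p -> jet_scal (jet2 g p) = scal g p.
Proof.
move=> Op; apply: eq_bigr => i _; apply: eq_bigr => j _; congr (_ * _).
rewrite /jet_ricci /ricci; congr (_ + _).
  by apply: eq_bigr => k _; rewrite !jet_dchristoffelE.
by apply: eq_bigr => k _; apply: eq_bigr => l _; rewrite !jet_christoffelE.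
Qed.

End JetOfMetric.

Section JetContinuity.
Variable c0 : jet_space R n.
Hypothesis uc : jet_metric c0 \in unitmx.

Lemma jm_cont a b : {for c0, continuous (fun c => jet_metric c a b)}.
Proof.
apply: (@continuous_comp _ _ _ jet_metric (fun A : 'M[R]_n => A a b)); last exact: entry_continuous.
apply: (@continuous_comp _ _ _ (fun c : jet_space R n => c.1.1) snd); last exact: cvg_snd.
by apply: (@continuous_comp _ _ _ (fun c : jet_space R n => c.1) fst); exact: cvg_fst.
Qed.

Lemma jd_cont k a b : {for c0, continuous (fun c => jet_d1 c k a b)}.
Proof.
apply: (@continuous_comp _ _ _ (fun c => jet_d1 c k) (fun A : 'M[R]_n => A a b)); last exact: entry_continuous.
apply: (@continuous_comp _ _ _ (fun c : jet_space R n => c.1.2)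
  (fun B : 'rV['M[R]_n]_n => B 0 k)); last exact: entry_continuous.
by apply: (@continuous_comp _ _ _ (fun c : jet_space R n => c.1) snd); [exact: cvg_fst|exact: cvg_snd].
Qed.

Lemma jdd_cont k l a b : {for c0, continuous (fun c => jet_d2 c k l a b)}.
Proof.
apply: (@continuous_comp _ _ _ (fun c => jet_d2 c k l) (fun A : 'M[R]_n => A a b)); last exact: entry_continuous.
apply: (@continuous_comp _ _ _ (fun c : jet_space R n => c.2)
  (fun B : 'M['M[R]_n]_n => B k l)); [exact: cvg_snd|exact: entry_continuous].
Qed.

Lemma jinv_cont a b : {for c0, continuous (fun c => invmx (jet_metric c) a b)}.
Proof. by apply: cont_invmx => // i j; exact: jm_cont. Qed.

Lemma jet_dinv_cont m a b : {for c0, continuous (fun c => jet_dinv c m a b)}.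
Proof.
rewrite (_ : (fun _ => _) = (fun c => - \sum_l
    (\sum_k invmx (jet_metric c) a k * jet_d1 c m k l) * invmx (jet_metric c) l b)); last first.
  apply/funext => c; rewrite /jet_dinv !mxE; congr (- _).
  by apply: eq_bigr => l _; rewrite !mxE.
apply: cont_opp; apply: cont_sum => l; apply: cont_mul; last exact: jinv_cont.
by apply: cont_sum => k; apply: cont_mul; [exact: jinv_cont|exact: jd_cont].
Qed.

Lemma jet_christoffel_cont k i j : {for c0, continuous (fun c => jet_christoffel c k i j)}.
Proof.
apply: cont_mul; first exact: cont_cst.
apply: cont_sum => l; apply: cont_mul; first exact: jinv_cont.
by apply: cont_sub; [apply: cont_add|]; exact: jd_cont.
Qed.

Lemma jet_dchristoffel_cont m k i j :
  {for c0, continuous (fun c => jet_dchristoffel c m k i j)}.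
Proof.
apply: cont_mul; first exact: cont_cst.
apply: cont_sum => l; apply: cont_add; apply: cont_mul.
- exact: jet_dinv_cont.
- by apply: cont_sub; [apply: cont_add|]; exact: jd_cont.
- exact: jinv_cont.
- by apply: cont_sub; [apply: cont_add|]; exact: jdd_cont.
Qed.

Lemma jet_scal_cont : {for c0, continuous jet_scal}.
Proof.
apply: cont_sum => i; apply: cont_sum => j; apply: cont_mul; first exact: jinv_cont.
apply: cont_add; apply: cont_sum => k.
  by apply: cont_sub; exact: jet_dchristoffel_cont.
by apply: cont_sum => l; apply: cont_sub; apply: cont_mul; exact: jet_christoffel_cont.
Qed.

Lemma jet_vol_cont : {for c0, continuous (fun c => vol (jet_metric c))}.
Proof.
apply: (@continuous_comp _ _ _ (fun c => \det (jet_metric c)) Num.sqrt).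
  by apply: cont_det => a b; exact: jm_cont.
exact: sqrt_continuous.
Qed.

Lemma jet_gradq_cont a b : {for c0, continuous (fun c => gradq (jet_metric c) a b)}.
Proof.
rewrite (_ : (fun _ => _) = (fun c => vol (jet_metric c) * invmx (jet_metric c) a b)); last first.
  by apply/funext => c; rewrite mxE.
by apply: cont_mul; [exact: jet_vol_cont|exact: jinv_cont].
Qed.

(** A neighborhood of [c0], given by closed conditions on just those functions of the jet that enter
    the integrals; open conditions are recovered by taking interiors. *)
Definition jet_close (d : R) : set (jet_space R n) := [set c |
  [/\ `|vol (jet_metric c) - vol (jet_metric c0)| <= d,
      `|jet_scal c * vol (jet_metric c) - jet_scal c0 * vol (jet_metric c0)| <= d &
      forall a b, `|gradq (jet_metric c) a b - gradq (jet_metric c0) a b| <= d]].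

Lemma jet_closeI d c s s0 : jet_scal c = s -> jet_scal c0 = s0 ->
  `|vol (jet_metric c) - vol (jet_metric c0)| <= d -> `|s * vol (jet_metric c) - s0 * vol (jet_metric c0)| <= d ->
  (forall a b, `|gradq (jet_metric c) a b - gradq (jet_metric c0) a b| <= d) -> jet_close d c.
Proof. by move=> <- <-. Qed.

Lemma jet_close_nbhs d : 0 < d -> nbhs c0 (jet_close d).
Proof.
move=> d0.
have h1 : \forall c \near c0, `|vol (jet_metric c) - vol (jet_metric c0)| <= d.
  have /cvgrPdist_le/(_ d d0) := jet_vol_cont; apply: filterS => c.
  by rewrite distrC.
have h2 : \forall c \near c0, `|jet_scal c * vol (jet_metric c) - jet_scal c0 * vol (jet_metric c0)| <= d.
  have /cvgrPdist_le/(_ d d0) := cont_mul jet_scal_cont jet_vol_cont; apply: filterS => c.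
  by rewrite distrC.
have h3 : \forall c \near c0, forall a b, `|gradq (jet_metric c) a b - gradq (jet_metric c0) a b| <= d.
  have : \forall c \near c0, forall ab : 'I_n * 'I_n, `|gradq (jet_metric c) ab.1 ab.2 - gradq (jet_metric c0) ab.1 ab.2| <= d.
    apply: (@filter_forall _ _ (fun (ab : 'I_n * 'I_n) c =>
      `|gradq (jet_metric c) ab.1 ab.2 - gradq (jet_metric c0) ab.1 ab.2| <= d) _ (nbhs_filter c0)) => -[a b] /=.
    have /cvgrPdist_le/(_ d d0) := @jet_gradq_cont a b; apply: filterS => c.
    by rewrite distrC.
  by apply: filterS => c h a b; exact: (h (a, b)).
by apply: filterS3 h1 h2 h3 => c.
Qed.

End JetContinuity.

(** All errors are measured by [g] at the same point. The factor [e / 2] for the gradient is the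
    gain that [qf_cutoff] leaves; the scalar curvatures are compared by absolute, not relative,
    error. *)
Definition closeness (e : R) g h q :=
  [/\ `|vol (h q) - vol (g q)| <= e * vol (g q),
      `|scalv h q - scalv g q| <= e * vol (g q) &
      forall x : 'I_n -> R, `|qf (gradq (h q)) x x - qf (gradq (g q)) x x| <=
        e / 2 * qf (gradq (g q)) x x].

Lemma closenessW e e' g h q : (g q)^T = g q -> posdef (g q) -> e <= e' ->
  closeness e g h q -> closeness e' g h q.
Proof.
move=> sy pd ee [h1 h2 h3]; split.
- by apply: le_trans h1 _; rewrite ler_wpM2r// sqrtr_ge0.
- by apply: le_trans h2 _; rewrite ler_wpM2r// sqrtr_ge0.
- move=> x; apply: le_trans (h3 x) _; rewrite ler_wpM2r ?gradq_ge0//.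
  by rewrite ler_wpM2r.
Qed.

(** One [d] serves all points and both metrics, as long as both jets are near the fixed jet [c0]:
    the triangle inequality passes through [c0], and the resulting error is then measured by [g] at
    the point [q]. *)
Lemma jet_close_closeness (c0 : jet_space R n) e : (jet_metric c0)^T = jet_metric c0 -> posdef (jet_metric c0) ->
  0 < e <= 1 -> exists2 d, 0 < d & forall g h q,
    jet_close c0 d (jet2 g q) -> jet_close c0 d (jet2 h q) ->
    jet_scal (jet2 g q) = scal g q -> jet_scal (jet2 h q) = scal h q ->
    closeness e g h q.
Proof.
move=> sc pc /andP[e0 e1].
have v0 := vol_gt0 pc.
have pg : posdef (gradq (jet_metric c0)).
  move=> w w0; rewrite /gradq -scalemxAr -scalemxAl mxE mulr_gt0//.
  exact: posdef_inv.
have [l l0 hl] := qf_coercive (gradq_sym sc) pg.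
(* [d1] controls the density and the scalar term; [d2] controls the gradient form through the
   coercivity constant [l]. *)
pose d1 := e * vol (jet_metric c0) / 4; pose d2 := l * e / (8 * (n%:R + 1)).
have n0 : 0 <= n%:R :> R by [].
have d10 : 0 < d1 by rewrite divr_gt0// mulr_gt0.
have d20 : 0 < d2 by rewrite divr_gt0 ?mulr_gt0// ltr_wpDl.
exists (Num.min d1 d2); first by rewrite lt_min d10.
set d := Num.min d1 d2; have dd1 : d <= d1 by rewrite ge_min lexx.
have dd2 : d <= d2 by rewrite ge_min lexx orbT.
have d0 : 0 < d by rewrite lt_min d10.
move=> g h q [g1 g2 g3] [h1 h2 h3] Eg Eh.
rewrite Eg in g2; rewrite Eh in h2.
have jg : jet_metric (jet2 g q) = g q by [].
have jh : jet_metric (jet2 h q) = h q by [].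
rewrite jg in g1 g2 g3; rewrite jh in h1 h2 h3.
have dv : 2 * d <= e * vol (g q) by exact: closeness_vol_arith e0 e1 v0 g1 dd1.
have tri (x y z : R) : `|x - z| <= d -> `|y - z| <= d -> `|y - x| <= 2 * d.
  move=> xz yz; rewrite (le_trans (ler_distD z _ _))// [`|z - x|]distrC.
  by rewrite mulr_natl mulr2n lerD.
split.
- exact: le_trans (tri _ _ _ g1 h1) dv.
- exact: le_trans (tri _ _ _ g2 h2) dv.
move=> x; set S := \sum_a x a ^+ 2.
have S0 : 0 <= S by apply: sumr_ge0 => a _; exact: sqr_ge0.
have k1 : `|qf (gradq (h q)) x x - qf (gradq (g q)) x x| <= 2 * d * n%:R * S.
  by apply: qf_dist => a b; exact: tri (g3 a b) (h3 a b).
apply: le_trans k1 _.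
have k2 : `|qf (gradq (g q)) x x - qf (gradq (jet_metric c0)) x x| <= d * n%:R * S by exact: qf_dist.
have k3 := hl x; rewrite -/S in k3.
exact: closeness_grad_arith l0 e0 e1 n0 (ltW d0) S0 k2 k3 dd2.
Qed.

Lemma jet_close_jet2 g h p q d : jet_scal (jet2 g p) = scal g p ->
  jet_scal (jet2 h q) = scal h q ->
  `|vol (h q) - vol (g p)| <= d -> `|scalv h q - scalv g p| <= d ->
  (forall a b, `|gradq (h q) a b - gradq (g p) a b| <= d) ->
  jet_close (jet2 g p) d (jet2 h q).
Proof. by move=> Eg Eh h1 h2 h3; apply: jet_closeI Eh Eg h1 h2 h3. Qed.

Lemma jet_close_jet2_nbhs g p d : g p \in unitmx -> 0 < d ->
  nbhs (jet2 g p) (jet_close (jet2 g p) d).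
Proof. by move=> u d0; exact: jet_close_nbhs. Qed.

Lemma jet_close_jet2_closeness g0 p e : (g0 p)^T = g0 p -> posdef (g0 p) ->
  0 < e <= 1 -> exists2 d, 0 < d & forall g h q,
    jet_close (jet2 g0 p) d (jet2 g q) -> jet_close (jet2 g0 p) d (jet2 h q) ->
    jet_scal (jet2 g q) = scal g q -> jet_scal (jet2 h q) = scal h q ->
    closeness e g h q.
Proof. by move=> s0 p0 e0; exact: jet_close_closeness. Qed.

End JetScal.

(** * Neighborhoods of a metric in the fine topology *)

Section FineNeighborhood.
Variables (R : realType) (n : nat) (M : manifold R n).
Implicit Types (U V K : set M) (i j : chart_idx M) (g h : Metr M).

Lemma metr_sym U (g : riem U) i q : cdom U i q -> (g i q)^T = g i q.
Proof. exact: comp_sym. Qed.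

Lemma metr_posdef U (g : riem U) i q : cdom U i q -> posdef (g i q).
Proof. by move=> iq w; exact: comp_pos. Qed.

Lemma metr_unit U (g : riem U) i q : cdom U i q -> g i q \in unitmx.
Proof. by move=> iq; apply: posdef_unit; exact: metr_posdef. Qed.

Lemma metr_smooth U (g : riem U) i a b : smooth_on (cdom U i) (fun p => g i p a b).
Proof. exact: comp_smooth. Qed.

Lemma jet_box_open i (O : set (jet_space R n)) : open O -> open (jet_box (M := M) i O).
Proof.
move=> oO; exists [set jet_box (M := M) i O].
  by move=> _ ->; apply: (@finI_from1 _ _ _ id); exists i, O.
by rewrite bigcup_set1.
Qed.

Lemma jet_valE (J : jet M) i : exists (V : set M) (h : riem V),
  jet_val J i = if `[< dom i (jet_base J) >] then
    Some (jet2 (h i) (chart i (jet_base J))) else None.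
Proof. by have [V [h [_ _ ->]]] := jet_valP J; exists V, h. Qed.

(** In every chart around it a jet carries its base point as the first coordinate, so the preimage
    of [V] is a union of jet boxes. *)
Lemma jet_base_open V : open V -> open [set J : jet M | V (jet_base J)].
Proof.
move=> oV.
have -> : [set J : jet M | V (jet_base J)] =
    \bigcup_(i in [set: chart_idx M]) jet_box i [set c : jet_space R n | cdom V i c.1.1.1].
  apply/seteqP; split => J /=.
    move=> VJ; have [i iJ] := dom_cover (jet_base J); exists i => //.
    have [W [h E]] := jet_valE J i; rewrite asboolT// in E.
    exists (jet2 (h i) (chart i (jet_base J))) => //.
    exact: cdom_chart.
  move=> [i _ [c Jc]] /=; have [W [h E]] := jet_valE J i.
  move: E; rewrite Jc; case: asboolP => // iJ [->] /= /cdom_parm[_ + _].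
  by rewrite chartK.
apply: bigcup_open => i _; apply: jet_box_open.
apply: (@open_comp _ _ (fun c : jet_space R n => c.1.1.1) (cdom V i)); last exact: cdom_open.
move=> c _.
apply: (@continuous_comp _ _ _ (fun c : jet_space R n => c.1.1) fst); last exact: cvg_fst.
by apply: (@continuous_comp _ _ _ (fun c : jet_space R n => c.1) fst); exact: cvg_fst.
Qed.

#[local] Opaque scal jet_scal vol gradq jet_close closeness jet2.

Section MetricContinuity.
Variables (U : set M) (g : riem U) (i : chart_idx M) (q0 : 'rV[R]_n).
Hypothesis oU : open U.
Hypothesis iq : cdom U i q0.

Let oc : open (cdom U i). Proof. exact: cdom_open. Qed.

Let sg a b : smooth_on (cdom U i) (fun p => g i p a b).
Proof. exact: metr_smooth. Qed.

Let ug p : cdom U i p -> g i p \in unitmx.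
Proof. exact: metr_unit. Qed.

Lemma vol_continuous : {for q0, continuous (fun q => vol (g i q))}.
Proof.
apply: (@continuous_comp _ _ _ (fun q => \det (g i q)) Num.sqrt).
  exact: (smooth_cont (smooth_det oc sg) iq).
exact: sqrt_continuous.
Qed.

Lemma scalv_continuous : {for q0, continuous (scalv (g i))}.
Proof.
apply: cont_mul; last exact: vol_continuous.
exact: (smooth_cont (smooth_scal oc sg ug) iq).
Qed.

Lemma gradq_continuous a b : {for q0, continuous (fun q => gradq (g i q) a b)}.
Proof.
have -> : (fun q => gradq (g i q) a b) = (fun q => vol (g i q) * invmx (g i q) a b).
  by apply/funext => c; rewrite mxE.
apply: cont_mul; first exact: vol_continuous.
exact: (smooth_cont (smooth_invmx oc ug sg a b) iq).
Qed.

Lemma metr_jet_scal : jet_scal (jet2 (g i) q0) = scal (g i) q0.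
Proof. exact: (jet_scalE oc sg ug iq). Qed.

End MetricContinuity.

#[local] Opaque scal jet_scal vol gradq jet_close closeness jet2.

Lemma dist_near (T : topologicalType) (f : T -> R) (t : T) d : {for t, continuous f} ->
  0 < d -> \forall s \near t, `|f s - f t| <= d.
Proof.
by move=> /cvgrPdist_le + d0 => /(_ d d0); apply: filterS => s; rewrite distrC.
Qed.

(** The jet of [g] itself stays near its value at [q0]; continuity of the three quantities that
    [jet_close] inspects gives this directly. *)
Lemma jet_close_near_chart g i q0 d : cdom [set: M] i q0 -> 0 < d ->
  \forall q \near q0, jet_close (jet2 (g i) q0) d (jet2 (g i) q).
Proof.
move=> iq d0; have oT : open [set: M] by exact: openT.
have h1 := dist_near (vol_continuous (g := g) oT iq) d0.
have h2 := dist_near (scalv_continuous (g := g) oT iq) d0.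
have h3 : \forall q \near q0, forall ab : 'I_n * 'I_n,
    `|gradq (g i q) ab.1 ab.2 - gradq (g i q0) ab.1 ab.2| <= d.
  apply: (@filter_forall _ _ (fun (ab : 'I_n * 'I_n) q =>
    `|gradq (g i q) ab.1 ab.2 - gradq (g i q0) ab.1 ab.2| <= d) _ (nbhs_filter q0)) => ab.
  exact: (dist_near (gradq_continuous (g := g) oT iq (a := ab.1) (b := ab.2)) d0).
have hc : \forall q \near q0, cdom [set: M] i q.
  by apply: open_nbhs_nbhs; split => //; exact: cdom_open.
apply: filterS (filterI (filterI h1 h2) (filterI h3 hc)) => q [[k1 k2] [k3 k4]].
exact: (jet_close_jet2 (metr_jet_scal g oT iq) (metr_jet_scal g oT k4) k1 k2
  (fun a b => k3 (a, b))).
Qed.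

Lemma jet_close_near g i x d : dom i x -> 0 < d ->
  \forall y \near x, dom i y /\
    jet_close (jet2 (g i) (chart i x)) d (jet2 (g i) (chart i y)).
Proof.
move=> ix d0.
have hd : \forall y \near x, dom i y.
  by apply: open_nbhs_nbhs; split => //; exact: dom_open.
have hq := jet_close_near_chart g (cdom_chart ix I) d0.
have hx : \forall y \near x,
    jet_close (jet2 (g i) (chart i x)) d (jet2 (g i) (chart i y)).
  exact: (chart_continuous ix hq).
by apply: filterS2 hd hx => y ? ?.
Qed.

(* Closeness is required at once in all charts that enter the integrals at [y],
   so the invariance of the scalar curvature under changes of charts is never
   needed. *)
Lemma fine_closeness g (e : nat -> M -> R) :
  partition_of_unity (@pou R n M) ->
  (forall m, continuous (e m)) -> (forall m y, 0 <= e m y <= 1) ->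
  (forall y, exists m, 0 < e m y) ->
  exists W : set (jet M), [/\ open W, graph_j2 g `<=` W &
    forall h, graph_j2 h `<=` W -> forall y, exists2 m, 0 < e m y &
      forall i, pou i y != 0 -> closeness (e m y) (g i) (h i) (chart i y)].
Proof.
move=> [cchi chi0 schi lf sum1] ce e01 epos.
have pd i y : dom i y -> cdom [set: M] i (chart i y) by move=> iy; exact: cdom_chart.
(* It suffices to find an open set of jets around the jet of [g] at each [x]; the union works, since
   the condition concerns one point [y] at a time. *)
suff /choice[W WP] : forall x, exists W : set (jet M), [/\ open W, W (j2 g x) &
    forall h y, W (j2 h y) -> exists2 m, 0 < e m y &
      forall i, pou i y != 0 -> closeness (e m y) (g i) (h i) (chart i y)].
  exists (\bigcup_(x in [set: M]) W x); split.
  - by apply: bigcup_open => x _; have [] := WP x.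
  - by move=> _ [x _ <-]; exists x => //; have [] := WP x.
  - move=> h hW y; have [|x _ Wx] := hW (j2 h y); first by exists y.
    by have [_ _] := WP x; exact.
move=> x; have [m emx] := epos x.
have [N Nx /finite_seqP[F EF]] := lf x.
(* By continuity [e m] stays above [e0] near [x], so [e0]-closeness with a fixed constant implies
   closeness at the rate [e m y]. *)
pose e0 := e m x / 2.
have e00 : 0 < e0 by rewrite divr_gt0.
have e001 : 0 < e0 <= 1.
  by rewrite e00 /e0; have /andP[_] := e01 m x; lra.
have /choice[d dP] : forall i, exists d, 0 < d /\ (dom i x -> forall (g' h' : 'rV[R]_n -> 'M[R]_n) q,
    jet_close (jet2 (g i) (chart i x)) d (jet2 g' q) ->
    jet_close (jet2 (g i) (chart i x)) d (jet2 h' q) ->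
    jet_scal (jet2 g' q) = scal g' q -> jet_scal (jet2 h' q) = scal h' q ->
    closeness e0 g' h' q).
  move=> i; have [ix|ix] := pselect (dom i x); last by exists 1.
  have [d d0 H] := @jet_close_jet2_closeness R n (g i) (chart i x) e0
    (metr_sym g (pd _ _ ix)) (metr_posdef g (pd _ _ ix)) e001.
  by exists d.
have hF : \forall y \near x, forall i, i \in F -> (dom i x -> dom i y /\
     jet_close (jet2 (g i) (chart i x)) (d i) (jet2 (g i) (chart i y))) /\
     (~ dom i x -> pou i y = 0).
  elim: F {EF} => [|i F IH]; first by near=> y.
  have hi : \forall y \near x, (dom i x -> dom i y /\
     jet_close (jet2 (g i) (chart i x)) (d i) (jet2 (g i) (chart i y))) /\
     (~ dom i x -> pou i y = 0).
    have [ix|ix] := pselect (dom i x).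
      have [d0 _] := dP i.
      by have := jet_close_near g ix d0; apply: filterS => y H; split.
    (* The closed support of [pou i] lies in the chart domain; if [x] is outside that domain, a
       whole neighborhood of [x] misses the support. *)
    have : nbhs x (~` closure [set z | pou i z != 0]).
      apply: open_nbhs_nbhs; split; last by move=> /schi.
      by apply: closed_openC; exact: closed_closure.
    apply: filterS => y ny; split => // _; apply: contrapT => /eqP cy.
    by apply: ny; exact: subset_closure.
  apply: filterS2 hi IH => y Hi IH j; rewrite inE => /predU1P[->//|]; exact: IH.
have he : \forall y \near x, e0 <= e m y.
  have : nbhs (e m x) [set t | e0 < t].
    apply: open_nbhs_nbhs; split; first exact: open_gt.
    by rewrite /= /e0 ltr_pdivrMr// ltr_pMr// ltr1n.
  move=> h; have {}h : \forall y \near x, e0 < e m y := ce m x _ h.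
  by apply: filterS h => y /ltW.
pose A := [set y | (N y /\ e0 <= e m y) /\ forall i, i \in F -> (dom i x -> dom i y /\
     jet_close (jet2 (g i) (chart i x)) (d i) (jet2 (g i) (chart i y))) /\
     (~ dom i x -> pou i y = 0)].
have nA : nbhs x A by apply: filterI hF; exact: filterI.
(* Only the finitely many charts in [F] matter near [x]; those not containing [x] impose no
   condition, because their [pou i] vanishes near [x]. *)
pose W i := if `[< dom i x >] then jet_box (M := M) i (interior (jet_close (jet2 (g i) (chart i x)) (d i))) else setT.
exists ([set J | interior A (jet_base J)] `&` \bigcap_(i in [set` F]) W i); split.
- apply: openI; first exact/jet_base_open/open_interior.
  have oW i : open (W i).
    rewrite /W; case: ifP => _; last exact: openT.
    exact/jet_box_open/open_interior.
  elim: F {EF hF A nA} => [|i F IH].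
    by rewrite set_nil bigcap_set0; exact: openT.
  rewrite (_ : \bigcap_(_ in _) _ = W i `&` \bigcap_(i in [set` F]) W i).
    exact: openI.
  apply/seteqP; split => J HJ.
    split; first by apply: HJ; rewrite /= inE eqxx.
    by move=> j /= jF; apply: HJ; rewrite /= inE jF orbT.
  move: HJ => [Ji HJ] j /=; rewrite inE => /predU1P[->//|jF]; exact: HJ.
- split; first exact: nA.
  move=> i _; rewrite /W; case: asboolP => // ix.
  exists (jet2 (g i) (chart i x)).
    by rewrite /= /jet_coord asboolT.
  have [d0 _] := dP i.
  by apply: jet_close_jet2_nbhs d0; exact: (metr_unit g (pd _ _ ix)).
move=> h y [/= /interior_subset[[Ny ey] Fy] hy]; exists m; first exact: lt_le_trans ey.
move=> i piy.
have iF : i \in F.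
  have : [set i | N `&` [set y | pou i y != 0] !=set0] i by exists y.
  by rewrite EF.
have [Fy1 Fy2] := Fy i iF.
have [ix|/Fy2] := pselect (dom i x); last by move=> p0; rewrite p0 eqxx in piy.
have [iy gy] := Fy1 ix.
have iq := pd _ _ iy.
apply: (closenessW _ _ ey); [exact: metr_sym|exact: metr_posdef|].
have oc : open (cdom [set: M] i) by exact/cdom_open/openT.
have [_ /(_ ix) H] := dP i; apply: H; first exact: gy.
- have := hy i iF; rewrite /W asboolT; last exact: ix.
  case=> c; rewrite /= /jet_coord asboolT; last exact: iy.
  move=> [<-] /interior_subset; exact.
- exact: (metr_jet_scal g openT iq).
- exact: (metr_jet_scal h openT iq).
Unshelve. all: by end_near. Qed.

End FineNeighborhood.

(** * Comparison of Yamabe energies *)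

Section PointwiseArithmetic.
Variable R : realType.

(** The gain in [Gw] and the loss in [Hx >= (1 - eps / 2) * Gx] cancel. For the scalar term,
    [2 * eps * |sg|] pays for the factor [(1 - eps) ^+ 2] and [eps * rg] for the difference of the
    curvatures. *)
Lemma energy_to_g (a eps v Q Gx Gw Hx rg sg sh : R) :
  0 <= a -> 0 <= eps -> eps <= 2^-1 -> 0 <= Q -> 0 <= Gx ->
  Gw <= (1 - eps / 2) * Gx + 8 * v ^+ 2 * Q ->
  `|Hx - Gx| <= eps / 2 * Gx -> 0 <= rg -> `|sh - sg| <= eps * rg ->
  a * Gw + sg * ((1 - eps) * v) ^+ 2 <=
    a * Hx + sh * v ^+ 2 + (16 * a * Q + eps * (rg + 2 * `|sg|)) * v ^+ 2.
Proof.
move=> a0 e0 e2 Q0 G0 Gw_le; rewrite ler_distl => /andP[H1 _] r0.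
rewrite ler_distl => /andP[s1 _].
have v0 := sqr_ge0 v.
have h1 : a * Gw <= a * Hx + 16 * a * Q * v ^+ 2.
  have h : Gw <= Hx + 8 * v ^+ 2 * Q by lra.
  have := ler_wpM2l a0 h; have := mulr_ge0 (mulr_ge0 a0 Q0) v0; lra.
have h2 : sg * (1 - eps) ^+ 2 <= sh + eps * (rg + 2 * `|sg|).
  have h3 : sg * (1 - eps) ^+ 2 <= sg + 2 * eps * `|sg|.
    have [s0|s0] := leP 0 sg; [rewrite ger0_norm//|rewrite ltr0_norm//].
      by have := mulr_ge0 e0 s0; have := mulr_ge0 e0 (mulr_ge0 e0 s0); nra.
    have sn : 0 <= - sg by lra.
    have := mulr_ge0 (mulr_ge0 e0 e0) sn; lra.
  by lra.
have := ler_wpM2r v0 h2; rewrite exprMn; lra.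
Qed.

(** Here the metrics are exchanged after the cut-off: [(1 + eps / 2) * (1 - eps / 2) <= 1] removes
    the gradient, and the factor [1 + eps / 2] on [8 * v ^+ 2 * Q] is covered by the constant 16. *)
Lemma energy_to_h (a eps v Q Gx Gw Hw rg sg sh : R) :
  0 <= a -> 0 <= eps -> eps <= 2^-1 -> 0 <= Q -> 0 <= Gx -> 0 <= Gw ->
  Gw <= (1 - eps / 2) * Gx + 8 * v ^+ 2 * Q ->
  `|Hw - Gw| <= eps / 2 * Gw -> 0 <= rg -> `|sh - sg| <= eps * rg ->
  a * Hw + sh * ((1 - eps) * v) ^+ 2 <=
    a * Gx + sg * v ^+ 2 + (16 * a * Q + eps * (rg + 2 * `|sg|)) * v ^+ 2.
Proof.
move=> a0 e0 e2 Q0 G0 Gw0 Gw_le; rewrite ler_distl => /andP[_ H1] r0.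
rewrite ler_distl => /andP[_ s1].
have v0 := sqr_ge0 v; have vQ := mulr_ge0 v0 Q0.
have h1 : a * Hw <= a * Gx + 16 * a * Q * v ^+ 2.
  have h : Hw <= Gx + 16 * v ^+ 2 * Q.
    have e1 : 0 <= 1 + eps / 2 by lra.
    have := ler_wpM2l e1 Gw_le.
    have := mulr_ge0 (mulr_ge0 e0 e0) G0.
    have e3 : eps * (v ^+ 2 * Q) <= 2^-1 * (v ^+ 2 * Q) by exact: ler_wpM2r.
    lra.
  have := ler_wpM2l a0 h; lra.
have h2 : sh * (1 - eps) ^+ 2 <= sg + eps * (rg + 2 * `|sg|).
  have e1 : 0 <= (1 - eps) ^+ 2 by exact: sqr_ge0.
  have e11 : (1 - eps) ^+ 2 <= 1 by nra.
  have h4 : sg * (1 - eps) ^+ 2 <= sg + 2 * eps * `|sg|.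
    have [s0|s0] := leP 0 sg; [rewrite ger0_norm//|rewrite ltr0_norm//].
      by have := mulr_ge0 e0 s0; have := mulr_ge0 e0 (mulr_ge0 e0 s0); nra.
    have sn : 0 <= - sg by lra.
    have := mulr_ge0 (mulr_ge0 e0 e0) sn; lra.
  have h5 := ler_wpM2r e1 s1.
  have h6 : eps * rg * (1 - eps) ^+ 2 <= eps * rg by rewrite ler_piMr// mulr_ge0.
  lra.
have := ler_wpM2r v0 h2; rewrite exprMn; lra.
Qed.

End PointwiseArithmetic.

Section Energies.
Variables (R : realType) (n : nat) (M : manifold R n).
Hypothesis n3 : (3 <= n)%N.
Implicit Types (U K S : set M) (i j : chart_idx M) (v phi : M -> R).
Local Notation chi := (@pou R n M).
Local Notation pexp := (@p_ R n).
Local Notation acst := (@a_ R n).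

Let n2 : (0 : R) < n%:R - 2.
Proof. by rewrite subr_gt0 ltr_nat. Qed.

Lemma p_ge2 : 2 <= pexp.
Proof. by rewrite /p_ ler_pdivlMr//; move: (n%:R : R) => x; lra. Qed.

Lemma p_le6 : pexp <= 6.
Proof.
rewrite /p_ ler_pdivrMr//.
have : (3%:R : R) <= n%:R by rewrite ler_nat.
by move: (n%:R : R) => x; lra.
Qed.

Lemma a_ge0 : 0 <= acst.
Proof.
rewrite /a_ divr_ge0 ?(ltW n2)// mulr_ge0//.
by move: (n%:R : R) n2 => x; lra.
Qed.

Definition dcomp v i (q : 'rV[R]_n) (a : 'I_n) : R := partial a (v \o parm i) q.

Definition energy_density U (g : riem U) v i q : R :=
  acst * qf (gradq (g i q)) (dcomp v i q) (dcomp v i q) + scalv (g i) q * v (parm i q) ^+ 2.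

Definition Lp_density U (g : riem U) v i q : R := `|v (parm i q)| `^ pexp * vol (g i q).

Lemma integral_riemE U (g : riem U) f :
  integral_riem g f = pint U (fun i q => f i q * vol (g i q)).
Proof.
rewrite /integral_riem /pint; apply: eq_fsbigr => i _; congr integral_Rn.
by apply/funext => q; rewrite /pou_term !patchE; case: ifP => // _; rewrite mulrA.
Qed.

Lemma yamabe_energyE U (g : riem U) v :
  yamabe_energy g v = pint U (energy_density g v) / sqn pexp (pint U (Lp_density g v)).
Proof.
rewrite /yamabe_energy /Lp_norm !integral_riemE /sqn; congr (pint _ _ / _).
apply/funext => i; apply/funext => q.
have -> : norm_d2 g v i q = qf (invmx (g i q)) (dcomp v i q) (dcomp v i q) by [].
by rewrite /energy_density /gradq qf_scale /scalv; ring.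
Qed.

Section OnOpen.
Variables (U K : set M) (v : M -> R).
Hypothesis oU : open U.
Hypothesis cK : compact K.
Hypothesis KU : K `<=` U.
Hypothesis sv : smoothM U v.
Hypothesis v0 : forall x, U x -> ~ K x -> v x = 0.

Lemma dcomp_vanish i q a : cdom U i q -> ~ K (parm i q) -> dcomp v i q a = 0.
Proof.
move=> iq Kq; rewrite -(@partial_cst _ _ 0 q a); apply: partial_near.
have oUK : open (U `&` ~` K).
  by apply: openI => //; apply/closed_openC/(compact_closed (@manifold_hausdorff _ _ M)).
apply: (@open_eq_near _ _ (cdom (U `&` ~` K) i)); first exact: cdom_open.
  by move=> p; rewrite inE => /cdom_parm[_ [Up Kp] _]; exact: v0.
by have [ix Ux <-] := cdom_parm iq; apply: cdom_chart.
Qed.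

Lemma dcomp_smooth i a : smooth_on (cdom U i) (fun q => dcomp v i q a).
Proof. exact: smooth_partial. Qed.

Section WithMetric.
Variable g : riem U.

Lemma qf_gradq_continuous i q : cdom U i q ->
  {for q, continuous (fun p => qf (gradq (g i p)) (dcomp v i p) (dcomp v i p))}.
Proof.
move=> iq; apply: cont_sum => a; apply: cont_sum => b.
apply: cont_mul; last exact: (smooth_cont (@dcomp_smooth i b) iq).
apply: cont_mul; last exact: (smooth_cont (@dcomp_smooth i a) iq).
exact: gradq_continuous.
Qed.

Lemma qf_gradq_vanish i q : cdom U i q -> ~ K (parm i q) ->
  qf (gradq (g i q)) (dcomp v i q) (dcomp v i q) = 0.
Proof.
move=> iq Kq; rewrite /qf big1// => a _; rewrite big1// => b _.
by rewrite (dcomp_vanish a iq Kq) mulr0 mul0r.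
Qed.

Lemma chart_fun_continuous i q : cdom U i q -> {for q, continuous (fun p => v (parm i p))}.
Proof. by move=> iq; exact: (smooth_cont (@sv i) iq). Qed.

Lemma chart_sqr_continuous i q : cdom U i q -> {for q, continuous (fun p => v (parm i p) ^+ 2)}.
Proof.
move=> iq; have -> : (fun p => v (parm i p) ^+ 2) = (fun p => v (parm i p) * v (parm i p)).
  by apply/funext => p; rewrite expr2.
by apply: cont_mul; exact: chart_fun_continuous.
Qed.

Lemma energy_density_admissible : admissible U K (energy_density g v).
Proof.
move=> i q iq; split; last first.
  move=> Kq; rewrite /energy_density qf_gradq_vanish// v0 ?expr0n ?mulr0 ?addr0//.
  by have [] := cdom_parm iq.
apply: cont_add; apply: cont_mul.
- exact: cont_cst.
- exact: qf_gradq_continuous.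
- exact: scalv_continuous.
- exact: chart_sqr_continuous.
Qed.

Lemma Lp_density_admissible : (forall x, U x -> 0 <= v x) -> admissible U K (Lp_density g v).
Proof.
move=> vge0 i q iq; have [_ Uq _] := cdom_parm iq; split; last first.
  move=> Kq; rewrite /Lp_density v0// normr0 powR0 ?mul0r// gt_eqF//.
  by have := p_ge2; lra.
apply: cont_mul; last exact: vol_continuous.
apply: (@continuous_comp _ _ _ (fun p => v (parm i p)) (fun x : R => `|x| `^ pexp)).
  exact: chart_fun_continuous.
by apply: powR_continuous; [have := p_ge2; lra|exact: vge0].
Qed.

End WithMetric.
End OnOpen.

Section Weight.
Variables (g : Metr M) (phi : M -> R) (S : set M).
Hypothesis sphi : smoothM setT phi.
Hypothesis cS : compact S.
Hypothesis phi0 : forall x, ~ S x -> phi x = 0.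

(* Error of the energy density per unit of [c m * v ^+ 2] in [energy_to_g] and
   [energy_to_h]. *)
Definition weight i q : R :=
  16 * acst * qf (gradq (g i q)) (dcomp phi i q) (dcomp phi i q) +
  phi (parm i q) ^+ 2 * (vol (g i q) + 2 * `|scalv (g i) q|).

Lemma weight_admissible : admissible setT S weight.
Proof.
have oT : open [set: M] by exact: openT.
have ph0 x : [set: M] x -> ~ S x -> phi x = 0 by move=> _; exact: phi0.
move=> i q iq; split; last first.
  move=> Sq; rewrite /weight (qf_gradq_vanish oT cS ph0 g iq Sq) phi0//.
  by rewrite expr0n mul0r mulr0 addr0.
apply: cont_add; apply: cont_mul.
- exact: cont_cst.
- exact: qf_gradq_continuous.
- exact: chart_sqr_continuous iq.
- apply: cont_add; first exact: vol_continuous.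
  apply: cont_mul; first exact: cont_cst.
  apply: (@continuous_comp _ _ _ (scalv (g i)) (fun x : R => `|x|)).
    exact: scalv_continuous.
  exact: norm_continuous.
Qed.

Lemma weight_ge0 i q : cdom [set: M] i q -> 0 <= weight i q.
Proof.
move=> iq; have sy := metr_sym g iq; have pd := metr_posdef g iq.
apply: addr_ge0.
  by rewrite mulr_ge0 ?gradq_ge0// mulr_ge0// a_ge0.
by rewrite mulr_ge0 ?sqr_ge0// addr_ge0 ?mulr_ge0// sqrtr_ge0.
Qed.

Hypothesis Hpou : partition_of_unity chi.

(** By homogeneity: [weighted_bound] is applied to [t * v], with [t] chosen to make the L^p norm 1,
    and the resulting bound [B + B] is scaled back by t^-2, which is [sqn pexp I]. *)
Lemma weight_bound : exists2 B, 0 <= B & forall U K v,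
  open U -> compact K -> K `<=` U -> smoothM U v ->
  (forall x, U x -> ~ K x -> v x = 0) -> (forall x, U x -> 0 <= v x) ->
  let I := pint U (Lp_density (riem_restrict (@subsetT _ U) g) v) in
  0 < I -> pint U (fun i q => weight i q * v (parm i q) ^+ 2) <= B * sqn pexp I.
Proof.
have volP i q : cdom [set: M] i q ->
    {for q, continuous (fun p => vol (g i p))} /\ 0 < vol (g i q).
  move=> iq; split; first by apply: vol_continuous => //; exact: openT.
  exact/vol_gt0/(metr_posdef g iq).
have [B B0 HB] := weighted_bound Hpou cS weight_admissible volP weight_ge0.
exists (2 * B); first by rewrite mulr_ge0.
move=> U K v oU cK KU sv v0 vge0 I I0.
have p2 := p_ge2.
have pn0 : pexp != 0 by rewrite gt_eqF//; lra.
pose t := (I `^ pexp^-1)^-1.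
have r0 : 0 < I `^ pexp^-1 by rewrite powR_gt0.
have t0 : 0 < t by rewrite invr_gt0.
have tp : t `^ pexp * I = 1.
  have E : (I `^ pexp^-1) `^ pexp = I by rewrite -powRrM mulVf// powRr1// ltW.
  by rewrite -[X in _ * X]E -powRM ?(ltW t0) ?(ltW r0)// mulVf ?gt_eqF// powR1.
pose f i q := (t * v (parm i q)) ^+ 2.
pose h i q := `|t * v (parm i q)| `^ pexp.
have wv : admissible U K (fun i q => weight i q * v (parm i q) ^+ 2).
  move=> i q iq; have iT : cdom [set: M] i q by apply: sub_cdom iq.
  have [cw _] := weight_admissible iT; have [_ Uq _] := cdom_parm iq; split.
    by apply: cont_mul => //; exact: chart_sqr_continuous iq.
  by move=> Kq; rewrite v0// expr0n mulr0.
have fE : (fun i q => weight i q * f i q) =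
    (fun i q => t ^+ 2 * (weight i q * v (parm i q) ^+ 2)).
  by apply/funext => i; apply/funext => q; rewrite /f exprMn mulrCA.
have hE : (fun i q => h i q * vol (g i q)) =
    (fun i q => t `^ pexp * Lp_density (riem_restrict (@subsetT _ U) g) v i q).
  apply/funext => i; apply/funext => q; rewrite /h /Lp_density /= normrM powRM//.
  by rewrite gtr0_norm// mulrA.
have la := Lp_density_admissible oU sv v0 (riem_restrict (@subsetT _ U) g) vge0.
have := HB U K f h oU cK KU.
rewrite fE hE !(pintZ Hpou _ oU cK KU)// tp => H.
have {}H : t ^+ 2 * pint U (fun i q => weight i q * v (parm i q) ^+ 2) <= B + B * 1.
  apply: H.
  - exact: admissibleZ.
  - exact: admissibleZ.
  - move=> i q iq; have [_ Uq _] := cdom_parm iq; split; first exact: powR_ge0.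
    rewrite /f /h ger0_norm ?mulr_ge0 ?(ltW t0) ?vge0//.
    by apply: sqr_le1DpowR => //; rewrite mulr_ge0 ?(ltW t0) ?vge0.
have t20 : 0 < t ^+ 2 by rewrite exprn_gt0.
rewrite -ler_pdivlMl// in H.
apply: le_trans H _; rewrite /sqn /t exprVn invrK mulr1 mulrC.
by rewrite [leLHS](_ : _ = 2 * B * I `^ pexp^-1 ^+ 2)//; ring.
Qed.

End Weight.
End Energies.

(** * The energy of a cut-off test function *)

Section Comparison.
Variables (R : realType) (n : nat) (M : manifold R n).
Hypothesis n3 : (3 <= n)%N.
Implicit Types (i : chart_idx M) (q : 'rV[R]_n).
Local Notation chi := (@pou R n M).
Local Notation pexp := (@p_ R n).
Local Notation acst := (@a_ R n).
Local Notation half := (2^-1 : R).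
Hypothesis Hpou : partition_of_unity chi.
Variables (g h : Metr M) (phi : nat -> M -> R) (S : nat -> set M) (c B : nat -> R).
Hypothesis sphi : forall m, smoothM setT (phi m).
Hypothesis cS : forall m, compact (S m).
Hypothesis phi0 : forall m x, ~ S m x -> phi m x = 0.
Hypothesis c0 : forall m, 0 <= c m.
Hypothesis cphi : forall m y, c m * phi m y ^+ 2 <= half ^+ m.+1.
Hypothesis cB : forall m, c m * B m <= half ^+ m.+1.

Definition weight_bounded m := forall U K v,
  open U -> compact K -> K `<=` U -> smoothM U v ->
  (forall x, U x -> ~ K x -> v x = 0) -> (forall x, U x -> 0 <= v x) ->
  let I := pint U (Lp_density (riem_restrict (@subsetT _ U) g) v) in
  0 < I -> pint U (fun i q => weight g (phi m) i q * v (parm i q) ^+ 2) <= B m * sqn pexp I.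
Hypothesis hB : forall m, weight_bounded m.
Hypothesis clo : forall y, exists2 m, 0 < c m * phi m y ^+ 2 &
  forall i, chi i y != 0 -> closeness (c m * phi m y ^+ 2) (g i) (h i) (chart i y).

Variables (U : set M) (mk : nat).
Hypothesis oU : open U.
Hypothesis mk1 : (0 < mk)%N.
Hypothesis Umk : forall m y, (m < mk)%N -> U y -> phi m y = 0.

Variables (K : set M) (N : nat) (v : M -> R).
Hypothesis cK : compact K.
Hypothesis KU : K `<=` U.
Hypothesis KN : forall m y, (N <= m)%N -> K y -> phi m y = 0.
Hypothesis sv : smoothM U v.
Hypothesis v0 : forall x, U x -> ~ K x -> v x = 0.
Hypothesis vge0 : forall x, U x -> 0 <= v x.

Local Notation r := (index_iota mk N).
Local Notation delta := (half ^+ mk).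
Local Notation rest f := (riem_restrict (@subsetT _ U) f).

(** The function eps truncated to finitely many indices: those below [mk] vanish on [U], those from
    [N] on vanish on [K]. The truncation is a finite sum, smooth on all of [M], and loses nothing on
    the support of [v]. *)
Definition damping y := \sum_(m <- r) c m * phi m y ^+ 2.
Definition cutoff y := (1 - damping y) * v y.

Lemma geometric_sum : \sum_(m <- r) half ^+ m.+1 <= delta.
Proof.
have [Nm|mN] := leqP N mk.
  by rewrite /index_iota (eqP (_ : (N - mk)%N == 0%N)) ?subn_eq0//= big_nil exprn_ge0.
rewrite -(subnKC (ltnW mN)); move: (N - mk)%N => k.
have -> : \sum_(mk <= m < mk + k) half ^+ m.+1 = delta - half ^+ (mk + k).
  elim: k => [|k IH]; first by rewrite addn0 big_geq// subrr.
  rewrite addnS big_nat_recr ?leq_addr//= IH.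
  by rewrite exprS; field.
by rewrite lerBlDr lerDl exprn_ge0.
Qed.

Lemma delta_half : 0 < delta <= half.
Proof.
rewrite exprn_gt0//=; case: mk mk1 => // k _.
by rewrite exprS ler_piMr// exprn_ile1//; lra.
Qed.

Lemma damping_ge0 y : 0 <= damping y.
Proof. by apply: sumr_ge0 => m _; rewrite mulr_ge0// sqr_ge0. Qed.

Lemma damping_le y : damping y <= delta.
Proof. by apply: le_trans geometric_sum; apply: ler_sum => m _; exact: cphi. Qed.

Lemma phi_damping m y : (mk <= m < N)%N -> c m * phi m y ^+ 2 <= damping y.
Proof.
move=> mr; rewrite /damping (big_rem m) ?mem_index_iota//= lerDl.
by apply: sumr_ge0 => k _; rewrite mulr_ge0// sqr_ge0.
Qed.

(** Closeness is known for one index [m] depending on the point. Since [phi m] is nonzero there, [m]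
    lies in the truncated range, and [damping] dominates its term. *)
Lemma closeness_damping i q : cdom U i q -> K (parm i q) -> chi i (parm i q) != 0 ->
  closeness (damping (parm i q)) (g i) (h i) q.
Proof.
move=> iq Kq cq; have [ix Uq xq] := cdom_parm iq.
have iT : cdom [set: M] i q by apply: sub_cdom iq.
have [m m0 Hm] := clo (parm i q).
have pm : phi m (parm i q) != 0.
  by apply: contraTneq m0 => ->; rewrite expr0n mulr0 ltxx.
have mr : (mk <= m < N)%N.
  apply/andP; split; rewrite leqNgt; apply: contra pm => mm.
    by rewrite Umk.
  by rewrite KN.
have := Hm i cq; rewrite xq; apply: closenessW.
- exact: (metr_sym g iT).
- exact: (metr_posdef g iT).
- exact: phi_damping.
Qed.

Lemma smooth_damping : smoothM setT damping.
Proof.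
move=> i; have oc : open (cdom [set: M] i) by exact/cdom_open/openT.
apply: smooth_sum => // m _; apply: smooth_mul => //; first exact: smooth_cst.
apply: (smooth_eq oc _ (smooth_mul oc (@sphi m i) (@sphi m i))) => p _ /=.
by rewrite expr2.
Qed.

Lemma smooth_cutoff : smoothM U cutoff.
Proof.
move=> i; have oc : open (cdom U i) by exact: cdom_open.
have se : smooth_on (cdom U i) (damping \o parm i).
  exact: (smoothM_sub (@subsetT _ U) smooth_damping).
by apply: (smooth_eq oc _ (smooth_mul oc (smooth_sub oc (smooth_cst 1) se) (@sv i))) => p _.
Qed.

Lemma cutoff_vanish x : U x -> ~ K x -> cutoff x = 0.
Proof. by move=> Ux Kx; rewrite /cutoff v0// mulr0. Qed.

Lemma cutoff_factor y : half <= 1 - damping y <= 1.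
Proof. by have := damping_ge0 y; have := damping_le y; have /andP[_] := delta_half; lra. Qed.

Lemma cutoff_ge0 x : U x -> 0 <= cutoff x.
Proof.
move=> Ux; rewrite mulr_ge0 ?vge0//; have /andP[+ _] := cutoff_factor x.
by apply: le_trans; lra.
Qed.

Lemma dcomp_cutoff i q a : cdom U i q -> dcomp cutoff i q a =
  (1 - damping (parm i q)) * dcomp v i q a +
  (- v (parm i q)) * \sum_(m <- r) (2 * c m * phi m (parm i q)) * dcomp (phi m) i q a.
Proof.
move=> iq; have oc : open (cdom U i) by exact: cdom_open.
have sp m : smooth_on (cdom U i) (phi m \o parm i).
  exact: (smoothM_sub (@subsetT _ U) (@sphi m)).
have se : smooth_on (cdom U i) (damping \o parm i).
  exact: (smoothM_sub (@subsetT _ U) smooth_damping).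
have s1 : smooth_on (cdom U i) (fun p => 1 - damping (parm i p)).
  exact: (smooth_sub oc (smooth_cst 1) se).
have spp m : smooth_on (cdom U i) (fun p => phi m (parm i p) * phi m (parm i p)).
  exact: (smooth_mul oc (sp m) (sp m)).
rewrite /dcomp.
have -> : cutoff \o parm i = (fun p => (1 - damping (parm i p)) * (v \o parm i) p) by [].
rewrite (partialM a s1 (@sv i) iq) addrC [X in _ + X]mulrC; congr (_ + _).
rewrite mulNr -mulrN; congr (_ * _).
rewrite (partialB a (smooth_cst 1) se iq) partial_cst sub0r; congr (- _).
have -> : damping \o parm i = (fun p => \sum_(m <- r) (fun p => c m * (phi m (parm i p) * phi m (parm i p))) p).
  by apply/funext => p; apply: eq_bigr => m _; rewrite expr2.
rewrite (partial_sum oc _ _ _ iq); last by move=> m; exact: (smooth_mul oc (smooth_cst (c m)) (spp m)).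
apply: eq_bigr => m _; rewrite (partialZ _ _ (spp m) iq) (partialM a (sp m) (sp m) iq).
by rewrite /=; ring.
Qed.

Lemma weight_sum i q : \sum_(m <- r) c m * weight g (phi m) i q =
  16 * acst * (\sum_(m <- r) c m * qf (gradq (g i q)) (dcomp (phi m) i q) (dcomp (phi m) i q))
  + damping (parm i q) * (vol (g i q) + 2 * `|scalv (g i) q|).
Proof.
rewrite /damping mulr_sumr mulr_suml -big_split; apply: eq_bigr => m _ /=.
by rewrite /weight; ring.
Qed.

Lemma cutoff_grad i q : cdom U i q ->
  qf (gradq (g i q)) (dcomp cutoff i q) (dcomp cutoff i q) <=
  (1 - damping (parm i q) / 2) * qf (gradq (g i q)) (dcomp v i q) (dcomp v i q)
  + 8 * v (parm i q) ^+ 2 *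
    \sum_(m <- r) c m * qf (gradq (g i q)) (dcomp (phi m) i q) (dcomp (phi m) i q).
Proof.
move=> iq; have iT : cdom [set: M] i q by apply: sub_cdom iq.
have sy := gradq_sym (metr_sym g iT).
have ge0 x : 0 <= qf (gradq (g i q)) x x.
  by apply: gradq_ge0; [exact: (metr_sym g iT)|exact: (metr_posdef g iT)].
have -> : dcomp cutoff i q = (fun a => (1 - damping (parm i q)) * dcomp v i q a +
  (- v (parm i q)) * \sum_(m <- r) (2 * c m * phi m (parm i q)) * dcomp (phi m) i q a).
  by apply/funext => a; exact: dcomp_cutoff.
apply: (qf_cutoff sy ge0 _ _ _ c0).
by apply: le_trans (damping_le _) _; have /andP[] := delta_half.
Qed.

Lemma energy_density_cutoff i q : cdom U i q -> K (parm i q) -> chi i (parm i q) != 0 ->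
  energy_density (rest g) cutoff i q <= energy_density (rest h) v i q +
     (\sum_(m <- r) c m * weight g (phi m) i q) * v (parm i q) ^+ 2 /\
  energy_density (rest h) cutoff i q <= energy_density (rest g) v i q +
     (\sum_(m <- r) c m * weight g (phi m) i q) * v (parm i q) ^+ 2.
Proof.
move=> iq Kq cq; have [_ cs cg] := closeness_damping iq Kq cq.
have iT : cdom [set: M] i q by apply: sub_cdom iq.
have ge0 x : 0 <= qf (gradq (g i q)) x x.
  by apply: gradq_ge0; [exact: (metr_sym g iT)|exact: (metr_posdef g iT)].
have Q0 : 0 <= \sum_(m <- r) c m * qf (gradq (g i q)) (dcomp (phi m) i q) (dcomp (phi m) i q).
  by apply: sumr_ge0 => m _; rewrite mulr_ge0.
have e2 : damping (parm i q) <= half.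
  by apply: le_trans (damping_le _) _; have /andP[] := delta_half.
have G := cutoff_grad iq.
have a0 : 0 <= acst by exact: a_ge0.
rewrite weight_sum; split.
  by apply: energy_to_g (damping_ge0 _) e2 Q0 (ge0 _) G (cg _) (sqrtr_ge0 _) cs.
by apply: energy_to_h (damping_ge0 _) e2 Q0 (ge0 _) (ge0 _) G (cg _) (sqrtr_ge0 _) cs.
Qed.

Lemma vol_cutoff i q : cdom U i q -> K (parm i q) -> chi i (parm i q) != 0 ->
  (1 - delta) * vol (g i q) <= vol (h i q) /\ (1 - delta) * vol (h i q) <= vol (g i q).
Proof.
move=> iq Kq cq; have [cv _ _] := closeness_damping iq Kq cq.
have vg : 0 <= vol (g i q) by exact: sqrtr_ge0.
have h1 : damping (parm i q) * vol (g i q) <= delta * vol (g i q) by rewrite ler_wpM2r// damping_le.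
have /andP[d0 d1] := delta_half.
move: cv; rewrite ler_distl => /andP[k1 k2]; split; first by lra.
have d2 : 0 <= 1 - delta by lra.
have k3 : vol (h i q) <= (1 + delta) * vol (g i q) by lra.
have := ler_wpM2l d2 k3; have := mulr_ge0 (mulr_ge0 (ltW d0) (ltW d0)) vg; lra.
Qed.

Section Direction.
Variables g1 g2 : Metr M.
Hypothesis g12 : (g1 = g /\ g2 = h) \/ (g1 = h /\ g2 = g).

(** [g1] measures [v] and [g2] its cut-off. Both directions are treated together by [g12], while the
    weights and the constants [B m] always belong to [g]. *)
Let I1 := pint U (Lp_density (rest g1) v).
Let I2 := pint U (Lp_density (rest g2) cutoff).

Let lp1 : admissible U K (Lp_density (rest g1) v). Proof. exact: (Lp_density_admissible n3 oU sv v0 _ vge0). Qed.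
Let lp2 : admissible U K (Lp_density (rest g2) cutoff).
Proof. exact: (Lp_density_admissible n3 oU smooth_cutoff cutoff_vanish _ cutoff_ge0). Qed.

Let vol12 i q : cdom U i q -> K (parm i q) -> chi i (parm i q) != 0 ->
  (1 - delta) * vol (g1 i q) <= vol (g2 i q) /\ (1 - delta) * vol (g2 i q) <= vol (g1 i q).
Proof.
by move=> iq Kq cq; have [? ?] := vol_cutoff iq Kq cq; case: g12 => [[-> ->]|[-> ->]].
Qed.

Lemma Lp1_ge0 : 0 <= I1.
Proof.
apply: (pint_ge0 Hpou oU cK KU lp1) => i q _ _.
by rewrite mulr_ge0 ?powR_ge0// sqrtr_ge0.
Qed.

Lemma Lp2_le : (1 - delta) * I2 <= I1.
Proof.
rewrite -(pintZ Hpou _ oU cK KU lp2).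
apply: (le_pint Hpou oU cK KU (admissibleZ _ lp2) lp1) => i q iq Kq cq.
have [_ V] := vol12 iq Kq cq; have [_ Uq _] := cdom_parm iq.
have p2 := p_ge2 R n3.
have /andP[d0 d1] := delta_half.
rewrite /Lp_density mulrCA; apply: ler_pM; [exact: powR_ge0| | |exact: V].
  by apply: mulr_ge0; [lra|exact: sqrtr_ge0].
apply: ge0_ler_powR; rewrite ?nnegrE ?normr_ge0//; first lra.
have /andP[f0 f1] := cutoff_factor (parm i q).
rewrite /cutoff normrM ger0_norm; last by lra.
by rewrite ler_piMl.
Qed.

(** The exponent is 6 + 1: the cut-off factor to the power [pexp] is at least [(1 - delta) ^+ 6]
    because [pexp <= 6], and the densities contribute one more factor. *)
Lemma Lp2_ge : (1 - delta) ^+ 7 * I1 <= I2.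
Proof.
rewrite -(pintZ Hpou _ oU cK KU lp1).
apply: (le_pint Hpou oU cK KU (admissibleZ _ lp1) lp2) => i q iq Kq cq.
have [V _] := vol12 iq Kq cq; have [_ Uq _] := cdom_parm iq.
have p2 := p_ge2 R n3; have p6 := p_le6 R n3.
have /andP[d0 d1] := delta_half.
have /andP[f0 f1] := cutoff_factor (parm i q).
rewrite /Lp_density.
have -> (x y : R) : (1 - delta) ^+ 7 * (x * y) = ((1 - delta) ^+ 6 * x) * ((1 - delta) * y) by ring.
apply: ler_pM; [| | |exact: V].
- by apply: mulr_ge0; [apply: exprn_ge0; lra|exact: powR_ge0].
- by apply: mulr_ge0; [lra|exact: sqrtr_ge0].
rewrite /cutoff normrM powRM//; apply: ler_wpM2r; first exact: powR_ge0.
rewrite ger0_norm; last by lra.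
apply: (@le_trans _ _ ((1 - damping (parm i q)) ^+ 6)).
  by apply: lerXn2r; rewrite ?nnegrE; [lra|lra|have := damping_le (parm i q); lra].
by apply: powR_ge_expn => //; apply/andP; split; lra.
Qed.

(** Index [m] contributes at most [c m * B m], hence at most 2^-(m+1), times the squared norm of
    [v]; from [mk] on these sum to at most [delta]. *)
Lemma energy_cutoff : 0 < I1 ->
  pint U (energy_density (rest g2) cutoff) <= pint U (energy_density (rest g1) v) + 4 * delta * sqn pexp I1.
Proof.
move=> I10; have p2 := p_ge2 R n3; have /andP[d0 d1] := delta_half.
(* [weight_bounded] is stated for the norm of [g], the conclusion for that of [g1]; the densities
   differ at most by a factor 2, so the squared norms do as well. *)
pose Ig := pint U (Lp_density (rest g) v).
have Ig_le : Ig <= 2 * I1 /\ 0 < Ig.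
  have lpg : admissible U K (Lp_density (rest g) v) by exact: (Lp_density_admissible n3 oU sv v0 _ vge0).
  have key i q : cdom U i q -> K (parm i q) -> chi i (parm i q) != 0 ->
      half * vol (g i q) <= vol (g1 i q) /\ half * vol (g1 i q) <= vol (g i q).
    move=> iq Kq cq; have [k1 k2] := vol_cutoff iq Kq cq.
    have vg : 0 <= vol (g i q) by exact: sqrtr_ge0.
    have vh : 0 <= vol (h i q) by exact: sqrtr_ge0.
    have d2 : half <= 1 - delta by lra.
    have := ler_wpM2r vg d2; have := ler_wpM2r vh d2.
    by case: g12 => [[-> _]|[-> _]]; split; lra.
  have h1 : half * Ig <= I1.
    rewrite -(pintZ Hpou _ oU cK KU lpg).
    apply: (le_pint Hpou oU cK KU (admissibleZ _ lpg) lp1) => i q iq Kq cq.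
    have [k1 _] := key i q iq Kq cq.
    by rewrite /Lp_density mulrCA; apply: ler_wpM2l => //; exact: powR_ge0.
  have h2 : half * I1 <= Ig.
    rewrite -(pintZ Hpou _ oU cK KU lp1).
    apply: (le_pint Hpou oU cK KU (admissibleZ _ lp1) lpg) => i q iq Kq cq.
    have [_ k1] := key i q iq Kq cq.
    by rewrite /Lp_density mulrCA; apply: ler_wpM2l => //; exact: powR_ge0.
  by split; lra.
have [Ig2 Ig0] := Ig_le.
have sq : sqn pexp Ig <= 2 * sqn pexp I1.
  by apply: le_sqn => //; [lra|exact: Lp1_ge0|exact: ltW].
have wadm m : admissible U K (fun i q => c m * (weight g (phi m) i q * v (parm i q) ^+ 2)).
  apply: admissibleZ => i q iq; have iT : cdom [set: M] i q by apply: sub_cdom iq.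
  have [cw _] := weight_admissible g (@sphi m) (@cS m) (@phi0 m) iT.
  have [_ Uq _] := cdom_parm iq; split.
    by apply: cont_mul => //; exact: chart_sqr_continuous iq.
  by move=> Kq; rewrite v0// expr0n mulr0.
have [sadm sumE] := pint_sum Hpou r oU cK KU wadm.
have e1adm : admissible U K (energy_density (rest g1) v) by exact: (energy_density_admissible oU cK sv v0 _).
have e2adm : admissible U K (energy_density (rest g2) cutoff).
  exact: (energy_density_admissible oU cK smooth_cutoff cutoff_vanish _).
apply: (@le_trans _ _ (pint U (fun i q => energy_density (rest g1) v i q +
    \sum_(m <- r) c m * (weight g (phi m) i q * v (parm i q) ^+ 2)))).
  apply: (le_pint Hpou oU cK KU e2adm (admissibleD e1adm sadm)) => i q iq Kq cq.
  have [k1 k2] := energy_density_cutoff iq Kq cq.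
  have -> : \sum_(m <- r) c m * (weight g (phi m) i q * v (parm i q) ^+ 2) =
      (\sum_(m <- r) c m * weight g (phi m) i q) * v (parm i q) ^+ 2.
    by rewrite mulr_suml; apply: eq_bigr => m _; rewrite mulrA.
  by case: g12 => [[-> ->]|[-> ->]].
rewrite (pintD Hpou oU cK KU e1adm sadm) lerD2l sumE.
apply: (@le_trans _ _ (\sum_(m <- r) half ^+ m.+1 * sqn pexp Ig)).
  apply: ler_sum => m _.
  have w1adm : admissible U K (fun i q => weight g (phi m) i q * v (parm i q) ^+ 2).
    move=> i q iq; have iT : cdom [set: M] i q by apply: sub_cdom iq.
    have [cw _] := weight_admissible g (@sphi m) (@cS m) (@phi0 m) iT.
    have [_ Uq _] := cdom_parm iq; split.
      by apply: cont_mul => //; exact: chart_sqr_continuous iq.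
    by move=> Kq; rewrite v0// expr0n mulr0.
  rewrite (pintZ Hpou _ oU cK KU w1adm).
  have := hB m oU cK KU sv v0 vge0 Ig0; move/(ler_wpM2l (c0 m)) => H.
  apply: le_trans H _; rewrite mulrA; apply: ler_wpM2r; first exact: sqn_ge0.
  exact: cB.
rewrite -mulr_suml.
have k1 := ler_wpM2r (sqn_ge0 pexp Ig) geometric_sum.
apply: le_trans k1 _.
apply: le_trans (ler_wpM2l (ltW d0) sq) _.
by rewrite mulrCA mulrA; apply: ler_wpM2r; [exact: sqn_ge0|apply: ler_wpM2r; [exact: ltW|rewrite ler_nat]].
Qed.

End Direction.
End Comparison.

(** * From integrals to energy quotients *)

Section EnergyRatio.
Variable R : realType.
Implicit Types (d e p x y : R).

Lemma bernoulli_le d k : 0 <= d <= 1 -> 1 - k%:R * d <= (1 - d) ^+ k.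
Proof.
move=> /andP[d0 d1]; elim: k => [|k IH]; first by rewrite expr0 mul0r subr0.
have d2 : 0 <= 1 - d by lra.
rewrite exprS; apply: le_trans (ler_wpM2l d2 IH).
have k0 : 0 <= k%:R * d ^+ 2 :> R by rewrite mulr_ge0 ?sqr_ge0.
by rewrite -natr1; move: (k%:R : R) k0 => x; lra.
Qed.

(** The numerator costs [4 * d] and the denominator at most [7 * d * |e'|]. The condition on [d]
    involves only the levels [e] and [e'], so one [d] works for every test function. *)
Lemma ratio_lt (d e e' p N1 N2 I1 I2 : R) : 2 <= p -> 0 < d <= 2^-1 ->
  0 <= I1 -> (1 - d) * I2 <= I1 -> (1 - d) ^+ 7 * I1 <= I2 ->
  (0 < I1 -> N2 <= N1 + 4 * d * sqn p I1) ->
  d * (4 + 7 * `|e'|) <= e' - e ->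
  N1 / sqn p I1 < e -> N2 / sqn p I2 < e'.
Proof.
move=> p2 /andP[d0 d1] I10 h1 h2 h3 de.
have e0 : 0 <= `|e'| by [].
have ee : e < e'.
  have : 0 < d * (4 + 7 * `|e'|) by rewrite mulr_gt0//; lra.
  by lra.
have d2 : 0 < 1 - d by lra.
have [I1p|] := ltP 0 I1; last first.
  (* Both quotients are of the form x / 0 = 0. *)
  move=> I1n; have E1 : I1 = 0 by apply/eqP; rewrite eq_le I1n.
  have E2 : I2 = 0.
    apply/eqP; rewrite eq_le; move: h2; rewrite E1 mulr0 => ->; rewrite andbT.
    by move: h1; rewrite E1 pmulr_rle0.
  have s0 : sqn p 0 = 0.
    by rewrite /sqn powR0 ?expr0n// invr_eq0 gt_eqF//; lra.
  by rewrite E1 E2 s0 invr0 !mulr0 => /lt_trans; apply.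
have I2p : 0 < I2 by apply: lt_le_trans h2; rewrite mulr_gt0// exprn_gt0.
have D1p := sqn_gt0 p I1p; have D2p := sqn_gt0 p I2p.
rewrite !ltr_pdivrMr// => hN.
have {}h3 := h3 I1p.
have c7 : 1 - 7 * d <= (1 - d) ^+ 7 by apply: bernoulli_le; lra.
have q1 : (1 - d) * sqn p I2 <= sqn p I1.
  rewrite -ler_pdivlMl//; apply: le_sqn => //.
  - by rewrite invf_ge1//; lra.
  - exact: ltW.
  - by rewrite ler_pdivlMl.
have q2 : (1 - d) ^+ 7 * sqn p I1 <= sqn p I2.
  have d7 : 0 < (1 - d) ^+ 7 by rewrite exprn_gt0.
  rewrite -ler_pdivlMl//; apply: le_sqn => //.
  - by rewrite invf_ge1// exprn_ile1//; lra.
  - exact: ltW.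
  - by rewrite ler_pdivlMl.
move: (sqn p I1) (sqn p I2) D1p D2p hN h3 q1 q2 => D1 D2 D1p D2p hN h3 q1 q2.
have q3 : (1 - 7 * d) * D1 <= D2 by apply: le_trans q2; rewrite ler_pM2r.
have q4 : D2 <= (1 + 2 * d) * D1.
  have k1 : 0 <= d * (1 - 2 * d) * D2 by rewrite mulr_ge0 ?(ltW D2p)// mulr_ge0 ?(ltW d0)//; lra.
  have k2 : 0 <= 1 + 2 * d by lra.
  by have := ler_wpM2l k2 q1; lra.
(* The energy may be negative: the lower bound [q3] on [D2] is the relevant one for [e' >= 0], the
   upper bound [q4] for [e' < 0]. *)
have q5 : (e' - 7 * d * `|e'|) * D1 <= e' * D2.
  have [s|s] := leP 0 e'.
    by rewrite ger0_norm//; have := ler_wpM2l s q3; lra.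
  rewrite ltr0_norm//; have s' : 0 <= - e' by lra.
  have := ler_wpM2l s' q4; have := mulr_ge0 (mulr_ge0 (ltW d0) s') (ltW D1p); lra.
have q6 : (e + 4 * d) * D1 <= (e' - 7 * d * `|e'|) * D1.
  by rewrite ler_pM2r//; lra.
lra.
Qed.

End EnergyRatio.

(** * Transfer of limits in the extended reals *)

Section ErealTransfer.
Variable R : realType.
Implicit Types (u v : nat -> \bar R) (l : \bar R) (a e : R).

(** An asymptotic form of v <= u by real levels. It is meaningful at -oo, and the index from which
    it holds may depend on [e] and [e'], as the error terms require. *)
Definition transfers u v := forall e e' : R, e < e' ->
  \forall k \near \oo, (u k < e%:E -> v k < e'%:E)%E.

Lemma cvge_near_lt u l a : u k @[k --> \oo] --> l -> (l < a%:E)%E ->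
  \forall k \near \oo, (u k < a%:E)%E.
Proof.
move=> ul la; apply: (ul [set x | (x < a%:E)%E]).
by apply: open_nbhs_nbhs; split=> //; exact: open_ereal_lt_ereal.
Qed.

Lemma cvge_near_gt u l a : u k @[k --> \oo] --> l -> (a%:E < l)%E ->
  \forall k \near \oo, (a%:E < u k)%E.
Proof.
move=> ul la; apply: (ul [set x | (a%:E < x)%E]).
by apply: open_nbhs_nbhs; split=> //; exact: open_ereal_gt_ereal.
Qed.

Lemma cvge_bounds v l :
  (forall a, (l < a%:E)%E -> \forall k \near \oo, (v k < a%:E)%E) ->
  (forall a, (a%:E < l)%E -> \forall k \near \oo, (a%:E < v k)%E) ->
  v k @[k --> \oo] --> l.
Proof.
case: l => [r| |] U L.
- move=> A rA; have /nbhs_ballP[e /= e0 eA] : nbhs r (fun x : R => A x%:E) := rA.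
  have h1 : \forall k \near \oo, (v k < (r + e)%:E)%E by apply: U; rewrite lte_fin ltrDl.
  have h2 : \forall k \near \oo, ((r - e)%:E < v k)%E by apply: L; rewrite lte_fin ltrBlDr ltrDl.
  apply: filterS2 h1 h2 => k /=; case: (v k) => [x| |] //; rewrite !lte_fin => k1 k2.
  by apply: eA; rewrite -ball_normE /= ltr_distlC k2.
- move=> A [x [xr xA]].
  have h : \forall k \near \oo, (x%:E < v k)%E by apply: L; rewrite ltry.
  by apply: filterS h => k /xA.
- move=> A [x [xr xA]].
  have h : \forall k \near \oo, (v k < x%:E)%E by apply: U; rewrite ltNyr.
  by apply: filterS h => k /xA.
Qed.

Lemma transfers_cvg u v l : transfers u v -> transfers v u ->
  u k @[k --> \oo] --> l -> v k @[k --> \oo] --> l.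
Proof.
move=> uv vu ul; apply: cvge_bounds => a.
- move=> la; have [e le ea] : exists2 e : R, (l < e%:E)%E & e < a.
    case: l la {ul} => [r| |] //.
      rewrite lte_fin => ra; exists ((r + a) / 2); rewrite ?lte_fin; lra.
    by move=> _; exists (a - 1); rewrite ?ltNyr//; lra.
  have h1 := cvge_near_lt ul le.
  by apply: filterS2 h1 (uv _ _ ea) => k k1 k2; exact: k2.
- move=> al; have [e le ea] : exists2 e : R, (e%:E < l)%E & a < e.
    case: l al {ul} => [r| |] //.
      rewrite lte_fin => ra; exists ((r + a) / 2); rewrite ?lte_fin; lra.
    by move=> _; exists (a + 1); rewrite ?ltry//; lra.
  have h1 := cvge_near_gt ul le.
  have be : (a + e) / 2 < e by lra.
  apply: filterS2 h1 (vu _ _ be) => k k1 k2.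
  (* For the lower bound: if [v k <= a], then [vu] at the intermediate level would push [u k] below
     [e]. *)
  rewrite ltNge; apply/negP => va.
  have : (v k < ((a + e) / 2)%:E)%E by apply: le_lt_trans va _; rewrite lte_fin; lra.
  by move=> /k2 /(lt_trans k1); rewrite ltxx.
Qed.

End ErealTransfer.

(** * Yamabe constants on complements of compact sets and at infinity *)

Section YamabeTransfer.
Variables (R : realType) (n : nat) (M : manifold R n).
Hypothesis n3 : (3 <= n)%N.
Local Notation chi := (@pou R n M).
Local Notation pexp := (@p_ R n).
Local Notation half := (2^-1 : R).

Lemma half_small (x : R) : 0 < x -> exists2 m, (0 < m)%N & half ^+ m <= x.
Proof.
move=> x0; have [m _ Hm] := near_infty_natSinv_expn_lt (PosNum x0).
exists m.+1 => //; apply/ltW; have := Hm m.+1 (leqnSn m).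
by rewrite /= div1r exprVn.
Qed.

Section Fixed.
Hypothesis Hpou : partition_of_unity chi.
Variables (g h : Metr M) (phi : nat -> M -> R) (S : nat -> set M) (c B : nat -> R).
Variable K0 : nat -> set M.
Hypothesis exK0 : compact_exhaustion K0.
Hypothesis sphi : forall m, smoothM setT (phi m).
Hypothesis cS : forall m, compact (S m).
Hypothesis phi0 : forall m x, ~ S m x -> phi m x = 0.
Hypothesis phiK : forall k m y, (k.+2 <= m)%N -> K0 k y -> phi m y = 0.
Hypothesis c0 : forall m, 0 <= c m.
Hypothesis cphi : forall m y, c m * phi m y ^+ 2 <= half ^+ m.+1.
Hypothesis cB : forall m, c m * B m <= half ^+ m.+1.
Hypothesis hB : forall m, weight_bounded g phi B m.
Hypothesis clo : forall y, exists2 m, 0 < c m * phi m y ^+ 2 &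
  forall i, chi i y != 0 -> closeness (c m * phi m y ^+ 2) (g i) (h i) (chart i y).

(** A test function of energy below [e] for [g1] is replaced by its cut-off, again a test function
    on the same [U], whose energy for [g2] is below [e']. *)
Lemma yamabe_lt (g1 g2 : Metr M) (U : set M) (mk : nat) (e e' : R) :
  (g1 = g /\ g2 = h) \/ (g1 = h /\ g2 = g) -> open U -> (0 < mk)%N ->
  (forall m y, (m < mk)%N -> U y -> phi m y = 0) ->
  half ^+ mk * (4 + 7 * `|e'|) <= e' - e ->
  (yamabe (riem_restrict (@subsetT _ U) g1) < e%:E)%E ->
  (yamabe (riem_restrict (@subsetT _ U) g2) < e'%:E)%E.
Proof.
move=> g12 oU mk1 Umk de /ereal_inf_lt[_ [v tv <-]]; rewrite lte_fin yamabe_energyE => Ev.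
have [sv [K [cK KU v0]] vge0 [x Ux vx]] := tv.
have [k0 Kk0] := exhaustion_compact_sub exK0 cK.
(* The support [K] lies in [K0 k0], and [phi m] vanishes on [K0 k0] from index [k0.+2] on. *)
pose N := k0.+2.
have KN m y : (N <= m)%N -> K y -> phi m y = 0.
  move=> Nm Ky; apply: (phiK Nm); exact: (interior_subset (Kk0 _ (leqnn _) _ Ky)).
pose w := cutoff phi c mk N v.
apply: (@le_lt_trans _ _ (yamabe_energy (riem_restrict (@subsetT _ U) g2) w)%:E).
  apply: ereal_inf_lbound; exists w; last by reflexivity.
  split.
  - by move=> i; exact: (smooth_cutoff c sphi mk oU N sv).
  - by exists K; split; [exact: cK|exact: KU|exact: (cutoff_vanish phi c mk N v0)].
  - exact: (cutoff_ge0 c0 cphi mk1 N vge0).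
  - exists x => //; rewrite /w /cutoff mulf_neq0//.
    have /andP[f0 _] := cutoff_factor c0 cphi mk1 N x.
    (* The cut-off factor is at least one half, so [w] does not vanish where [v] does not. *)
    by rewrite gt_eqF//; apply: lt_le_trans f0; lra.
rewrite lte_fin yamabe_energyE.
apply: (ratio_lt (p_ge2 R n3) (delta_half R mk1) _ _ _ _ de Ev).
- exact: (Lp1_ge0 n3 Hpou oU cK KU sv v0 vge0).
- exact: (Lp2_le n3 Hpou sphi c0 cphi clo oU mk1 Umk cK KU KN sv v0 vge0 g12).
- exact: (Lp2_ge n3 Hpou sphi c0 cphi clo oU mk1 Umk cK KU KN sv v0 vge0 g12).
- exact: (energy_cutoff n3 Hpou sphi cS phi0 c0 cphi cB hB clo oU mk1 Umk cK KU KN sv v0 vge0 g12).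
Qed.

(** First [mk] is chosen from [e] and [e']. For large [k] the set [K k] contains the supports of all
    [phi m] with [m < mk], so these vanish on its complement. The exhaustion [K] is arbitrary and
    unrelated to [K0]. *)
Lemma yamabe_transfers (g1 g2 : Metr M) (K : nat -> set M) :
  (g1 = g /\ g2 = h) \/ (g1 = h /\ g2 = g) -> compact_exhaustion K ->
  transfers (fun k => yamabe (riem_restrict (@subsetT _ (~` K k)) g1))
            (fun k => yamabe (riem_restrict (@subsetT _ (~` K k)) g2)).
Proof.
move=> g12 exK e e' ee.
have a0 : 0 < 4 + 7 * `|e'| by have : 0 <= `|e'| by []; lra.
have x0 : 0 < (e' - e) / (4 + 7 * `|e'|) by rewrite divr_gt0//; lra.
have [mk mk1] := half_small x0; rewrite ler_pdivlMr// => Hmk.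
have /choice[k0 Hk0] : forall m, exists k0, forall k, (k0 <= k)%N -> S m `<=` interior (K k).
  by move=> m; exact: (exhaustion_compact_sub exK (@cS m)).
exists (\max_(m < mk) k0 m)%N => // k /= kk.
have [cK _ _] := exK.
apply: (yamabe_lt g12 _ mk1) => //.
  exact/closed_openC/(compact_closed (@manifold_hausdorff _ _ M)).
move=> m y mm Ky; apply: phi0 => Sy; apply: Ky.
have mk0 : (k0 m <= k)%N.
  by apply: leq_trans kk; exact: (leq_bigmax (F := fun j : 'I_mk => k0 j) (Ordinal mm)).
exact: (interior_subset (Hk0 m k mk0 y Sy)).
Qed.

Lemma yamabe_infty_eq : yamabe_infty h = yamabe_infty g.
Proof.
rewrite /yamabe_infty; apply: (congr1 (xget -oo%E)); apply/seteqP; split => l Hl K exK.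
  apply: (@transfers_cvg _ (fun k => yamabe (riem_restrict (@subsetT _ (~` K k)) h))).
  - by apply: yamabe_transfers exK; right.
  - by apply: yamabe_transfers exK; left.
  - exact: Hl.
apply: (@transfers_cvg _ (fun k => yamabe (riem_restrict (@subsetT _ (~` K k)) g))).
- by apply: yamabe_transfers exK; left.
- by apply: yamabe_transfers exK; right.
- exact: Hl.
Qed.

End Fixed.

(* [pou] is the default value 0 of [xget] if there is no partition of unity; all
   integrals are 0 in that case. *)
Lemma pou_dichotomy : partition_of_unity chi \/ chi = (fun _ _ => 0).
Proof.
have [[c Hc]|nc] := pselect (exists c, @partition_of_unity R n M c).
  by left; apply: (@xgetPex _ _ [set c | partition_of_unity c]); exists c.
by right; rewrite /pou xgetPN// => c Hc; apply: nc; exists c.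
Qed.

(** Every energy is 0 for every metric, so on each open set both constants are the infimum of the
    same set, {0} or empty. *)
Lemma yamabe_pou0 (g h : Metr M) : chi = (fun _ _ => 0) ->
  yamabe_infty h = yamabe_infty g.
Proof.
move=> E.
have I0 (U : set M) (k : riem U) f : integral_riem k f = 0.
  rewrite integral_riemE /pint fsbig1// => i _.
  have -> : pou_term U (fun i q => f i q * vol (k i q)) i = fun=> 0.
    by apply/funext => q; rewrite pou_termE E mul0r; case: asboolP.
  exact: integral_Rn0.
have Y0 (U : set M) (k : riem U) : yamabe k = ereal_inf [set (0 : R)%:E | _ in test_fun U].
  rewrite /yamabe; apply: (congr1 (@ereal_inf R)); apply/seteqP; split => z /= [v tv <-].
    by exists v; [exact: tv|rewrite /yamabe_energy I0 mul0r].
  by exists v; [exact: tv|rewrite /yamabe_energy I0 mul0r].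
have YE (K : nat -> set M) :
    (fun k => yamabe (riem_restrict (@subsetT _ (~` K k)) h)) =
    (fun k => yamabe (riem_restrict (@subsetT _ (~` K k)) g)).
  by apply/funext => k; rewrite (Y0 _ (riem_restrict _ h)) (Y0 _ (riem_restrict _ g)).
rewrite /yamabe_infty; apply: (congr1 (xget -oo%E)); apply/seteqP; split => l Hl K exK.
  by rewrite -YE; exact: Hl.
by rewrite YE; exact: Hl.
Qed.

Lemma yamabe_infty_locally_constant (g : Metr M) :
  \forall h \near g, yamabe_infty h = yamabe_infty g.
Proof.
have [Hpou|E] := pou_dichotomy; last first.
  by apply: filterE => h; exact: yamabe_pou0.
(* If there is no compact exhaustion, the condition that defines the limit is vacuous for every
   metric, and [xget] sees the same set. *)
have [[K0 exK0]|nK] := pselect (exists K0 : nat -> set M, compact_exhaustion K0); last first.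
  apply: filterE => h; rewrite /yamabe_infty; apply: (congr1 (xget -oo%E)).
  by apply/seteqP; split => l _ K exK; case: nK; exists K.
have [phi [sphi phige0 phipos phiS phiK]] := layer_functions exK0.
have /choice[S HS] : forall m, exists S, compact S /\ forall y, ~ S y -> phi m y = 0.
  by move=> m; have [S ? ?] := phiS m; exists S.
have cS m : compact (S m) by have [] := HS m.
have phi0 m y : ~ S m y -> phi m y = 0 by have [_] := HS m; exact.
have cphi m : continuous (phi m).
  by move=> y; exact: (smoothM_continuous openT (sphi m)).
have /choice[A HA] : forall m, exists A, 0 <= A /\ forall y, phi m y ^+ 2 <= A.
  move=> m; have : compact ((fun y => phi m y ^+ 2) @` S m).
    apply: continuous_compact (cS m); apply: continuous_subspaceT => y.
    have -> : (fun y => phi m y ^+ 2) = (fun y => phi m y * phi m y).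
      by apply/funext => z; rewrite expr2.
    exact: (cvgM (cphi m y) (cphi m y)).
  move=> /compact_bounded[A [_ bA]]; exists (Num.max 0 (A + 1)).
  split; first by rewrite le_max lexx.
  move=> y; rewrite le_max; apply/orP.
  have [Sy|Sy] := pselect (S m y); last by left; rewrite phi0// expr0n.
  right; apply: le_trans (ler_norm _) _; apply: (bA (A + 1)); first by rewrite ltrDl.
  by exists y.
have /choice[B HB] : forall m, exists B, 0 <= B /\
    weight_bounded g phi (fun _ => B) m.
  move=> m; have [B B0 bB] := weight_bound n3 g (sphi m) (cS m) (@phi0 m) Hpou.
  by exists B; split.
(* One denominator enforces both smallness conditions: [c m * phi m ^+ 2] and [c m * B m] are at
   most 2^-(m+1); the 1 keeps it positive. *)
pose c m := half ^+ m.+1 / (1 + A m + B m).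
have AB m : 0 < 1 + A m + B m by have [? _] := HA m; have [? _] := HB m; lra.
have hm m : 0 < half ^+ m.+1 by rewrite exprn_gt0//; lra.
have c0 m : 0 < c m by rewrite divr_gt0.
have cphi2 m y : c m * phi m y ^+ 2 <= half ^+ m.+1.
  have [A0 bA] := HA m; have [B0 _] := HB m.
  rewrite /c -mulrA ler_piMr ?(ltW (hm m))// ler_pdivrMl// mulr1.
  by apply: le_trans (bA y) _; lra.
have cB m : c m * B m <= half ^+ m.+1.
  have [A0 _] := HA m; have [B0 _] := HB m.
  rewrite /c -mulrA ler_piMr ?(ltW (hm m))// ler_pdivrMl// mulr1; lra.
have [|||W [oW gW HW]] := @fine_closeness _ _ _ g (fun m y => c m * phi m y ^+ 2) Hpou.
- move=> m y; have -> : (fun y => c m * phi m y ^+ 2) = (fun y => c m * (phi m y * phi m y)).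
    by apply/funext => z; rewrite expr2.
  exact: (cvgM (cvg_cst _) (cvgM (cphi m y) (cphi m y))).
- move=> m y; rewrite mulr_ge0 ?(ltW (c0 m)) ?sqr_ge0//=.
  by apply: le_trans (cphi2 m y) _; rewrite exprn_ile1//; lra.
- move=> y; have [m pm] := phipos y; exists m.
  by rewrite mulr_gt0// exprn_gt0.
exists W; first by split.
move=> h hW; apply: (yamabe_infty_eq Hpou exK0 sphi cS phi0 phiK _ cphi2 cB _ (HW h hW)).
  by move=> m; exact: ltW.
by move=> m; have [_ H] := HB m; exact: H.
Qed.

End YamabeTransfer.

Theorem theorem1p6 (R : realType) (n : nat) (M : manifold R n) :
  (3 <= n)%N -> ~ compact [set: M] ->
  (forall g : Metr M, \forall h \near g, yamabe_infty h = yamabe_infty g) /\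
  continuous (fun g : Metr M => yamabe_infty g).
Proof.
move=> n3 _; split; first exact: yamabe_infty_locally_constant.
move=> g A /nbhs_singleton Ag.
have := yamabe_infty_locally_constant n3 g.
by apply: filterS => h hg; rewrite /= hg.
Qed.
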